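(* Let $G$ be a surface group, that is, a finitely generated free group or the fundamental group of a closed orientable hyperbolic surface, with a fixed finite generating set. There is a constant $C$ such that for every nontrivial element $g\in G$ of word length $l(g)$ there is a subgroup $H$ of $G$ of index at most $C\,l(g)$ with $g\notin H$.
   Context: $l(g)$ is the word length of $g$ with respect to the fixed generating set. *)

(* Defs.v *)
From HB Require Import structures.
From mathcomp Require Import all_boot all_order all_algebra.
From mathcomp Require Import all_classical all_reals all_analysis.
From mathcomp Require Import complex.

Set Implicit Arguments.
Unset Strict Implicit.
Unset Printing Implicit Defensive.

Import Order.TTheory GRing.Theory Num.Theory.
Import numFieldNormedType.Exports.

Local Open Scope classical_set_scope.
Local Open Scope ring_scope.

Section Words.
Variables (G : groupType) (s : seq G).

Definition is_word (w : seq G) : Prop :=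
  forall x, x \in w -> (x \in s) || ((x^-1)%g \in s).

Definition spells (w : seq G) (g : G) : Prop :=
  is_word w /\ (\prod_(x <- w) x)%g = g.

Definition generates : Prop := forall g : G, exists w, spells w g.

Definition is_word_length (g : G) (n : nat) : Prop :=
  (exists2 w, spells w g & size w = n) /\
  (forall w, spells w g -> (n <= size w)%N).

(* Such an n is unique, and exists for every g as soon as [generates] holds;
   otherwise the value is 0. *)
Definition word_length (g : G) : nat := xget 0%N [set n | is_word_length g n].

End Words.

Definition finitely_generated (G : groupType) : Prop :=
  exists s : seq G, generates s.

Definition left_cosets (G : groupType) (H : groupClosed G) : set (set G) :=
  [set [set (x * h)%g | h in [set` H]] | x in [set: G]].

Definition free_basis (G : groupType) (I : Type) (e : I -> G) : Prop :=
  forall (K : groupType) (f : I -> K),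
    exists phi : {multiplicative G -> K},
      (forall i, phi (e i) = f i) /\
      (forall psi : {multiplicative G -> K},
         (forall i, psi (e i) = f i) -> psi =1 phi).

Definition free_group (G : groupType) : Prop :=
  exists (I : Type) (e : I -> G), free_basis e.

Section FundamentalGroup.
Variables (R : realType) (S : topologicalType) (x : S).

(* A loop is a total function on R of which only the values on [0, 1] matter. *)
Definition is_loop (f : R -> S) : Prop :=
  [/\ {within `[0, 1], continuous f}, f 0 = x & f 1 = x].

Definition loop_homotopic (f g : R -> S) : Prop :=
  exists h : R * R -> S,
    [/\ {within `[0, 1] `*` `[0, 1], continuous h},
        forall t, 0 <= t <= 1 -> h (t, 0) = f t /\ h (t, 1) = g t &
        forall u, 0 <= u <= 1 -> h (0, u) = x /\ h (1, u) = x].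

Definition loop_concat (f g : R -> S) : R -> S :=
  fun t => if t <= 2^-1 then f (2 * t) else g (2 * t - 1).

(* G is isomorphic to the group of homotopy classes of loops at x: [cls] is
   the quotient map, transported along the isomorphism. *)
Definition is_fundamental_group (G : groupType) : Prop :=
  exists cls : (R -> S) -> G,
    [/\ forall g : G, exists2 f, is_loop f & cls f = g,
        forall f1 f2, is_loop f1 -> is_loop f2 ->
          (cls f1 = cls f2 <-> loop_homotopic f1 f2) &
        forall f1 f2, is_loop f1 -> is_loop f2 ->
          cls (loop_concat f1 f2) = (cls f1 * cls f2)%g].

End FundamentalGroup.

Section HyperbolicSurface.
Variable R : realType.

(* The hyperbolic plane is the upper half-plane, in real coordinates. *)
Definition upper_half_plane : set (R * R) := [set z | 0 < z.2].

Definition affix (z : R * R) : R[i] := Complex z.1 z.2.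

(* The orientation-preserving isometries of the upper half-plane are the maps
   z |-> (a z + b) / (c z + d) with a, b, c, d real and a d - b c = 1. *)
Definition mobius (a b c d : R) (z : R * R) : R * R :=
  let w := ((a%:C * affix z + b%:C) / (c%:C * affix z + d%:C))%C in
  (complex.Re w, complex.Im w).

(* A chart (U, phi) is a homeomorphism phi from the open set U onto an open
   subset of the upper half-plane; values of phi outside U are irrelevant. *)
Definition is_chart (S : topologicalType) (U : set S) (phi : S -> R * R) : Prop :=
  [/\ open U,
      phi @` U `<=` upper_half_plane,
      {in U &, injective phi},
      {within U, continuous phi} &
      forall V, V `<=` U -> open V -> open (phi @` V)].

(* An atlas whose transition maps are locally restrictions of orientation-
   preserving isometries, i.e. an orientation together with a hyperbolic
   structure. *)
Definition oriented_hyperbolic_atlas (S : topologicalType)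
    (A : set (set S * (S -> R * R))) : Prop :=
  [/\ forall c, A c -> is_chart c.1 c.2,
      forall p : S, exists2 c, A c & c.1 p &
      forall c c' p, A c -> A c' -> c.1 p -> c'.1 p ->
        exists a b c0 d : R, a * d - b * c0 = 1 /\
          \forall q \near p, c'.2 q = mobius a b c0 d (c.2 q)].

(* Connected; closed means compact without boundary, and the absence of
   boundary is built into the charts. *)
Definition closed_orientable_hyperbolic_surface (S : topologicalType) : Prop :=
  [/\ compact [set: S], connected [set: S], hausdorff_space S &
      exists A : set (set S * (S -> R * R)), oriented_hyperbolic_atlas A].

Definition surface_group (G : groupType) : Prop :=
  (finitely_generated G /\ free_group G) \/
  (exists (S : topologicalType) (x : S),
     closed_orientable_hyperbolic_surface S /\ is_fundamental_group R x G).

End HyperbolicSurface.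

(* Main.v *)
(* For a free group, a reduced word of length [n] is read by partial
   permutations of [{0, .., n}]; extend them to permutations and take the
   stabilizer of [0].

   For a closed surface, developing the hyperbolic structure gives a holonomy
   representation into SL2(R), up to sign, acting freely and cocompactly on the
   upper half-plane. The Dirichlet tessellation of an orbit yields a
   presentation in which every letter and its inverse occur exactly once in the
   relators. Such relators can be solved explicitly: after Tietze moves, the
   only equation left is [A, B] = W^-1 up to scalars, which has a rational
   parametrization. Hence the holonomy is a real point of a family of projective
   representations over a polynomial ring Z[t1, .., tm]. If [g] is nontrivial,
   a matrix entry (or the difference of the diagonal entries) certifying that
   its image is not scalar is a nonzero polynomial of degree and logarithmic
   height O(l(g)), so it survives under some specialization to F_p with
   p = O(l(g)). There [g] moves a point of the projective line, whose stabilizer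
   has index at most p + 1. *)

Require Import Defs.
From HB Require Import structures.
From mathcomp Require Import all_boot all_order all_algebra.
From mathcomp Require Import fingroup perm.
From mathcomp Require Import all_classical all_reals all_analysis.
From mathcomp Require Import complex ring lra zify.

Set Implicit Arguments.
Unset Strict Implicit.
Unset Printing Implicit Defensive.

Import Order.TTheory GRing.Theory Num.Theory.
Import numFieldNormedType.Exports.

Local Open Scope classical_set_scope.
Local Open Scope card_scope.
Local Open Scope ring_scope.

(** * Moebius transformations and hyperbolic distance *)

(** Linear index rests on two economies. A nonzero integer of size [E^l] is prime to some [p] of
    size O(l), since the product of the primes up to x grows exponentially in x; and a point
    stabilizer on the projective line has index p + 1 at most, while PGL2(F_p) has order about p^3.
    The entries of the holonomy are arbitrary reals, and the ring they generate may have no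
    homomorphism to F_p for the required p. A polynomial ring over Z maps to F_p for every choice of
    values, and a polynomial that is nonzero mod p is nonzero at some of them once p exceeds its
    degree. This is why the relators are solved rationally. Clearing denominators in the solution
    rescales matrices, so everything is kept projective, with adjugates for inverses, and the
    determinants of the letters must be kept nonzero mod p as well. Matrices are prescribed on
    letters only; they define a homomorphism through the universal property [sp_univ], which is
    proved by continuing potentials over the half-plane. *)

Record mat2 (R : Type) := Mat2 { e11 : R; e12 : R; e21 : R; e22 : R }.

Section Mat2.
Variable R : comNzRingType.
Implicit Types M N P : mat2 R.

Definition mmul M N := Mat2
  (e11 M * e11 N + e12 M * e21 N) (e11 M * e12 N + e12 M * e22 N)
  (e21 M * e11 N + e22 M * e21 N) (e21 M * e12 N + e22 M * e22 N).
(** The adjugate is the inverse for determinant 1, and a division-free inverse up to scalars over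
    any ring. *)
Definition madj M := Mat2 (e22 M) (- e12 M) (- e21 M) (e11 M).
Definition mscale (k : R) M := Mat2 (k * e11 M) (k * e12 M) (k * e21 M) (k * e22 M).
Definition mid := Mat2 (1 : R) 0 0 1.
Definition mdet M := e11 M * e22 M - e12 M * e21 M.
Definition mtr M := e11 M + e22 M.

Lemma mmulA M N P : mmul M (mmul N P) = mmul (mmul M N) P.
Proof. by case: M N P => [? ? ? ?] [? ? ? ?] [? ? ? ?]; rewrite /mmul /=; congr Mat2; ring. Qed.
Lemma mmul1m M : mmul mid M = M.
Proof. by case: M => ? ? ? ?; rewrite /mmul /=; congr Mat2; ring. Qed.
Lemma mmulm1 M : mmul M mid = M.
Proof. by case: M => ? ? ? ?; rewrite /mmul /=; congr Mat2; ring. Qed.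
Lemma mdetM M N : mdet (mmul M N) = mdet M * mdet N.
Proof. by rewrite /mdet /=; ring. Qed.
Lemma mdet_adj M : mdet (madj M) = mdet M.
Proof. by rewrite /mdet /=; ring. Qed.
Lemma mtr_adj M : mtr (madj M) = mtr M.
Proof. by rewrite /mtr /=; ring. Qed.
Lemma mdet1 : mdet mid = 1.
Proof. by rewrite /mdet /=; ring. Qed.
Lemma mdetZ k M : mdet (mscale k M) = k ^+ 2 * mdet M.
Proof. by rewrite /mdet /=; ring. Qed.
Lemma mtrZ k M : mtr (mscale k M) = k * mtr M.
Proof. by rewrite /mtr /=; ring. Qed.
Lemma mmul_adj M : mmul M (madj M) = mscale (mdet M) mid.
Proof. by case: M => ? ? ? ?; rewrite /mmul /mscale /mdet /=; congr Mat2; ring. Qed.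
Lemma madj_mul M : mmul (madj M) M = mscale (mdet M) mid.
Proof. by case: M => ? ? ? ?; rewrite /mmul /mscale /mdet /=; congr Mat2; ring. Qed.
Lemma madjM M N : madj (mmul M N) = mmul (madj N) (madj M).
Proof. by case: M N => ? ? ? ? [? ? ? ?]; rewrite /mmul /madj /=; congr Mat2; ring. Qed.
Lemma madjK M : madj (madj M) = M.
Proof. by case: M => ? ? ? ?; rewrite /madj /= !opprK. Qed.
Lemma mscaleM k l M N : mmul (mscale k M) (mscale l N) = mscale (k * l) (mmul M N).
Proof. by case: M N => ? ? ? ? [? ? ? ?]; rewrite /mmul /mscale /=; congr Mat2; ring. Qed.
Lemma mscaleA k l M : mscale k (mscale l M) = mscale (k * l) M.
Proof. by rewrite /mscale /= !mulrA. Qed.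
Lemma mscale1 M : mscale 1 M = M.
Proof. by case: M => ? ? ? ?; rewrite /mscale /= !mul1r. Qed.
Lemma madjZ k M : madj (mscale k M) = mscale k (madj M).
Proof. by rewrite /madj /mscale /= !mulrN. Qed.
Lemma madj1 : madj mid = mid.
Proof. by rewrite /madj /= oppr0. Qed.

Lemma mscaleAl k M N : mmul (mscale k M) N = mscale k (mmul M N).
Proof. by rewrite -{1}[N]mscale1 mscaleM mulr1. Qed.
Lemma mscaleAr k M N : mmul M (mscale k N) = mscale k (mmul M N).
Proof. by rewrite -{1}[M]mscale1 mscaleM mul1r. Qed.
End Mat2.

Section HalfPlane.
Variable R : realType.
Implicit Types (M N : mat2 R) (z w : R * R).

Definition mob M z := mobius (e11 M) (e12 M) (e21 M) (e22 M) z.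
Definition mden M z := (e21 M * z.1 + e22 M) ^+ 2 + (e21 M * z.2) ^+ 2.

Lemma mden_gt0 M z : mdet M = 1 -> 0 < z.2 -> 0 < mden M z.
Proof.
case: M z => a b c d [x y]; rewrite /mdet /mden /= => h y0.
have [c0|c0] := eqVneq c 0.
  rewrite c0 !mul0r add0r expr0n /= addr0 exprn_even_gt0 //=.
  by apply: contra_eq_neq h => ->; rewrite c0 !mulr0 subr0 eq_sym oner_eq0.
by rewrite ltr_wpDl ?sqr_ge0 // exprn_even_gt0 //= mulf_neq0 // gt_eqF.
Qed.


Lemma mobE M z : mob M z =
  (((e11 M * z.1 + e12 M) * (e21 M * z.1 + e22 M) + e11 M * e21 M * z.2 ^+ 2)
     / mden M z, mdet M * z.2 / mden M z).
Proof.
case: M z => a b c d [x y]; rewrite /mob /mobius /mden /mdet /affix /=.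
by simpc; congr pair => /=; ring.
Qed.

Lemma mob_H M z : mdet M = 1 -> 0 < z.2 -> 0 < (mob M z).2.
Proof. by move=> h z0; rewrite mobE /= h mul1r divr_gt0 // mden_gt0. Qed.


Lemma affix_inj z w : affix z = affix w -> z = w.
Proof. by case: z w => [x y] [x' y'] [-> ->]. Qed.

Lemma complex_eta (c : R[i]) : Complex (complex.Re c) (complex.Im c) = c.
Proof. by case: c. Qed.

Lemma affix_mob M z : affix (mob M z) =
  (((e11 M)%:C * affix z + (e12 M)%:C) / ((e21 M)%:C * affix z + (e22 M)%:C))%C.
Proof. by rewrite -[RHS]complex_eta. Qed.

Definition sqn (c : R[i]) : R := complex.Re c ^+ 2 + complex.Im c ^+ 2.

Lemma sqnM c d : sqn (c * d) = sqn c * sqn d.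
Proof. by case: c d => a b [a' b']; rewrite /sqn; simpc => /=; ring. Qed.

Lemma sqn_eq0 c : (sqn c == 0) = (c == 0).
Proof.
case: c => a b; rewrite /sqn /= paddr_eq0 ?sqr_ge0 // !sqrf_eq0.
by rewrite eq_complex.
Qed.

Lemma sqnV c : sqn c^-1 = (sqn c)^-1.
Proof.
have [->|c0] := eqVneq c 0; first by rewrite invr0 /sqn /= !expr0n /= addr0 invr0.
apply: (mulfI (_ : sqn c != 0)); first by rewrite sqn_eq0.
by rewrite -sqnM !divff ?sqn_eq0 // /sqn /= expr1n expr0n addr0.
Qed.

Lemma mden_sqn M z : mden M z = sqn ((e21 M)%:C * affix z + (e22 M)%:C)%C.
Proof. by rewrite /mden /sqn /affix /=; simpc. Qed.

Lemma mden_neq0 M z : mdet M = 1 -> 0 < z.2 ->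
  ((e21 M)%:C * affix z + (e22 M)%:C)%C != 0.
Proof. by move=> h z0; rewrite -sqn_eq0 -mden_sqn gt_eqF // mden_gt0. Qed.

Lemma mobM M N z : mdet M = 1 -> mdet N = 1 -> 0 < z.2 ->
  mob (mmul M N) z = mob M (mob N z).
Proof.
move=> hM hN z0; apply: affix_inj.
have d1 := mden_neq0 hN z0; have d2 := mden_neq0 hM (mob_H hN z0).
have d3 : mdet (mmul M N) = 1 by rewrite mdetM hM hN mulr1.
have := mden_neq0 d3 z0; move: d1 d2.
rewrite !affix_mob; set Z := affix z; case: M hM {d3} => a b c d hM.
case: N hN => a' b' c' d' hN /=; rewrite !rmorphD !rmorphM /= => d1 d2 d3.
field; rewrite d1 /=; move: d3; apply: contraNneq => e.
by apply/eqP; rewrite -e; ring.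
Qed.

Lemma mob1 z : mob (mid R) z = z.
Proof.
apply: affix_inj; rewrite affix_mob /= mul1r mul0r addr0 add0r.
by rewrite divr1.
Qed.

Lemma mobN M z : mob (mscale (-1) M) z = mob M z.
Proof.
apply: affix_inj; rewrite !affix_mob /= !mulN1r !rmorphN /=.
by rewrite !mulNr -!opprD invrN mulrNN.
Qed.

Lemma mobK M z : mdet M = 1 -> 0 < z.2 -> mob (madj M) (mob M z) = z.
Proof.
by move=> h z0; rewrite -mobM ?mdet_adj // madj_mul h mscale1 mob1.
Qed.

Lemma mobVK M z : mdet M = 1 -> 0 < z.2 -> mob M (mob (madj M) z) = z.
Proof.
by move=> h z0; rewrite -mobM ?mdet_adj // mmul_adj h mscale1 mob1.
Qed.

(* [hd z w = 2 (cosh d(z, w) - 1)] for the hyperbolic distance [d]. *)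
Definition hd z w := ((z.1 - w.1) ^+ 2 + (z.2 - w.2) ^+ 2) / (z.2 * w.2).

Lemma hd_ge0 z w : 0 < z.2 -> 0 < w.2 -> 0 <= hd z w.
Proof. by move=> *; rewrite divr_ge0 ?addr_ge0 ?sqr_ge0 // mulr_ge0 // ltW. Qed.

Lemma hdC z w : hd z w = hd w z.
Proof. by rewrite /hd [w.2 * _]mulrC; congr (_ * _); ring. Qed.

Lemma hd_eq0 z w : 0 < z.2 -> 0 < w.2 -> hd z w = 0 -> z = w.
Proof.
move=> z0 w0 /eqP; rewrite /hd mulf_eq0 invr_eq0 mulf_eq0 (gt_eqF z0) (gt_eqF w0).
rewrite !orbF paddr_eq0 ?sqr_ge0 // !sqrf_eq0 !subr_eq0 => /andP[/eqP h1 /eqP h2].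
by case: z w h1 h2 {z0 w0} => [? ?] [? ?] /= -> ->.
Qed.

Lemma hdxx z : hd z z = 0.
Proof. by rewrite /hd !subrr expr0n /= addr0 mul0r. Qed.

Lemma hd_sqn z w : hd z w = sqn (affix z - affix w) / (z.2 * w.2).
Proof. by rewrite /hd /sqn /affix; simpc. Qed.

Lemma hd_mob M z w : mdet M = 1 -> 0 < z.2 -> 0 < w.2 ->
  hd (mob M z) (mob M w) = hd z w.
Proof.
move=> h z0 w0; have dz := mden_neq0 h z0; have dw := mden_neq0 h w0.
rewrite !hd_sqn !affix_mob.
have -> : (((e11 M)%:C * affix z + (e12 M)%:C) / ((e21 M)%:C * affix z + (e22 M)%:C)
  - ((e11 M)%:C * affix w + (e12 M)%:C) / ((e21 M)%:C * affix w + (e22 M)%:C))%C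
  = ((affix z - affix w) / (((e21 M)%:C * affix z + (e22 M)%:C) *
     ((e21 M)%:C * affix w + (e22 M)%:C)))%C.
  have hc : ((e11 M)%:C * (e22 M)%:C - (e12 M)%:C * (e21 M)%:C = 1)%C.
    by rewrite -!rmorphM -rmorphB /= -[LHS]/(_%:C)%C; congr (_%:C)%C.
  rewrite -[X in _ = X / _]mul1r -hc; field.
  by rewrite dz dw.
rewrite sqnM sqnV sqnM -!mden_sqn !mobE /= h.
have ez : mden M z != 0 by rewrite gt_eqF // mden_gt0.
have ew : mden M w != 0 by rewrite gt_eqF // mden_gt0.
by field; rewrite ez ew !gt_eqF.
Qed.

(** The numerator is the squared modulus of [c z^2 + (d - a) z - b], the quadratic whose zeros are
    the fixed points. *)
Lemma hd_self M z : mdet M = 1 -> 0 < z.2 -> hd (mob M z) z =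
  ((e21 M * (z.1 ^+ 2 - z.2 ^+ 2) + (e22 M - e11 M) * z.1 - e12 M) ^+ 2 +
   (2 * e21 M * z.1 * z.2 + (e22 M - e11 M) * z.2) ^+ 2) / z.2 ^+ 2.
Proof.
move=> h z0; have dz := mden_neq0 h z0.
rewrite !hd_sqn !affix_mob.
have -> : (((e11 M)%:C * affix z + (e12 M)%:C) / ((e21 M)%:C * affix z + (e22 M)%:C)
  - affix z)%C = (((e11 M)%:C * affix z + (e12 M)%:C -
   affix z * ((e21 M)%:C * affix z + (e22 M)%:C)) / ((e21 M)%:C * affix z + (e22 M)%:C))%C.
  by field; rewrite dz.
rewrite sqnM sqnV -!mden_sqn !mobE /= h.
have ez : mden M z != 0 by rewrite gt_eqF // mden_gt0.
rewrite /sqn /affix; simpc => /=.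
by field; rewrite ez !gt_eqF.
Qed.

(** The imaginary part of [c z^2 + (d - a) z - b] vanishes at two points of equal height; the
    difference gives [c = 0], and then [a = d] and [b = 0]. *)
Lemma mob_fix3 M (x y e : R) : mdet M = 1 -> 0 < y -> 0 < e ->
  mob M (x, y) = (x, y) -> mob M (x + e, y) = (x + e, y) ->
  M = mid R \/ M = mscale (-1) (mid R).
Proof.
move=> h y0 e0 f1 f2.
have z0 : (0 : R) < ((x, y) : R * R).2 by [].
have z1 : (0 : R) < ((x + e, y) : R * R).2 by [].
have := hd_self h z0; have := hd_self h z1; rewrite f1 f2 !hdxx /=.
have y2 : y ^+ 2 != 0 by rewrite sqrf_eq0 gt_eqF.
have aux (a b : R) : 0 = (a ^+ 2 + b ^+ 2) / y ^+ 2 -> a = 0 /\ b = 0.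
  move/esym/eqP; rewrite mulf_eq0 invr_eq0 (negPf y2) orbF paddr_eq0 ?sqr_ge0 //.
  by rewrite !sqrf_eq0 => /andP[/eqP ? /eqP ?].
move=> /aux[_ b2] /aux[a1 b1].
have c0 : e21 M = 0.
  have : e21 M * (2 * e * y) = 0 by lra.
  by move/eqP; rewrite mulf_eq0 => /orP[/eqP //|]; rewrite !mulf_eq0 !gt_eqF ?ltr0n.
move: b1 a1 h; rewrite c0 !mulr0 !mul0r !add0r => /eqP; rewrite mulf_eq0 (gt_eqF y0) orbF.
rewrite subr_eq0 => /eqP da; rewrite da subrr mul0r => /eqP.
rewrite sub0r oppr_eq0 => /eqP b0; rewrite /mdet c0 b0 da !mul0r subr0.
move=> /eqP; rewrite -expr2 sqrf_eq1 => /orP[] /eqP a1.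
  by left; case: M c0 b0 da a1 {f1 f2 b2} => a b c d /= -> -> -> ->.
by right; case: M c0 b0 da a1 {f1 f2 b2} => a b c d /= -> -> -> ->; rewrite /mscale /=; congr Mat2; ring.
Qed.

Lemma cvg_pairR (T : Type) (F : set_system T) {FF : Filter F} (f g : T -> R) (a b : R) :
  f @ F --> a -> g @ F --> b -> (f x, g x) @[x --> F] --> (a, b).
Proof. by move=> fa gb; exact: (cvg_pair (G := nbhs a) (H := nbhs b) fa gb). Qed.

Lemma mob_cont M z : mdet M = 1 -> 0 < z.2 -> mob M w @[w --> z] --> mob M z.
Proof.
move=> h z0.
have -> : mob M = (fun z => (((e11 M * z.1 + e12 M) * (e21 M * z.1 + e22 M) + e11 M * e21 M * z.2 ^+ 2)
     / mden M z, mdet M * z.2 / mden M z)) by apply/funext => w; exact: mobE.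
have c1 : (fst : R * R -> R) x @[x --> z] --> z.1 by exact: cvg_fst.
have c2 : (snd : R * R -> R) x @[x --> z] --> z.2 by exact: cvg_snd.
have lin (a b : R) : (a * v.1 + b) @[v --> z] --> a * z.1 + b.
  by apply: (cvgD (cvgM (cvg_cst a) c1) (cvg_cst b)).
have cy (a : R) : (a * v.2) @[v --> z] --> a * z.2 by exact: (cvgM (cvg_cst a) c2).
have cd : mden M x @[x --> z] --> mden M z.
  by rewrite /mden; apply: cvgD; rewrite !expr2; [exact: (cvgM (lin _ _) (lin _ _)) | exact: (cvgM (cy _) (cy _))].
have ez : mden M z != 0 by rewrite gt_eqF // mden_gt0.
have ci : (mden M v)^-1 @[v --> z] --> (mden M z)^-1 by exact: (cvgV ez cd).
have c3 : (e11 M * e21 M * v.2 ^+ 2) @[v --> z] --> e11 M * e21 M * z.2 ^+ 2.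
  by rewrite expr2; exact: (cvgM (cvg_cst _) (cvgM c2 c2)).
have h2 : (mdet M * v.2 / mden M v) @[v --> z] --> mdet M * z.2 / mden M z.
  exact: (cvgM (cy _) ci).
have h1 : (((e11 M * v.1 + e12 M) * (e21 M * v.1 + e22 M) + e11 M * e21 M * v.2 ^+ 2) / mden M v) @[v --> z]
   --> ((e11 M * z.1 + e12 M) * (e21 M * z.1 + e22 M) + e11 M * e21 M * z.2 ^+ 2) / mden M z.
  exact: (cvgM (cvgD (cvgM (lin _ _) (lin _ _)) c3) ci).
exact: (cvg_pairR h1 h2).
Qed.

Lemma near_H z : 0 < z.2 -> \forall w \near z, 0 < w.2 :> R.
Proof.
move=> z0; have c2 : (snd : R * R -> R) x @[x --> z] --> z.2 by exact: cvg_snd.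
exact: cvgr_gt c2 _ z0.
Qed.

Lemma near_mob (P : R * R -> Prop) M z : mdet M = 1 -> 0 < z.2 ->
  (\forall w \near mob M z, P w) -> \forall w \near z, P (mob M w).
Proof. by move=> h z0 /(mob_cont h z0). Qed.

Lemma hd_cont z w : 0 < z.2 -> 0 < w.2 -> hd v w @[v --> z] --> hd z w.
Proof.
move=> z0 w0.
have c1 : (fst : R * R -> R) x @[x --> z] --> z.1 by exact: cvg_fst.
have c2 : (snd : R * R -> R) x @[x --> z] --> z.2 by exact: cvg_snd.
rewrite /hd; apply: cvgM; last first.
  apply: cvgV; first by rewrite mulf_neq0 ?gt_eqF.
  by apply: cvgM; [exact: c2 | exact: cvg_cst].
by apply: cvgD; rewrite !expr2; apply: cvgM; apply: cvgB;
  first [exact: c1 | exact: c2 | exact: cvg_cst].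
Qed.

Lemma near_hd z (e : R) : 0 < z.2 -> 0 < e -> \forall w \near z, hd w z < e.
Proof.
by move=> z0 e0; apply: (cvgr_lt (hd z z) (hd_cont z0 z0)); rewrite hdxx.
Qed.

(** [hd < 1] keeps the ratio of heights below [(3 + sqrt 5) / 2]; 3 is a round value above it. *)
Lemma hd_im z w (e : R) : 0 < z.2 -> 0 < w.2 -> e <= 1 -> hd w z < e ->
  w.2 < 3 * z.2.
Proof.
move=> z0 w0 e1; rewrite /hd ltr_pdivrMr ?mulr_gt0 // => h.
rewrite ltNge; apply/negP => h3.
have h4 : e * (w.2 * z.2) <= w.2 * z.2 by rewrite ger_pMl // mulr_gt0.
have : (w.1 - z.1) ^+ 2 >= 0 by rewrite sqr_ge0.
have : w.2 * (w.2 - 3 * z.2) >= 0 by rewrite mulr_ge0 ?subr_ge0 // ltW.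
have : z.2 ^+ 2 > 0 by rewrite exprn_gt0.
by nra.
Qed.

Lemma hd_close z w (e : R) : 0 < z.2 -> 0 < w.2 -> e <= 1 -> hd w z < e ->
  (w.1 - z.1) ^+ 2 < 3 * e * z.2 ^+ 2 /\ (w.2 - z.2) ^+ 2 < 3 * e * z.2 ^+ 2.
Proof.
move=> z0 w0 e1 h; have h3 := hd_im z0 w0 e1 h.
have e0 : 0 < e by apply: le_lt_trans h; exact: hd_ge0.
move: h; rewrite /hd ltr_pdivrMr ?mulr_gt0 // => h.
have h4 : e * (w.2 * z.2) < 3 * e * z.2 ^+ 2.
  rewrite -subr_gt0; have -> : 3 * e * z.2 ^+ 2 - e * (w.2 * z.2) = e * z.2 * (3 * z.2 - w.2) by ring.
  by rewrite !mulr_gt0 // subr_gt0.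
have s1 : (w.1 - z.1) ^+ 2 >= 0 by rewrite sqr_ge0.
have s2 : (w.2 - z.2) ^+ 2 >= 0 by rewrite sqr_ge0.
by split; lra.
Qed.
End HalfPlane.

(** * Gluing over rectangles *)

Section Cousin.
Variable R : realType.

(** Compactness of the interval: [Q a] holds up to its supremum, and the local hypothesis there
    carries it further unless the supremum is [b]. *)
Lemma cousin (Q : R -> R -> Prop) (a b : R) : a <= b ->
  (forall x, a <= x <= b -> exists2 e, 0 < e & forall c d, a <= c <= x -> x <= d <= b ->
     d - c < e -> Q c d) ->
  (forall c m d, a <= c <= m -> m <= d <= b -> Q c m -> Q m d -> Q c d) -> Q a b.
Proof.
move=> ab loc add.
pose E := [set t | a <= t <= b /\ Q a t].
have Ea : E a.
  have [|e e0 h] := loc a; first by rewrite lexx.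
  by split; [rewrite lexx | apply: h; rewrite ?lexx ?subrr].
have Eub : has_ubound E by exists b => t [/andP[]].
have Esup : has_sup E by split=> //; exists a.
have am : a <= sup E by apply: ub_le_sup.
have mb : sup E <= b by apply: ge_sup; [exists a | move=> t [/andP[]]].
have [|e e0 he] := loc (sup E); first by rewrite am.
have [t [/andP[at_ tb] Qt] tm] := sup_adherent (divr_gt0 e0 (ltr0n R 2)) Esup.
have tle : t <= sup E by apply: ub_le_sup => //; rewrite /E /= at_ tb.
(* Since [t > sup E - e / 2], the piece from [t] to [s] is shorter than [e / 2 + e / 3 < e]. *)
pose s := Num.min b (sup E + e / 3).
have sm : sup E <= s by rewrite le_min mb lerDl divr_ge0 // ltW.
have sb : s <= b by rewrite ge_min lexx.
have s3 : s <= sup E + e / 3 by rewrite ge_min lexx orbT.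
have Qs : Q a s.
  apply: (add a t s) => //; rewrite ?lexx ?at_ ?(le_trans tle sm) //.
  by apply: he; rewrite ?at_ ?tle ?sm //; lra.
have sE : s <= sup E by apply: ub_le_sup => //; split=> //; rewrite (le_trans am sm).
suff -> : b = s by [].
by move: sE; rewrite /s minElt; case: ifP => // _ h; move: h e0; lra.
Qed.

(* Local statements on rectangles that can be glued hold on every rectangle. *)
Lemma rect_ind (P : R -> R -> R -> R -> Prop) (a b c d : R) : a <= b -> c <= d ->
  (forall x y, a <= x <= b -> c <= y <= d -> exists2 e, 0 < e &
     forall a' b' c' d', a <= a' <= x -> x <= b' <= b -> c <= c' <= y -> y <= d' <= d ->
       b' - a' < e -> d' - c' < e -> P a' b' c' d') ->
  (forall a' m b' c' d', a <= a' <= m -> m <= b' <= b -> c <= c' <= d' -> d' <= d ->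
     P a' m c' d' -> P m b' c' d' -> P a' b' c' d') ->
  (forall a' b' c' m d', a <= a' <= b' -> b' <= b -> c <= c' <= m -> m <= d' <= d ->
     P a' b' c' m -> P a' b' m d' -> P a' b' c' d') ->
  P a b c d.
Proof.
move=> ab cd loc addx addy.
apply: (cousin (Q := fun a' b' => P a' b' c d)) => //; last first.
  by move=> a' m b' h1 h2; apply: addx; rewrite ?lexx.
move=> x hx.
(* Thin columns around [x]: their width may shrink each time two of them are stacked, so it is part
   of [Q]. *)
pose Q c' d' := exists2 e, 0 < e &
  forall a' b', a <= a' <= x -> x <= b' <= b -> b' - a' < e -> P a' b' c' d'.
apply: (cousin (Q := Q)) => //.
  move=> y hy; have [e e0 h] := loc x y hx hy.
  by exists e => // c' d' hc hd hcd; exists e => // a' b' ha hb hab; exact: h.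
move=> c' m d' hc hd [e1 e10 h1] [e2 e20 h2].
exists (Num.min e1 e2); first by rewrite lt_min e10.
move=> a' b' ha hb; rewrite lt_min => /andP[l1 l2].
apply: (addy _ _ _ m) => //; [|by case/andP: hb|exact: h1|exact: h2].
by case/andP: ha => -> h; case/andP: hb => /(le_trans h) ->.
Qed.

(** Connectedness of the unit interval, in the form used for continuation along segments: [P] has
    only to be locally constant. *)
Lemma seg_ind (P : R -> Prop) :
  (forall t : R, 0 <= t <= 1 -> exists2 U, nbhs t U & forall s s', U s -> U s' ->
     0 <= s <= 1 -> 0 <= s' <= 1 -> P s -> P s') -> P 0 -> P 1.
Proof.
move=> loc; apply: (cousin (Q := fun s t => P s -> P t)) => //; last first.
  by move=> c m d _ _ h1 h2 /h1.
move=> x hx; have [U /nbhs_ballP[e /= e0 xU] h] := loc x hx.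
exists e => // c d /andP[c0 cx] /andP[xd d1] dc.
apply: h; rewrite ?c0 ?d1 ?(le_trans cx) ?(le_trans c0) //; try (by apply: le_trans d1);
  try (by apply: le_trans xd; case/andP: hx).
all: apply: xU; rewrite /ball /= ltr_norml; apply/andP; split; lra.
Qed.
End Cousin.

(** * Euclidean segments in the half-plane *)

Definition pt (R : realType) (z w : R * R) (t : R) : R * R :=
  (z.1 + t * (w.1 - z.1), z.2 + t * (w.2 - z.2)).

Section Points.
Variable R : realType.
Implicit Types z w u : R * R.

Lemma pt0 z w : pt z w 0 = z.
Proof. by case: z => ? ?; rewrite /pt /= !mul0r !addr0. Qed.
Lemma pt1 z w : pt z w 1 = w.
Proof. by case: z w => ? ? [? ?]; rewrite /pt /= !mul1r ![_ + (_ - _)]addrC !subrK. Qed.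

Lemma pt_cont z w (t : R) : pt z w s @[s --> t] --> pt z w t.
Proof.
have h (a b : R) : (a + s * b) @[s --> t] --> a + t * b.
  by apply: (cvgD (cvg_cst a) (cvgM _ (cvg_cst b))); exact: cvg_id.
exact: (cvg_pairR (h _ _) (h _ _)).
Qed.

Lemma pt_H z w (t : R) : 0 < z.2 -> 0 < w.2 -> 0 <= t <= 1 -> 0 < (pt z w t).2.
Proof.
move=> z0 w0 /andP[t0 t1] /=; have [->|tn0] := eqVneq t 0; first by rewrite mul0r addr0.
have tp : 0 < t by rewrite lt_neqAle eq_sym tn0.
have -> : z.2 + t * (w.2 - z.2) = (1 - t) * z.2 + t * w.2 by ring.
by rewrite ltr_wpDl ?mulr_gt0 // mulr_ge0 ?subr_ge0 // ltW.
Qed.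

Lemma pt_rect z w (t a b c d : R) : 0 <= t <= 1 -> a <= z.1 <= b -> c <= z.2 <= d ->
  a <= w.1 <= b -> c <= w.2 <= d ->
  a <= (pt z w t).1 <= b /\ c <= (pt z w t).2 <= d.
Proof.
move=> /andP[t0 t1] /andP[h1 h2] /andP[h3 h4] /andP[h5 h6] /andP[h7 h8].
by split; apply/andP; split; rewrite /pt /=; nra.
Qed.

(** Hyperbolic balls are Euclidean discs, so straight segments from the centre stay inside. Straight
    segments also stay in rectangles, which geodesics need not do. *)
Lemma pt_ball z w (t e : R) : 0 < z.2 -> 0 < w.2 -> 0 <= t <= 1 -> hd w z < e ->
  hd (pt z w t) z < e.
Proof.
move=> z0 w0 ht h; have p0 := pt_H z0 w0 ht; case/andP: ht => t0 t1.
have e0 : 0 < e by apply: le_lt_trans h; exact: hd_ge0.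
move: h p0; rewrite /hd /pt /= => h p0; rewrite ltr_pdivrMr ?mulr_gt0 //.
move: h; rewrite ltr_pdivrMr ?mulr_gt0 // => h.
set q := (w.1 - z.1) ^+ 2 + (w.2 - z.2) ^+ 2 in h.
have -> : (z.1 + t * (w.1 - z.1) - z.1) ^+ 2 + (z.2 + t * (w.2 - z.2) - z.2) ^+ 2 = t * (t * q).
  by rewrite /q; ring.
have q0 : 0 <= q by rewrite addr_ge0 ?sqr_ge0.
have -> : e * ((z.2 + t * (w.2 - z.2)) * z.2) = (1 - t) * (e * z.2 ^+ 2) + t * (e * (w.2 * z.2)) by ring.
have ez : 0 < e * z.2 ^+ 2 by rewrite mulr_gt0 // exprn_gt0.
have [->|tn0] := eqVneq t 0; first by rewrite !mul0r subr0 mul1r addr0.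
have tp : 0 < t by rewrite lt_neqAle eq_sym tn0.
have h3 : t * q < t * (e * (w.2 * z.2)) by rewrite ltr_pM2l.
have h4 : t * (t * q) <= t * q by rewrite ler_pM2l // ler_piMl.
have h5 : 0 <= (1 - t) * (e * z.2 ^+ 2) by rewrite mulr_ge0 ?subr_ge0 // ltW.
by move: h3 h4 h5; clear; lra.
Qed.

(** [hd] behaves like a squared distance: [|w - z|^2 <= 2 |w - u|^2 + 2 |u - z|^2], and [u.2 / z.2]
    and [u.2 / w.2] are below 3 by [hd_im], whence [12 = 2 * 3 + 2 * 3]. *)
Lemma hd_triangle z u w (e : R) : 0 < z.2 -> 0 < u.2 -> 0 < w.2 -> e <= 1 ->
  hd w u < e -> hd u z < e -> hd w z < 12 * e.
Proof.
move=> z0 u0 w0 e1 h1 h2; have l2 := hd_im z0 u0 e1 h2.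
have l1 : u.2 < 3 * w.2 by apply: hd_im e1 _ => //; rewrite hdC.
have e0 : 0 < e by apply: le_lt_trans h1; exact: hd_ge0.
move: h1 h2; rewrite /hd !ltr_pdivrMr ?mulr_gt0 // => h1 h2.
have s1 : 0 <= (w.1 - u.1 - (u.1 - z.1)) ^+ 2 by rewrite sqr_ge0.
have s2 : 0 <= (w.2 - u.2 - (u.2 - z.2)) ^+ 2 by rewrite sqr_ge0.
have : e * (w.2 * u.2) < e * (w.2 * (3 * z.2)) by rewrite ltr_pM2l // ltr_pM2l.
have : e * (u.2 * z.2) < e * (3 * w.2 * z.2) by rewrite ltr_pM2l // ltr_pM2r.
by nra.
Qed.

Lemma hd_small (y e : R) : 0 < y -> 0 < e -> exists2 del, 0 < del & forall z w,
  y - del < z.2 -> y - del < w.2 -> `|w.1 - z.1| < del -> `|w.2 - z.2| < del -> hd w z < e.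
Proof.
move=> y0 e0.
have s0 : 0 < Num.sqrt (e / 8) by rewrite sqrtr_gt0 divr_gt0.
(* Heights stay above [3 / 4 * y], so the denominator exceeds [9 / 16 * y ^+ 2], while the two
   squares add up to less than [e / 4 * y ^+ 2]. *)
set del := Num.min (y / 4) (Num.sqrt (e / 8) * y).
have [d1 d2] : del <= y / 4 /\ del <= Num.sqrt (e / 8) * y.
  by rewrite !ge_min !lexx orbT.
have d0 : 0 < del by rewrite lt_min !mulr_gt0 ?invr_gt0.
exists del => // z w hz hw h1 h2.
have z0 : 3 / 4 * y < z.2 by lra.
have w0 : 3 / 4 * y < w.2 by lra.
have z00 : 0 < z.2 by lra. have w00 : 0 < w.2 by lra.
have aux (x : R) : `|x| < del -> x ^+ 2 < e / 8 * y ^+ 2.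
  move=> hx; rewrite -[e / 8]sqr_sqrtr ?divr_ge0 ?ltW // -exprMn -[x ^+ 2]real_normK ?num_real //.
  have h3 := lt_le_trans hx d2.
  by rewrite ltr_sqr ?nnegrE //; apply: mulr_ge0; exact: ltW.
rewrite /hd ltr_pdivrMr ?mulr_gt0 //.
have := aux _ h1; have := aux _ h2.
have : 3 / 4 * y * (3 / 4 * y) < w.2 * z.2 by apply: ltr_pM => //; lra.
rewrite -(ltr_pM2l e0); nra.
Qed.
End Points.

(** * The developing map *)

(** Equality of germs at [z]. *)
Definition agree (X Y : topologicalType) (f g : X -> Y) (z : X) := \forall w \near z, f w = g w.

Definition rect (R : realType) (a b c d : R) : set (R * R) :=
  [set z | a <= z.1 <= b /\ c <= z.2 <= d].

Section Developing.
Variables (R : realType) (S : topologicalType) (A : set (set S * (S -> R * R))).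
Hypothesis HA : oriented_hyperbolic_atlas A.
Hypothesis hS : hausdorff_space S.
Implicit Types (z w : R * R) (D : R * R -> S) (M N : mat2 R).

Lemma chart_open c : A c -> open c.1.
Proof. by case: HA => h _ _ /h[]. Qed.
Lemma chart_H c s : A c -> c.1 s -> 0 < (c.2 s).2.
Proof. by case: HA => h _ _ /h[_ hs _ _ _] cs; apply: hs; exists s. Qed.
Lemma chart_inj c s t : A c -> c.1 s -> c.1 t -> c.2 s = c.2 t -> s = t.
Proof. by case: HA => h _ _ /h[_ _ hi _ _] cs ct; apply: hi; rewrite inE. Qed.
Lemma chart_cont c s : A c -> c.1 s -> c.2 t @[t --> s] --> c.2 s.
Proof.
case: HA => h _ _ /h[ho _ _ hc _] cs.
by move: hc; rewrite continuous_open_subspace // => /(_ s); apply; rewrite inE.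
Qed.
Lemma chart_image c (V : set S) : A c -> V `<=` c.1 -> open V -> open (c.2 @` V).
Proof. by case: HA => h _ _ /h[_ _ _ _]; apply. Qed.
Lemma chart_at s : exists2 c, A c & c.1 s.
Proof. by case: HA. Qed.
Lemma near_chart c s : A c -> c.1 s -> \forall t \near s, c.1 t.
Proof. by move=> Ac cs; apply: open_nbhs_nbhs; split=> //; exact: chart_open. Qed.

Lemma transition c c' s : A c -> A c' -> c.1 s -> c'.1 s ->
  exists2 N, mdet N = 1 & \forall t \near s, c'.2 t = mob N (c.2 t).
Proof.
case: HA => _ _ h Ac Ac' cs cs'; have [a [b [d [e [de h']]]]] := h _ _ _ Ac Ac' cs cs'.
by exists (Mat2 a b d e).
Qed.

(* [D] is near [z] the inverse of a chart, up to a Moebius transformation. *)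
Definition good D z := exists c M, [/\ A c, mdet M = 1 &
  \forall w \near z, c.1 (D w) /\ c.2 (D w) = mob M w].

(** Near [z], [D] inverts a chart after a Moebius map, and charts are open maps on their domains. *)
Lemma good_cont D z : 0 < z.2 -> good D z -> D w @[w --> z] --> D z.
Proof.
move=> z0 [c [M [Ac hM hD]]] V Vz.
have [cz ez] := nbhs_singleton hD.
have oW : open (V^° `&` c.1) by apply: openI; [exact: open_interior | exact: chart_open].
have oI := chart_image Ac (@subIsetr _ _ _) oW.
have : \forall w \near mob M z, (c.2 @` (V^° `&` c.1)) w.
  by apply: open_nbhs_nbhs; split=> //; exists (D z).
move=> /(near_mob hM z0) h; rewrite /nbhs /=; near=> w.
have [cw ew] : c.1 (D w) /\ c.2 (D w) = mob M w by near: w.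
have [s [Vs cs] es] : (c.2 @` (V^° `&` c.1)) (mob M w) by near: w.
suff e : s = D w by rewrite /= -e; exact: interior_subset.
by apply: (chart_inj Ac cs cw); rewrite es.
Unshelve. all: by end_near. Qed.

Lemma good_agree D D' z : agree D D' z -> good D z -> good D' z.
Proof.
move=> h [c [M [Ac hM hD]]]; exists c, M; split=> //.
by near=> w; rewrite -(near h w) //; near: w.
Unshelve. all: by end_near. Qed.

Lemma good_chart D z c : 0 < z.2 -> good D z -> A c -> c.1 (D z) ->
  exists2 M, mdet M = 1 & \forall w \near z, c.1 (D w) /\ c.2 (D w) = mob M w.
Proof.
move=> z0 gD Ac cz; have Dc := good_cont z0 gD.
have [c' [M [Ac' hM hD]]] := gD; have [cz' _] := nbhs_singleton hD.
have [N hN hT] := transition Ac' Ac cz' cz.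
exists (mmul N M); first by rewrite mdetM hN hM mulr1.
have h1 := Dc _ hT; have h2 := Dc _ (near_chart Ac cz); have h3 := near_H z0.
near=> w; have w0 : 0 < w.2 by near: w.
split; first by near: w.
have -> : c.2 (D w) = mob N (c'.2 (D w)) by near: w.
have [_ ->] : c'.1 (D w) /\ c'.2 (D w) = mob M w by near: w.
by rewrite mobM.
Unshelve. all: by end_near. Qed.

(** Identity theorem: [N^-1 M] fixes [z] and a point beside it at the same height, so [mob_fix3]
    applies. *)
Lemma mob_agree M N z : mdet M = 1 -> mdet N = 1 -> 0 < z.2 ->
  agree (mob M) (mob N) z -> forall w, 0 < w.2 -> mob M w = mob N w.
Proof.
move=> hM hN z0 ag.
have hP : mdet (mmul (madj N) M) = 1 by rewrite mdetM mdet_adj hM hN mulr1.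
have [e /= e0 he] : exists2 e : R, 0 < e & forall w, ball z e w -> mob (mmul (madj N) M) w = w.
  have h3 := near_H z0.
  have : \forall w \near z, mob (mmul (madj N) M) w = w.
    near=> w; have w0 : 0 < w.2 by near: w.
    rewrite mobM ?mdet_adj //; have -> : mob M w = mob N w by near: w.
    by rewrite mobK.
  by move=> /nbhs_ballP.
have fx (t : R) : 0 <= t < e -> mob (mmul (madj N) M) (z.1 + t, z.2) = (z.1 + t, z.2).
  move=> /andP[t0 te]; apply: he; split; rewrite /ball /=.
    by rewrite opprD addrA subrr sub0r normrN ger0_norm.
  by rewrite subrr normr0.
have f1 : mob (mmul (madj N) M) (z.1, z.2) = (z.1, z.2) by have := fx 0; rewrite addr0 lexx e0; apply.
have e2 : 0 < e / 2 by rewrite divr_gt0.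
have f2 : mob (mmul (madj N) M) (z.1 + e / 2, z.2) = (z.1 + e / 2, z.2).
  by apply: fx; rewrite ltW //= ltr_pdivrMr // ltr_pMr // ltr1n.
have hh := mob_fix3 hP z0 e2 f1 f2; move=> w w0.
rewrite -[LHS](mobVK hN) ?mob_H //; congr mob.
rewrite -mobM ?mdet_adj //.
by case: hh => ->; rewrite ?mobN mob1.
Unshelve. all: by end_near. Qed.

(** If [D1 z] and [D2 z] differ, Hausdorff separation forbids agreement anywhere near [z]. If they
    coincide, both maps are read in one chart as Moebius maps, and agreement near one point makes
    these equal. *)
Lemma agree_loc D1 D2 z : 0 < z.2 -> good D1 z -> good D2 z ->
  exists2 U, nbhs z U & forall w w', U w -> U w' -> agree D1 D2 w -> agree D1 D2 w'.
Proof.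
move=> z0 g1 g2; have c1 := good_cont z0 g1; have c2 := good_cont z0 g2.
have [e12|/eqP n12] := pselect (D1 z = D2 z); last first.
  have := hS; rewrite open_hausdorff => /(_ _ _ n12)[[B C] /= [zB zC] [oB oC BC]].
  rewrite !inE in zB zC.
  exists (D1 @^-1` B `&` D2 @^-1` C).
    by apply: filterI; [apply: c1 | apply: c2]; exact: open_nbhs_nbhs.
  move=> w w' [Bw Cw] _ /nbhs_singleton ag.
  have : (B `&` C) (D1 w) by split=> //; rewrite ag.
  by rewrite (eqP BC).
have [c Ac cz] := chart_at (D1 z).
have [M1 h1 n1] := good_chart z0 g1 Ac cz.
have [M2 h2 n2] : exists2 M, mdet M = 1 & \forall w \near z, c.1 (D2 w) /\ c.2 (D2 w) = mob M w.
  by apply: good_chart => //; rewrite -e12.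
have n3 := near_H z0.
pose U := [set w | [/\ 0 < w.2, c.1 (D1 w) /\ c.2 (D1 w) = mob M1 w &
   c.1 (D2 w) /\ c.2 (D2 w) = mob M2 w]].
have nU : nbhs z U by near=> w; split; near: w.
exists U^°; first by apply: open_nbhs_nbhs; split=> //; exact: open_interior.
move=> w w' Uw Uw' ag.
have w0 : 0 < w.2 by have [] := nbhs_singleton Uw.
have eqM : forall v, 0 < v.2 -> mob M1 v = mob M2 v.
  apply: (mob_agree h1 h2 w0); rewrite /agree; near=> v.
  have [_ [_ <-] [_ <-]] : U v by near: v.
  by congr c.2; near: v.
rewrite /agree; near=> v.
have [v0 [k1 e1] [k2 e2]] : U v by near: v.
by apply: (chart_inj Ac k1 k2); rewrite e1 e2 eqM.
Unshelve. all: by end_near. Qed.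

Lemma agree_seg D1 D2 z w : 0 < z.2 -> 0 < w.2 ->
  (forall t, 0 <= t <= 1 -> good D1 (pt z w t)) ->
  (forall t, 0 <= t <= 1 -> good D2 (pt z w t)) ->
  agree D1 D2 z -> agree D1 D2 w.
Proof.
move=> z0 w0 g1 g2; rewrite -{1}(pt0 z w) -{2}(pt1 z w).
apply: (seg_ind (P := fun t => agree D1 D2 (pt z w t))) => t ht.
have [U nU hU] := agree_loc (pt_H z0 w0 ht) (g1 t ht) (g2 t ht).
exists (pt z w @^-1` U); first exact: pt_cont.
by move=> s s' Us Us' _ _; exact: hU.
Qed.

(** A Lebesgue number for the atlas. The second ball, around [u], is there because germs are
    extended in the chart of [s] from points near [s] as well as from [s]. *)
Definition unif (e : R) := forall s, exists c, [/\ A c, c.1 s &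
  forall u, 0 < u.2 -> hd u (c.2 s) < e -> forall w, 0 < w.2 -> hd w u < e -> (c.2 @` c.1) w].

Lemma unif_ball : compact [set: S] -> exists e : R, [/\ 0 < e, e <= 1 & unif e].
Proof.
move=> /compact_near_coveringP cS.
pose P (e : R) s := exists c, [/\ A c, c.1 s &
  forall w, 0 < w.2 -> hd w (c.2 s) < e -> (c.2 @` c.1) w].
have loc : forall s, [set: S] s -> \forall t \near s & e \near 0^'+, P e t.
  move=> s _; have [c Ac cs] := chart_at s.
  have s0 := chart_H Ac cs; set z := c.2 s in s0.
  have oI := chart_image Ac (@subset_refl _ _) (chart_open Ac).
  have /nbhs_ballP[r /= r0 hr] : nbhs z (c.2 @` c.1) by apply: open_nbhs_nbhs; split=> //; exists s.
  have nz : \forall w \near z, ball z (r / 2) w /\ w.2 < 2 * z.2.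
    have c2 : (snd : R * R -> R) x @[x --> z] --> z.2 by exact: cvg_snd.
    near=> w; split; near: w; first by apply: nbhsx_ballx; rewrite divr_gt0.
    by apply: (cvgr_lt z.2 c2); lra.
  have n1 := chart_cont Ac cs nz; have n2 := near_chart Ac cs.
  (* At a point of height below [2 * z.2], [hd_close] bounds the change of each coordinate by
     [r / 2] as soon as [3 * e * (2 * z.2) ^+ 2 <= (r / 2) ^+ 2]; hence 48. *)
  pose e0 : R := Num.min 1 (r ^+ 2 / (48 * z.2 ^+ 2)).
  have e00 : 0 < e0 by rewrite lt_min ltr01 divr_gt0 ?mulr_gt0 ?exprn_gt0.
  exists ([set t | c.1 t /\ (ball z (r / 2) (c.2 t) /\ (c.2 t).2 < 2 * z.2)], [set e : R | 0 < e <= e0]).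
    split; first by apply: filterI.
    near=> e; apply/andP; split; first by near: e; exact: nbhs_right_gt.
    by near: e; exact: nbhs_right_le.
  case=> t e /= [[ct [bt lt2]]] /andP[e_0 e_e0]; exists c; split=> // w w0 hw.
  have t0 := chart_H Ac ct; set u := c.2 t in bt lt2 hw t0.
  have [e1 e2] : e <= 1 /\ e <= r ^+ 2 / (48 * z.2 ^+ 2).
    by move: e_e0; rewrite le_min => /andP[].
  have [k1 k2] := hd_close t0 w0 e1 hw.
  have k3 : 3 * e * u.2 ^+ 2 <= (r / 2) ^+ 2.
    have l2 : u.2 ^+ 2 <= (2 * z.2) ^+ 2 by rewrite lerXn2r // ?nnegrE ltW // mulr_gt0.
    have l3 : 3 * e * u.2 ^+ 2 <= 3 * e * (2 * z.2) ^+ 2 by rewrite ler_pM2l // mulr_gt0.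
    apply: (le_trans l3); move: e2; rewrite ler_pdivlMr ?mulr_gt0 ?exprn_gt0 // => e2.
    by rewrite exprMn exprMn; lra.
  have aux (x : R) : x ^+ 2 < 3 * e * u.2 ^+ 2 -> `|x| < r / 2.
    move=> hx; rewrite -(ger0_norm (ltW (divr_gt0 r0 (ltr0n R 2)))) -ltr_sqr ?nnegrE //.
    rewrite !real_normK ?num_real //; exact: lt_le_trans k3.
  apply: hr; have [b1 b2] := bt.
  have n1' := aux _ k1; have n2' := aux _ k2.
  by split; rewrite /ball /= in b1 b2 *; [have := ler_normD (z.1 - u.1) (u.1 - w.1) | have := ler_normD (z.2 - u.2) (u.2 - w.2)];
    rewrite addrA subrK [X in _ <= _ + X]distrC => hh; apply: (le_lt_trans hh); lra.
have n0 : \forall e \near 0^'+, [set: S] `<=` P e by exact: cS R (0^'+) P _ loc.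
have [e [/andP[e0 e1] he]] : exists e, (0 < e <= (1:R)) /\ [set: S] `<=` P e.
  apply: (@filter_ex _ (0^'+)); near=> e; split; last by near: e.
  apply/andP; split; first by near: e; exact: nbhs_right_gt.
  by near: e; exact: nbhs_right_le.
(* Two steps of size [e / 12] stay within [e] by [hd_triangle]. *)
exists (e / 12); split; [by rewrite divr_gt0 | by lra |].
move=> s; have [c [Ac cs hc]] := he s I; exists c; split=> // u u0 us w w0 wu.
have e12 : 12 * (e / 12) = e by lra.
apply: hc => //; rewrite -e12; apply: (hd_triangle _ u0) => //; last by lra.
exact: chart_H Ac cs.
Unshelve. all: by end_near. Qed.

Variable e0 : R.
Hypotheses (e0_gt0 : 0 < e0) (e0_le1 : e0 <= 1) (He0 : unif e0).

(* A germ at [z] extends to the hyperbolic ball of radius [e0] around [z]. *)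
Lemma good_ext D z c : 0 < z.2 -> good D z -> A c -> c.1 (D z) ->
  (forall w, 0 < w.2 -> hd w (c.2 (D z)) < e0 -> (c.2 @` c.1) w) ->
  exists D' M, [/\ mdet M = 1, agree D D' z & forall w, 0 < w.2 -> hd w z < e0 ->
     [/\ good D' w, c.1 (D' w) & c.2 (D' w) = mob M w]].
Proof.
move=> z0 gD Ac cz hc; have [M hM nM] := good_chart z0 gD Ac cz.
have [_ ez] := nbhs_singleton nM.
pose D' w := xget (D z) [set s | c.1 s /\ c.2 s = mob M w].
have D'P w : 0 < w.2 -> hd w z < e0 -> c.1 (D' w) /\ c.2 (D' w) = mob M w.
  move=> w0 wz; have [|s cs es] := hc (mob M w) (mob_H hM w0).
    by rewrite ez hd_mob.
  by rewrite /D'; case: xgetP => [t _ //|/(_ s)[]].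
have n3 := near_H z0; have n4 := near_hd z0 e0_gt0.
exists D', M; split=> //.
  rewrite /agree; near=> w; have [cw ew] : c.1 (D w) /\ c.2 (D w) = mob M w by near: w.
  have [||c'w e'w] := D'P w; [by near: w..|].
  by apply: (chart_inj Ac cw c'w); rewrite ew e'w.
move=> w w0 wz; have [k1 k2] := D'P w w0 wz; split=> //; exists c, M; split=> //.
have n5 := near_H w0.
have n6 : \forall v \near w, hd v z < e0 by exact: (cvgr_lt (hd w z) (hd_cont w0 z0)).
by near=> v; apply: D'P; near: v.
Unshelve. all: by end_near. Qed.

(** The local extension agrees with the global [D] at [z], hence along the segment to every [w] of
    the ball. *)
Lemma good_ext_global D z c : 0 < z.2 -> (forall w, 0 < w.2 -> good D w) -> A c -> c.1 (D z) ->
  (forall w, 0 < w.2 -> hd w (c.2 (D z)) < e0 -> (c.2 @` c.1) w) ->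
  exists2 M, mdet M = 1 & forall w, 0 < w.2 -> hd w z < e0 ->
     c.1 (D w) /\ c.2 (D w) = mob M w.
Proof.
move=> z0 gD Ac cz hc; have [D' [M [hM ag hD']]] := good_ext z0 (gD z z0) Ac cz hc.
exists M => // w w0 wz; have [_ k1 k2] := hD' w w0 wz.
suff /nbhs_singleton -> : agree D D' w by [].
apply: (agree_seg z0 w0 _ _ ag) => t ht; first exact: gD (pt_H z0 w0 ht).
by have [] := hD' (pt z w t) (pt_H z0 w0 ht) (pt_ball z0 w0 ht wz).
Qed.

(** The cut at [p w <= m] is harmless: where [p = m] the germs of [D1] and [D2] coincide, and
    elsewhere the strict inequality persists nearby. *)
Lemma good_glue (p : R * R -> R) m (Q1 Q2 : set (R * R)) D1 D2 :
  continuous p -> (forall w, Q1 w -> p w <= m) -> (forall w, Q2 w -> m <= p w) ->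
  (forall w, Q1 w -> good D1 w) -> (forall w, Q2 w -> good D2 w) ->
  (forall w, (Q1 `|` Q2) w -> p w = m -> agree D1 D2 w) ->
  let D' w := if p w <= m then D1 w else D2 w in
  [/\ forall w, (Q1 `|` Q2) w -> good D' w, forall w, Q1 w -> agree D1 D' w &
      forall w, Q2 w -> agree D2 D' w].
Proof.
move=> cp q1 q2 g1 g2 ag D'.
have a1 w : (Q1 `|` Q2) w -> p w <= m -> agree D1 D' w.
  move=> Qw; rewrite le_eqVlt => /orP[/eqP pm|pm].
    have h := ag w Qw pm; rewrite /agree; near=> v; rewrite /D'; case: ifP => // _.
    by near: v.
  have h : \forall v \near w, p v < m by exact: (cvgr_lt (p w) (cp w)).
  by rewrite /agree; near=> v; rewrite /D' ltW //; near: v.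
have a2 w : (Q1 `|` Q2) w -> m <= p w -> agree D2 D' w.
  move=> Qw; rewrite le_eqVlt => /orP[/eqP pm|pm].
    have h := ag w Qw (esym pm); rewrite /agree; near=> v; rewrite /D'; case: ifP => // _.
    by apply/esym; near: v.
  have h : \forall v \near w, m < p v by exact: (cvgr_gt (p w) (cp w)).
  by rewrite /agree; near=> v; rewrite /D' leNgt; have -> : m < p v by near: v.
split=> [w Qw|w Qw|w Qw]; last 2 first.
- by apply: a1; [left | exact: q1].
- by apply: a2; [right | exact: q2].
case: (Qw) => Q; first by apply: good_agree (g1 w Q); apply: a1 => //; exact: q1.
by apply: good_agree (g2 w Q); apply: a2 => //; exact: q2.
Unshelve. all: by end_near. Qed.

(** Analytic continuation without monodromy: the two halves of a rectangle meet in a connected edge,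
    so an extension to one half, restarted at a corner [x] of that edge, agrees with the extension
    to the other half on all of it. *)
Lemma good_rect a b c d : a <= b -> 0 < c -> c <= d -> forall z D, rect a b c d z -> good D z ->
  exists2 D', (forall w, rect a b c d w -> good D' w) & agree D D' z.
Proof.
move=> ab c0 cd.
have recH a' b' c' d' w : c <= c' -> rect a' b' c' d' w -> 0 < w.2.
  by move=> cc [_ /andP[h _]]; apply: lt_le_trans h; exact: lt_le_trans cc.
have rectP a' b' c' d' z w t : 0 <= t <= 1 -> rect a' b' c' d' z -> rect a' b' c' d' w ->
    rect a' b' c' d' (pt z w t).
  by move=> ht [z1 z2] [w1 w2]; have [] := pt_rect ht z1 z2 w1 w2.
have glue (p : R * R -> R) m (Q1 Q2 : set (R * R)) x : continuous p ->
    (forall w, Q1 w -> p w <= m) -> (forall w, Q2 w -> m <= p w) ->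
    (forall w, (Q1 `|` Q2) w -> p w = m -> 0 < w.2 /\ forall t, 0 <= t <= 1 -> (Q1 `&` Q2) (pt x w t)) ->
    (Q1 `&` Q2) x -> 0 < x.2 ->
    (forall z D, Q1 z -> good D z -> exists2 D', (forall w, Q1 w -> good D' w) & agree D D' z) ->
    (forall z D, Q2 z -> good D z -> exists2 D', (forall w, Q2 w -> good D' w) & agree D D' z) ->
    forall z D, (Q1 `|` Q2) z -> good D z ->
      exists2 D', (forall w, (Q1 `|` Q2) w -> good D' w) & agree D D' z.
  move=> cp q1 q2 hI [x1 x2] x0 P1 P2 z D Qz gD.
  have both D1 D2 : (forall w, Q1 w -> good D1 w) -> (forall w, Q2 w -> good D2 w) ->
      agree D1 D2 x -> forall w, (Q1 `|` Q2) w -> p w = m -> agree D1 D2 w.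
    move=> g1 g2 ag w Qw pw; have [w0 ht] := hI w Qw pw.
    by apply: (agree_seg x0 w0 _ _ ag) => t /ht[??]; [exact: g1 | exact: g2].
  case: Qz => Qz.
    have [D1 g1 ag1] := P1 z D Qz gD; have [D2 g2 ag2] := P2 x D1 x2 (g1 x x1).
    have [h1 h2 _] := good_glue cp q1 q2 g1 g2 (both _ _ g1 g2 ag2).
    eexists; first exact: h1.
    by have := h2 z Qz; rewrite /agree => h; near=> v; rewrite -(near h v) //; near: v.
  have [D2 g2 ag2] := P2 z D Qz gD; have [D1 g1 ag1] := P1 x D2 x1 (g2 x x2).
  have ag : agree D1 D2 x by apply: filterS ag1 => v ->.
  have [h1 _ h2] := good_glue cp q1 q2 g1 g2 (both _ _ g1 g2 ag).
  eexists; first exact: h1.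
  by have := h2 z Qz; rewrite /agree => h; near=> v; rewrite -(near h v) //; near: v.
apply: (rect_ind (P := fun a b c d => forall z D, rect a b c d z -> good D z ->
  exists2 D', (forall w, rect a b c d w -> good D' w) & agree D D' z)) => //.
- move=> x y hx hy; have y0 : 0 < y by case/andP: hy => /(lt_le_trans c0).
  have [del del0 hdel] := hd_small y0 e0_gt0; exists del => //.
  move=> a' b' c' d' ha hb hc hd' dx dy z D Qz gD.
  have z0 : 0 < z.2 by apply: recH Qz; case/andP: hc.
  have [ch [Ach chz hch]] := He0 (D z).
  have [|D' [M [hM ag hD']]] := good_ext z0 gD Ach chz.
    by move=> w w0; apply: hch => //; [exact: chart_H | rewrite hdxx].
  exists D' => // w Qw; have w0 : 0 < w.2 by apply: recH Qw; case/andP: hc.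
  have [|//] := hD' w w0.
  case: Qz Qw hc hd' => /andP[??] /andP[??] [/andP[??] /andP[??]] /andP[??] /andP[??].
  by apply: hdel; rewrite ?ltr_norml; lra.
- move=> a' m b' c' d' ha hb hc hd' P1 P2.
  have -> : rect a' b' c' d' = rect a' m c' d' `|` rect m b' c' d'.
    apply/seteqP; split=> [w [/andP[h1 h2] h3]|w [] [/andP[h1 h2] h3]].
    + by case: (leP w.1 m) => wm; [left | right]; rewrite /rect /= h3 ?h1 ?wm ?h2 ?ltW.
    + by rewrite /rect /= h3 h1 (le_trans h2) //; case/andP: hb.
    + by rewrite /rect /= h3 h2 (le_trans _ h1) //; case/andP: ha.
  have Qx : (rect a' m c' d' `&` rect m b' c' d') (m, c').
    by rewrite /rect /= !lexx; case/andP: ha hb hc => ? -> /andP[-> ?] /andP[? ->].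
  have cc : c <= c' by case/andP: hc.
  apply: (glue fst m _ _ (m, c')) => //.
  + by move=> ?; exact: cvg_fst.
  + by move=> w [/andP[]].
  + by move=> w [/andP[]].
  + move=> w Qw wm; have Qw' : (rect a' m c' d' `&` rect m b' c' d') w.
      case: Qx Qw => [[/= /andP[x1 x2] _] [/= /andP[x3 x4] _]] [] [_ q2];
      by split; split=> //; rewrite wm ?x1 ?x2 ?x3 ?x4.
    by split; [exact: recH cc (proj1 Qw') | move=> t ht; split; apply: rectP => //; case: Qx; case: Qw'].
  + exact: recH cc (proj1 Qx).
- move=> a' b' c' m d' ha hb hc hd' P1 P2.
  have -> : rect a' b' c' d' = rect a' b' c' m `|` rect a' b' m d'.
    apply/seteqP; split=> [w [h3 /andP[h1 h2]]|w [] [h3 /andP[h1 h2]]].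
    + by case: (leP w.2 m) => wm; [left | right]; rewrite /rect /= h3 ?h1 ?wm ?h2 ?ltW.
    + by rewrite /rect /= h3 h1 (le_trans h2) //; case/andP: hd'.
    + by rewrite /rect /= h3 h2 (le_trans _ h1) //; case/andP: hc.
  have Qx : (rect a' b' c' m `&` rect a' b' m d') (a', m).
    by rewrite /rect /= !lexx; case/andP: hc hd' ha => ? -> /andP[-> ?] /andP[? ->].
  have cc : c <= c' by case/andP: hc.
  have cm : c <= m by apply: (le_trans cc); case/andP: hc.
  apply: (glue snd m _ _ (a', m)) => //.
  + by move=> ?; exact: cvg_snd.
  + by move=> w [_ /andP[]].
  + by move=> w [_ /andP[]].
  + move=> w Qw wm; have Qw' : (rect a' b' c' m `&` rect a' b' m d') w.
      case: Qx Qw => [[_ /= /andP[x1 x2]] [_ /= /andP[x3 x4]]] [] [q2 _];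
      by split; split=> //; rewrite wm ?x1 ?x2 ?x3 ?x4.
    by split; [exact: recH cc (proj1 Qw') | move=> t ht; split; apply: rectP => //; case: Qx; case: Qw'].
  + exact: recH cc (proj1 Qx).
Unshelve. all: by end_near. Qed.

Lemma good_global D z : 0 < z.2 -> good D z ->
  exists2 D', (forall w, 0 < w.2 -> good D' w) & agree D D' z.
Proof.
move=> z0 gD.
(* [Q (big w)] contains [z] and [w] with room to spare, so that for [v] near [w] each of [Q (big w)]
   and [Q (big v)] contains the other's point. *)
pose big (w : R * R) : R := 1 + `|z.1| + z.2 + z.2^-1 + `|w.1| + w.2 + w.2^-1.
pose Q (r : R) := rect (- r) r r^-1 r.
have lt1 (x : R) : x < x + 1 by rewrite ltrDl.
have gt1 (x : R) : x - 1 < x by rewrite gtrBl.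
have bigP w (r : R) : 0 < w.2 -> 0 < r -> `|w.1| <= r -> w.2 <= r -> w.2^-1 <= r -> Q r w.
  move=> w0 r0 h1 h2 h3; rewrite /Q /rect /= h2 andbT -ler_norml; split=> //.
  by rewrite -[w.2]invrK lef_pV2 // posrE invr_gt0.
have big0 w : 0 < w.2 -> [/\ 1 <= big w, Q (big w) z, Q (big w) w & \forall v \near w, Q (big w) v /\ Q (big v) w].
  move=> w0.
  have p1 : 0 < z.2^-1 by rewrite invr_gt0.
  have p2 : 0 < w.2^-1 by rewrite invr_gt0.
  have p3 : 0 <= `|z.1| by []. have p4 : 0 <= `|w.1| by [].
  have c1 : (fst : R * R -> R) x @[x --> w] --> w.1 by exact: cvg_fst.
  have c2 : (snd : R * R -> R) x @[x --> w] --> w.2 by exact: cvg_snd.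
  have b1 : 1 <= big w by rewrite /big; lra.
  split=> //; try (by apply: bigP => //; rewrite /big; lra).
  have c3 : x.2^-1 @[x --> w] --> w.2^-1 by apply: cvgV => //; rewrite gt_eqF.
  have c4 : `|x.1| @[x --> w] --> `|w.1| by exact: cvg_norm.
  have n1 := cvgr_lt _ c4 _ (lt1 _); have n1' := cvgr_gt _ c4 _ (gt1 _).
  have n2 := cvgr_lt _ c2 _ (lt1 _); have n2' := cvgr_gt _ c2 _ (gt1 _).
  have n3 := cvgr_lt _ c3 _ (lt1 _); have n3' := cvgr_gt _ c3 _ (gt1 _).
  have n4 := near_H w0.
  near=> v; have v0 : 0 < v.2 by near: v.
  have p5 : 0 < v.2^-1 by rewrite invr_gt0.
  have p6 : 0 <= `|v.1| by [].
  have h1 : `|v.1| < `|w.1| + 1 by near: v; apply: n1.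
  have h1' : `|w.1| - 1 < `|v.1| by near: v; apply: n1'.
  have h2 : v.2 < w.2 + 1 by near: v; apply: n2.
  have h2' : w.2 - 1 < v.2 by near: v; apply: n2'.
  have h3 : v.2^-1 < w.2^-1 + 1 by near: v; apply: n3.
  have h3' : w.2^-1 - 1 < v.2^-1 by near: v; apply: n3'.
  by split; apply: bigP => //; rewrite /big; move: z0 w0 v0 p1 p2 p3 p4 p5 p6 h1 h1' h2 h2' h3 h3';
    clear; move: `|z.1| `|w.1| `|v.1| z.2^-1 w.2^-1 v.2^-1 => *; lra.
have QH r w : 1 <= r -> Q r w -> 0 < w.2.
  by move=> r1 [_ /andP[h _]]; apply: lt_le_trans h; rewrite invr_gt0; lra.
have ex r : exists D', 1 <= r -> Q r z -> (forall w, Q r w -> good D' w) /\ agree D D' z.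
  have [r1|] := leP 1 r; last by exists D.
  have [Qz|?] := pselect (Q r z); last by exists D.
  have r0 : 0 < r by lra.
  have rr : - r <= r by lra.
  have ri : 0 < r^-1 by rewrite invr_gt0.
  have rv : r^-1 <= r by apply: (le_trans _ r1); rewrite invf_le1.
  have [D' h1 h2] := good_rect rr ri rv Qz gD.
  by exists D'.
have [Dr hDr] := choice ex.
have loc w : 0 < w.2 -> agree (Dr (big w)) (fun w => Dr (big w) w) w.
  move=> w0; have [b1 bz bw nb] := big0 w w0; have [g ag] := hDr _ b1 bz.
  have n3 := near_H w0; rewrite /agree; near=> v.
  have v0 : 0 < v.2 by near: v.
  have [Qv Qw] : Q (big w) v /\ Q (big v) w by near: v.
  have [c1 cz cv _] := big0 v v0; have [g' ag'] := hDr _ c1 cz.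
  suff /nbhs_singleton : agree (Dr (big w)) (Dr (big v)) v by [].
  have cc r t : 0 <= t <= 1 -> Q r z -> Q r v -> Q r (pt z v t).
    by move=> ht [z1 z2] [w1 w2]; have [] := pt_rect ht z1 z2 w1 w2.
  apply: (@agree_seg _ _ z v) => // [t ht|t ht|]; [by apply: g; exact: cc|by apply: g'; exact: cc|].
  by apply: filterS2 ag ag' => u <- <-.
exists (fun w => Dr (big w) w).
  move=> w w0; have [b1 bz bw nb] := big0 w w0; have [g ag] := hDr _ b1 bz.
  by apply: (@good_agree (Dr (big w))); [exact: loc | exact: g].
have [b1 bz bw nb] := big0 z z0; have [g ag] := hDr _ b1 bz.
by apply: filterS2 ag (loc z z0) => u -> <-.
Unshelve. all: by end_near. Qed.
End Developing.

(** * Lifting paths and homotopies *)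

Section Covering.
Variables (R : realType) (S : topologicalType) (A : set (set S * (S -> R * R))).
Hypothesis HA : oriented_hyperbolic_atlas A.
Hypothesis hS : hausdorff_space S.
Variable e0 : R.
Hypotheses (e0_gt0 : 0 < e0) (e0_le1 : e0 <= 1) (He0 : unif A e0).
Variable D : R * R -> S.
Hypothesis gD : forall w, 0 < w.2 -> good A D w.
Implicit Types (z w : R * R) (M N : mat2 R).

Lemma chart_ball s : exists c, [/\ A c, c.1 s &
  forall u, 0 < u.2 -> hd u (c.2 s) < e0 -> forall w, 0 < w.2 -> hd w u < e0 -> (c.2 @` c.1) w].
Proof. exact: He0. Qed.

Lemma ball_iso z : 0 < z.2 -> exists c M, [/\ A c, mdet M = 1 & forall w, 0 < w.2 ->
  hd w z < e0 -> c.1 (D w) /\ c.2 (D w) = mob M w].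
Proof.
move=> z0; have [c [Ac cz hc]] := chart_ball (D z).
have [|M hM h] := good_ext_global HA hS e0_gt0 z0 gD Ac cz.
  by apply: hc; [exact: (chart_H HA Ac cz) | rewrite hdxx].
by exists c, M.
Qed.

Lemma D_inj z w : 0 < z.2 -> 0 < w.2 -> hd w z < e0 -> D w = D z -> w = z.
Proof.
move=> z0 w0 wz e; have [c [M [Ac hM h]]] := ball_iso z0.
have [_ e1] := h w w0 wz; have [_ e2] := h z z0 (eq_ind_r (fun a => a < e0) e0_gt0 (hdxx z)).
by rewrite -(mobK hM w0) -e1 e e2 mobK.
Qed.

Lemma D_cont z : 0 < z.2 -> D w @[w --> z] --> D z.
Proof. by move=> z0; exact: good_cont HA _ _ z0 (gD z0). Qed.

Lemma D_open z (V : set (R * R)) : 0 < z.2 -> nbhs z V ->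
  \forall s \near D z, exists w, [/\ V w, 0 < w.2 & D w = s].
Proof.
move=> z0 nV; have [c [M [Ac hM h]]] := ball_iso z0.
have [cz ez] := h z z0 (eq_ind_r (fun a => a < e0) e0_gt0 (hdxx z)).
have n1 := near_chart HA Ac cz; have n2 := chart_cont HA Ac cz.
have n3 := near_hd z0 e0_gt0.
have m1 : 0 < (mob M z).2 by exact: mob_H.
have : \forall u \near mob M z, V (mob (madj M) u) /\ hd (mob (madj M) u) z < e0.
  apply: (near_mob (P := fun w => V w /\ hd w z < e0)); rewrite ?mdet_adj // mobK //.
  by apply: filterI.
rewrite -ez => /n2 n4.
near=> s; exists (mob (madj M) (c.2 s)).
have cs : c.1 s by near: s.
have [Vs hs] : V (mob (madj M) (c.2 s)) /\ hd (mob (madj M) (c.2 s)) z < e0 by near: s.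
have s0 := chart_H HA Ac cs.
have w0 : 0 < (mob (madj M) (c.2 s)).2 by apply: mob_H; rewrite ?mdet_adj.
split=> //; have [k1 k2] := h _ w0 hs.
by apply: (chart_inj HA Ac k1 cs); rewrite k2 mobVK.
Unshelve. all: by end_near. Qed.

(** The image of [D] is open by [D_open], and closed because around each of its points it fills a
    ball of the uniform radius [e0]. *)
Lemma D_surj z s : connected [set: S] -> 0 < z.2 -> exists2 w, 0 < w.2 & D w = s.
Proof.
move=> cS z0; pose B := [set s | exists2 w : R * R, 0 < w.2 & D w = s].
suff e : B = [set: S] by have : [set: S] s by []; rewrite -e.
apply: cS.
- by exists (D z), z.
- exists B; last by rewrite setTI.
  rewrite openE => t [w w0 <-]; apply: filterS (D_open w0 (near_H w0)) => t' [v [_ v0 <-]].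
  by exists v.
- exists B; last by rewrite setTI.
  rewrite -[B]setCK; apply: open_closedC; rewrite openE => t nBt.
  have [c [Ac ct hc]] := chart_ball t; have t0 := chart_H HA Ac ct.
  have n1 := near_chart HA Ac ct; have n2 := chart_cont HA Ac ct (near_hd t0 e0_gt0).
  rewrite /interior /=; near=> t' => -[w w0 wt]; apply: nBt.
  have ct' : c.1 t' by near: t'.
  have ht' : hd (c.2 t') (c.2 t) < e0 by near: t'.
  have cw : c.1 (D w) by rewrite wt.
  have [|M hM hMw] := good_ext_global HA hS e0_gt0 w0 gD Ac cw.
    by rewrite wt; apply: hc => //; exact: (chart_H HA Ac ct').
  have [_ ew] := hMw w w0 (eq_ind_r (fun a => a < e0) e0_gt0 (hdxx w)).
  have v0 : 0 < (mob (madj M) (c.2 t)).2 by apply: mob_H; rewrite ?mdet_adj.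
  exists (mob (madj M) (c.2 t)) => //.
  have [|k1 k2] := hMw _ v0.
    by rewrite -[hd _ _](hd_mob hM) // mobVK // -ew wt hdC.
  by apply: (chart_inj HA Ac k1 ct); rewrite k2 mobVK.
Unshelve. all: by end_near. Qed.

Definition wcont (X Y : topologicalType) (Q : set X) (f : X -> Y) (q : X) :=
  forall V, nbhs (f q) V -> \forall q' \near q, Q q' -> V (f q').

Lemma wcontS (X Y : topologicalType) (Q Q' : set X) (f : X -> Y) q :
  Q `<=` Q' -> wcont Q' f q -> wcont Q f q.
Proof. by move=> QQ h V /h; apply: filterS => q' + /QQ. Qed.

Lemma wcont_comp (X Y Z : topologicalType) (Q : set X) (f : X -> Y) (g : Y -> Z) q :
  wcont Q f q -> g y @[y --> f q] --> g (f q) -> wcont Q (g \o f) q.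
Proof. by move=> h hg V /hg /h. Qed.

Definition is_lift (X : topologicalType) (Q : set X) (h : X -> S) (H : X -> R * R) :=
  forall q, Q q -> [/\ 0 < (H q).2, D (H q) = h q & wcont Q H q].

(** Where two lifts agree they agree nearby by local injectivity of [D] ([D_inj]); where they differ
    they differ nearby because the plane is Hausdorff. *)
Lemma lift_unique (X : topologicalType) (Q : set X) h H1 H2 (g : R -> X) :
  is_lift Q h H1 -> is_lift Q h H2 ->
  (forall t, 0 <= t <= 1 -> Q (g t) /\ g s @[s --> t] --> g t) ->
  H1 (g 0) = H2 (g 0) -> H1 (g 1) = H2 (g 1).
Proof.
move=> l1 l2 hg; apply: (seg_ind (P := fun t => H1 (g t) = H2 (g t))) => t ht.
have [Qt gt] := hg t ht.
have [p1 d1 c1] := l1 _ Qt; have [p2 d2 c2] := l2 _ Qt.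
have [e|/eqP n] := pselect (H1 (g t) = H2 (g t)).
  have n1 := gt _ (c1 _ (near_hd p1 (divr_gt0 e0_gt0 (ltr0n R 12)))).
  have n2 := gt _ (c2 _ (near_hd p2 (divr_gt0 e0_gt0 (ltr0n R 12)))).
  exists [set s | (Q (g s) -> hd (H1 (g s)) (H1 (g t)) < e0 / 12) /\
                  (Q (g s) -> hd (H2 (g s)) (H2 (g t)) < e0 / 12)].
    by near=> s; split; near: s.
  move=> s s' _ [k1 k2] _ hs' _; have [Qs _] := hg s' hs'.
  have [q1 f1 _] := l1 _ Qs; have [q2 f2 _] := l2 _ Qs.
  apply: D_inj => //; last by rewrite f1 f2.
  rewrite (_ : e0 = 12 * (e0 / 12)); last by field.
  apply: (hd_triangle q2 p1) => //; first by move: e0_le1; lra.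
    exact: k1.
  by rewrite e hdC; exact: k2.
have := @norm_hausdorff R (R * R)%type; rewrite open_hausdorff => /(_ _ _ n)[[B C] /= [zB zC] [oB oC BC]].
rewrite !inE in zB zC.
have n1 := gt _ (c1 _ (open_nbhs_nbhs (conj oB zB))).
have n2 := gt _ (c2 _ (open_nbhs_nbhs (conj oC zC))).
exists [set s | (Q (g s) -> B (H1 (g s))) /\ (Q (g s) -> C (H2 (g s)))].
  by near=> s; split; near: s.
move=> s s' [k1 k2] _ hs _ e; have [Qs _] := hg s hs.
have : (B `&` C) (H1 (g s)) by split; [exact: k1 | rewrite e; exact: k2].
by rewrite (eqP BC).
Unshelve. all: by end_near. Qed.

Lemma lift_glue (X : topologicalType) (p : X -> R) m (Q1 Q2 : set X) h H1 H2 :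
  continuous p -> (forall q, Q1 q -> p q <= m) -> (forall q, Q2 q -> m <= p q) ->
  closed Q1 -> closed Q2 -> is_lift Q1 h H1 -> is_lift Q2 h H2 ->
  (forall q, (Q1 `|` Q2) q -> p q = m -> Q1 q /\ Q2 q) ->
  (forall q, Q1 q -> Q2 q -> H1 q = H2 q) ->
  exists H, [/\ is_lift (Q1 `|` Q2) h H, forall q, Q1 q -> H q = H1 q & forall q, Q2 q -> H q = H2 q].
Proof.
move=> cp q1 q2 k1 k2 l1 l2 qq hh; pose H q := if p q <= m then H1 q else H2 q.
have e1 q : Q1 q -> H q = H1 q by move=> /q1; rewrite /H => ->.
have e2 q : Q2 q -> H q = H2 q.
  move=> Q; rewrite /H; case: ifP => // pm.
  have [|? ?] := qq q (or_intror Q); last exact: hh.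
  by apply/eqP; rewrite eq_le pm q2.
have near_out (Q : set X) q (P : X -> Prop) : closed Q -> ~ Q q -> \forall q' \near q, Q q' -> P q'.
  move=> cQ nQ; have : nbhs q (~` Q) by apply: open_nbhs_nbhs; split=> //; rewrite openC.
  by apply: filterS => ? ? /[dup].
exists H; split=> // q Qq.
have hV V : nbhs (H q) V -> (\forall q' \near q, Q1 q' -> V (H1 q')) /\ (\forall q' \near q, Q2 q' -> V (H2 q')).
  move=> nV; split.
    have [Q|] := pselect (Q1 q); last exact: near_out.
    by have [_ _] := l1 q Q; apply; rewrite -e1.
  have [Q|] := pselect (Q2 q); last exact: near_out.
  by have [_ _] := l2 q Q; apply; rewrite -e2.
have hc : wcont (Q1 `|` Q2) H q.
  move=> V /hV[n1 n2]; near=> q' => -[] Q.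
    by rewrite e1 //; move: Q; near: q'.
  by rewrite e2 //; move: Q; near: q'.
case: Qq => Q; first by rewrite !e1 //; have [? ? _] := l1 q Q.
by rewrite !e2 //; have [? ? _] := l2 q Q.
Unshelve. all: by end_near. Qed.

Lemma rect_closed (a b c d : R) : closed (rect a b c d).
Proof.
have -> : rect a b c d = (fst @^-1` `[a, b]) `&` (snd @^-1` `[c, d]).
  by apply/seteqP; split=> z; rewrite /rect /= !in_itv.
apply: closedI; apply: closed_comp => [z _|]; try exact: interval_closed.
  exact: cvg_fst.
exact: cvg_snd.
Qed.

(** Over a small rectangle the lift is [h] followed by one chart and the inverse of a Moebius map.
    Lifts over adjacent halves agree along the whole common edge once they agree at its corner. *)
Lemma lift_rect h (a b c d : R) : a <= b -> c <= d ->
  (forall q, rect a b c d q -> wcont (rect a b c d) h q) ->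
  forall q z, rect a b c d q -> 0 < z.2 -> D z = h q ->
    exists2 H, is_lift (rect a b c d) h H & H q = z.
Proof.
move=> ab cd hc.
have rectP a' b' c' d' z w t : 0 <= t <= 1 -> rect a' b' c' d' z -> rect a' b' c' d' w ->
    rect a' b' c' d' (pt z w t).
  by move=> ht [z1 z2] [w1 w2]; have [] := pt_rect ht z1 z2 w1 w2.
have glue (p : R * R -> R) m (Q1 Q2 : set (R * R)) x : continuous p ->
    (forall q, Q1 q -> p q <= m) -> (forall q, Q2 q -> m <= p q) -> closed Q1 -> closed Q2 ->
    (forall q, (Q1 `|` Q2) q -> p q = m -> Q1 q /\ Q2 q) ->
    (forall q t, 0 <= t <= 1 -> Q1 q -> Q2 q -> (Q1 `&` Q2) (pt x q t)) ->
    (Q1 `&` Q2) x ->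
    (forall q z, Q1 q -> 0 < z.2 -> D z = h q -> exists2 H, is_lift Q1 h H & H q = z) ->
    (forall q z, Q2 q -> 0 < z.2 -> D z = h q -> exists2 H, is_lift Q2 h H & H q = z) ->
    forall q z, (Q1 `|` Q2) q -> 0 < z.2 -> D z = h q ->
      exists2 H, is_lift (Q1 `|` Q2) h H & H q = z.
  move=> cp q1 q2 k1 k2 qq hI [x1 x2] P1 P2 q z Qq z0 hz.
  have both H1 H2 : is_lift Q1 h H1 -> is_lift Q2 h H2 -> H1 x = H2 x ->
      forall q, Q1 q -> Q2 q -> H1 q = H2 q.
    move=> l1 l2 e q' Q Q'; rewrite -[q'](pt1 x).
    have sub1 : is_lift (Q1 `&` Q2) h H1.
      by move=> v [v1 v2]; have [? ? w] := l1 v v1; split=> //; apply: wcontS w; exact: subIsetl.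
    have sub2 : is_lift (Q1 `&` Q2) h H2.
      by move=> v [v1 v2]; have [? ? w] := l2 v v2; split=> //; apply: wcontS w; exact: subIsetr.
    apply: (lift_unique sub1 sub2) => [t ht|]; last by rewrite pt0.
    by split; [exact: hI | exact: pt_cont].
  case: Qq => Q.
    have [H1 l1 e1] := P1 q z Q z0 hz; have [y0 hy _] := l1 x x1.
    have [H2 l2 e2] := P2 x _ x2 y0 hy.
    have [H [lH f1 _]] := lift_glue cp q1 q2 k1 k2 l1 l2 qq (both _ _ l1 l2 (esym e2)).
    by exists H => //; rewrite f1.
  have [H2 l2 e2] := P2 q z Q z0 hz; have [y0 hy _] := l2 x x2.
  have [H1 l1 e1] := P1 x _ x1 y0 hy.
  have [H [lH _ f2]] := lift_glue cp q1 q2 k1 k2 l1 l2 qq (both _ _ l1 l2 e1).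
  by exists H => //; rewrite f2.
apply: (rect_ind (P := fun a b c d => forall q z, rect a b c d q -> 0 < z.2 -> D z = h q ->
    exists2 H, is_lift (rect a b c d) h H & H q = z)) => //.
- move=> x y hx hy.
  have [ch [Ac cz hch]] := chart_ball (h (x, y)).
  have s0 := chart_H HA Ac cz.
  have e12 : 0 < e0 / 12 by rewrite divr_gt0.
  have nV : \forall s \near h (x, y), ch.1 s /\ hd (ch.2 s) (ch.2 (h (x, y))) < e0 / 12.
    apply: filterI; first exact: (near_chart HA Ac cz).
    exact: (chart_cont HA Ac cz (near_hd s0 e12)).
  have Qxy : rect a b c d (x, y) by split.
  have /nbhs_ballP[del /= del0 hdel] := hc _ Qxy _ nV.
  exists del => // a' b' c' d' /andP[a1 a2] /andP[b1 b2] /andP[c1 c2] /andP[d1 d2] dx dy.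
  have sub : rect a' b' c' d' `<=` rect a b c d.
    move=> q [/andP[h1 h2] /andP[h3 h4]]; split; apply/andP; split; by
      [exact: le_trans h1|exact: le_trans b2|exact: le_trans h3|exact: le_trans d2].
  have inV q : rect a' b' c' d' q -> ch.1 (h q) /\ hd (ch.2 (h q)) (ch.2 (h (x, y))) < e0 / 12.
    move=> Qq; apply: hdel; last exact: sub.
    by case: Qq => /andP[h1 h2] /andP[h3 h4]; split; rewrite /ball /= ltr_norml; apply/andP; split; lra.
  move=> q z Qq z0 hz; have [cq hq] := inV q Qq.
  have q0 := chart_H HA Ac cq.
  have cDz : ch.1 (D z) by rewrite hz.
  have [|M hM hMz] := good_ext_global HA hS e0_gt0 z0 gD Ac cDz.
    rewrite hz; apply: hch => //; apply: (lt_le_trans hq).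
    by move: e0_gt0; lra.
  have [_ ez] := hMz z z0 (eq_ind_r (fun a => a < e0) e0_gt0 (hdxx z)).
  exists (fun q' => mob (madj M) (ch.2 (h q'))); last by rewrite -hz ez mobK.
  move=> q' Qq'; have [cq' hq'] := inV q' Qq'; have q'0 := chart_H HA Ac cq'.
  have w0 : 0 < (mob (madj M) (ch.2 (h q'))).2 by apply: mob_H; rewrite ?mdet_adj.
  split=> //.
    have [|k1 k2] := hMz _ w0.
      rewrite -[hd _ _](hd_mob hM) // mobVK // -ez hz.
      rewrite (_ : e0 = 12 * (e0 / 12)); last by field.
      apply: (hd_triangle q0 s0) => //; first by move: e0_le1; lra.
      by rewrite hdC.
    by apply: (chart_inj HA Ac k1 cq'); rewrite k2 mobVK.
  apply: (@wcont_comp _ _ _ _ h (mob (madj M) \o ch.2)).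
    by apply: (wcontS sub); apply: hc; exact: sub.
  have hM' : mdet (madj M) = 1 by rewrite mdet_adj.
  by move=> V nV'; exact: (chart_cont HA Ac cq' (mob_cont hM' q'0 nV')).
- move=> a' m b' c' d' ha hb hc' hd' P1 P2.
  have -> : rect a' b' c' d' = rect a' m c' d' `|` rect m b' c' d'.
    apply/seteqP; split=> [w [/andP[h1 h2] h3]|w [] [/andP[h1 h2] h3]].
    + by case: (leP w.1 m) => wm; [left | right]; rewrite /rect /= h3 ?h1 ?wm ?h2 ?ltW.
    + by rewrite /rect /= h3 h1 (le_trans h2) //; case/andP: hb.
    + by rewrite /rect /= h3 h2 (le_trans _ h1) //; case/andP: ha.
  have Qx : (rect a' m c' d' `&` rect m b' c' d') (m, c').
    by rewrite /rect /= !lexx; case/andP: ha hb hc' => ? -> /andP[-> ?] /andP[? ->].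
  apply: (glue fst m _ _ (m, c')) => //; try exact: rect_closed.
  + by move=> ?; exact: cvg_fst.
  + by move=> w [/andP[]].
  + by move=> w [/andP[]].
  + move=> w Qw wm; case: Qx Qw => [[/= /andP[x1 x2] _] [/= /andP[x3 x4] _]] [] [_ q2];
      by split; split=> //; rewrite wm ?x1 ?x2 ?x3 ?x4.
  + by move=> q t ht q1 q2; split; apply: rectP => //; case: Qx.
- move=> a' b' c' m d' ha hb hc' hd' P1 P2.
  have -> : rect a' b' c' d' = rect a' b' c' m `|` rect a' b' m d'.
    apply/seteqP; split=> [w [h3 /andP[h1 h2]]|w [] [h3 /andP[h1 h2]]].
    + by case: (leP w.2 m) => wm; [left | right]; rewrite /rect /= h3 ?h1 ?wm ?h2 ?ltW.
    + by rewrite /rect /= h3 h1 (le_trans h2) //; case/andP: hd'.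
    + by rewrite /rect /= h3 h2 (le_trans _ h1) //; case/andP: hc'.
  have Qx : (rect a' b' c' m `&` rect a' b' m d') (a', m).
    by rewrite /rect /= !lexx; case/andP: hc' hd' ha => ? -> /andP[-> ?] /andP[? ->].
  apply: (glue snd m _ _ (a', m)) => //; try exact: rect_closed.
  + by move=> ?; exact: cvg_snd.
  + by move=> w [_ /andP[]].
  + by move=> w [_ /andP[]].
  + move=> w Qw wm; case: Qx Qw => [[_ /= /andP[x1 x2]] [_ /= /andP[x3 x4]]] [] [q2 _];
      by split; split=> //; rewrite wm ?x1 ?x2 ?x3 ?x4.
  + by move=> q t ht q1 q2; split; apply: rectP => //; case: Qx.
Qed.
End Covering.

(** * Deck transformations *)

Section Deck.
Variables (R : realType) (S : topologicalType) (A : set (set S * (S -> R * R))).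
Hypothesis HA : oriented_hyperbolic_atlas A.
Hypothesis hS : hausdorff_space S.
Variable e0 : R.
Hypotheses (e0_gt0 : 0 < e0) (e0_le1 : e0 <= 1) (He0 : unif A e0).
Variable D : R * R -> S.
Hypothesis gD : forall w, 0 < w.2 -> good A D w.
Implicit Types (z w : R * R) (M N : mat2 R) (f : R -> S) (g : R -> R * R).

Definition unitI : set R := [set t | 0 <= t <= 1].

Lemma withinP (X Y : topologicalType) (Q : set X) (f : X -> Y) :
  {within Q, continuous f} <-> forall q, Q q -> wcont Q f q.
Proof. by rewrite subspace_continuousP; split=> h q Qq V /(h q Qq). Qed.

Lemma unit_itv : unitI = `[0, 1]%classic.
Proof. by apply/seteqP; split=> t; rewrite /unitI /= in_itv. Qed.

Lemma loop_wcont x f : is_loop x f -> forall t, unitI t -> wcont unitI f t.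
Proof. by case=> + _ _; rewrite -unit_itv => /withinP. Qed.

Lemma plift_exists f z : (forall t, unitI t -> wcont unitI f t) -> 0 < z.2 -> D z = f 0 ->
  exists2 g, is_lift D unitI f g & g 0 = z.
Proof.
move=> hf z0 Dz.
(* A path is lifted as a homotopy over the degenerate rectangle [[0, 1] x {0}]. *)
have rI (q : R * R) : rect 0 1 0 0 q -> unitI q.1 by case.
have Ir (t : R) : unitI t -> rect 0 1 0 0 (t, 0 : R) by move=> h; split=> //=; rewrite lexx.
have hc q : rect 0 1 0 0 q -> wcont (rect 0 1 0 0) (fun q : R * R => f q.1) q.
  move=> Qq V nV; have n1 := hf _ (rI _ Qq) V nV.
  have c1 : (fst : R * R -> R) x @[x --> q] --> q.1 by exact: cvg_fst.
  have n2 := c1 _ n1.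
  by near=> q' => /rI; near: q'.
have Q0 : rect 0 1 0 0 ((0, 0) : R * R) by apply: Ir; rewrite /unitI /= lexx ler01.
have [H lH H0] := lift_rect HA hS e0_gt0 e0_le1 He0 gD ler01 (lexx 0) hc Q0 z0 Dz.
exists (fun t => H (t, 0)) => // t It; have [p d c] := lH _ (Ir t It); split=> //.
move=> V /c n1.
have c1 : (s, 0 : R) @[s --> t] --> (t, 0 : R).
  by apply: cvg_pairR; [exact: cvg_id | exact: cvg_cst].
by have n2 := c1 _ n1; near=> s => /Ir; near: s.
Unshelve. all: by end_near. Qed.

Lemma plift_unique f g1 g2 : is_lift D unitI f g1 -> is_lift D unitI f g2 -> g1 0 = g2 0 ->
  forall t, unitI t -> g1 t = g2 t.
Proof.
move=> l1 l2 e t /andP[t0 t1].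
have := lift_unique HA hS e0_gt0 e0_le1 He0 gD (g := fun s => s * t) l1 l2.
rewrite mul1r; apply; last by rewrite mul0r.
move=> s /andP[s0 s1]; split.
  by rewrite /unitI /= mulr_ge0 //= mulr_ile1.
by apply: cvgM; [exact: cvg_id | exact: cvg_cst].
Qed.

Lemma lift_cst x z g : 0 < z.2 -> D z = x -> is_lift D unitI (fun=> x) g -> g 0 = z -> g 1 = z.
Proof.
move=> z0 zx l e; apply: (plift_unique l (g2 := fun=> z)) => //; last by rewrite /unitI /= ler01 lexx.
by move=> t It; split=> // V /nbhs_singleton Vz; near=> s.
Unshelve. all: by end_near. Qed.

Lemma lift_eq (X : topologicalType) (Q : set X) (h h' : X -> S) H :
  (forall q, Q q -> h q = h' q) -> is_lift D Q h H -> is_lift D Q h' H.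
Proof. by move=> e l q Qq; have [? d ?] := l q Qq; split=> //; rewrite d e. Qed.

Lemma lift_comp (X Y : topologicalType) (Q : set X) (Q' : set Y) (h : X -> S) H (p : Y -> X) :
  (forall q, Q' q -> Q (p q)) -> (forall q, Q' q -> p q' @[q' --> q] --> p q) ->
  is_lift D Q h H -> is_lift D Q' (h \o p) (H \o p).
Proof.
move=> hp cp l q Qq; have [? ? c] := l _ (hp _ Qq); split=> // V /c n1.
have n2 := cp q Qq _ n1; near=> q' => /hp; near: q'.
exact: n2.
Unshelve. all: by end_near. Qed.

(** The homotopy lifts to the square. Its vertical sides lift a constant loop, so they are constant,
    and its horizontal sides are [g1] and [g2] by uniqueness. *)
Lemma homotopy_end x f1 f2 g1 g2 : loop_homotopic x f1 f2 ->
  is_lift D unitI f1 g1 -> is_lift D unitI f2 g2 -> g1 0 = g2 0 -> g1 1 = g2 1.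
Proof.
move=> [h [/withinP hc h1 h2]] l1 l2 e.
have hR : `[0, 1]%classic `*` `[0, 1]%classic = rect 0 1 0 1 :> set (R * R).
  by apply/seteqP; split=> q; rewrite /rect /= !in_itv.
rewrite hR in hc.
have I0 : unitI 0 by rewrite /unitI /= ler01 lexx.
have I1 : unitI 1 by rewrite /unitI /= ler01 lexx.
have Rp t u : unitI t -> unitI u -> rect 0 1 0 1 (t, u) by [].
have [p0 d0 _] := l1 _ I0.
have [h10 _] := h1 0 I0.
have [H lH H0] := lift_rect HA hS e0_gt0 e0_le1 He0 gD ler01 ler01 hc (Rp 0 0 I0 I0) p0 (etrans d0 (esym h10)).
have side (p : R -> R * R) f : (forall t, unitI t -> rect 0 1 0 1 (p t) /\ h (p t) = f t) ->
    (forall t, unitI t -> p s @[s --> t] --> p t) -> is_lift D unitI f (H \o p).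
  move=> hp cp; apply: (lift_eq (h := h \o p)) => [t /hp[] //|].
  by apply: lift_comp lH => // t /hp[].
have cid (t : R) : s @[s --> t] --> t by exact: cvg_id.
have b0 : is_lift D unitI f1 (H \o (fun t => (t, 0))).
  by apply: side => t It; [have [] := h1 t It | exact: cvg_pairR (cid t) (cvg_cst _)].
have b1 : is_lift D unitI f2 (H \o (fun t => (t, 1))).
  by apply: side => t It; [have [] := h1 t It | exact: cvg_pairR (cid t) (cvg_cst _)].
have s0 : is_lift D unitI (fun=> x) (H \o (fun u => (0, u))).
  by apply: side => t It; [have [] := h2 t It | exact: cvg_pairR (cvg_cst _) (cid t)].
have s1 : is_lift D unitI (fun=> x) (H \o (fun u => (1, u))).
  by apply: side => t It; [have [] := h2 t It | exact: cvg_pairR (cvg_cst _) (cid t)].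
have k1 := plift_unique b0 l1 H0 I1.
have [q00 dd _] := s0 0 I0; have k2 := lift_cst q00 dd s0 erefl.
have k3 := plift_unique b1 l2 (etrans k2 (etrans H0 e)) I1.
have [q10 dd' _] := s1 0 I0; have k4 := lift_cst q10 dd' s1 erefl.
by rewrite -k1 -k3; exact: esym k4.
Qed.

Lemma concat_lift x f1 f2 g1 g2 : is_loop x f1 -> is_loop x f2 ->
  is_lift D unitI f1 g1 -> is_lift D unitI f2 g2 -> g1 1 = g2 0 ->
  exists g, [/\ is_lift D unitI (loop_concat f1 f2) g, g 0 = g1 0 & g 1 = g2 1].
Proof.
move=> [_ _ f11] [_ f20 _] l1 l2 e.
pose Q1 : set R := [set t | 0 <= t <= 2^-1]; pose Q2 : set R := [set t | 2^-1 <= t <= 1].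
have U12 : unitI = Q1 `|` Q2.
  apply/seteqP; split=> [t /andP[a b]|t [] /andP[a b]]; rewrite /unitI /=; last 2 first.
  - by apply/andP; split; lra.
  - by apply/andP; split; lra.
  by case: (lerP t 2^-1) => h; [left | right]; rewrite /Q1 /Q2 /= ?a ?h ?b ?ltW.
have cid (t : R) : s @[s --> t] --> t by exact: cvg_id.
have c2 (t : R) : (2 * s) @[s --> t] --> 2 * t by exact: (cvgM (cvg_cst _) (cid t)).
have L1 : is_lift D Q1 (loop_concat f1 f2) (g1 \o (fun t => 2 * t)).
  apply: (lift_eq (h := f1 \o (fun t => 2 * t))) => [t /andP[_ h]|].
    by rewrite /loop_concat h.
  by apply: lift_comp l1 => t // /andP[a b]; rewrite /unitI /=; apply/andP; split; lra.
have L2 : is_lift D Q2 (loop_concat f1 f2) (g2 \o (fun t => 2 * t - 1)).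
  apply: (lift_eq (h := f2 \o (fun t => 2 * t - 1))) => [t /andP[h _]|].
    rewrite /loop_concat /=; case: ifP => // h'.
    have -> : t = 2^-1 by apply/eqP; rewrite eq_le h h'.
    by rewrite divff ?pnatr_eq0 // subrr f11 f20.
  apply: lift_comp l2 => t; last by move=> _; exact: (cvgB (c2 t) (cvg_cst _)).
  by move=> /andP[a b]; rewrite /unitI /=; apply/andP; split; lra.
have cl1 : closed Q1.
  have -> : Q1 = `[0, 2^-1]%classic by apply/seteqP; split=> t; rewrite /Q1 /= in_itv.
  exact: interval_closed.
have cl2 : closed Q2.
  have -> : Q2 = `[2^-1, 1]%classic by apply/seteqP; split=> t; rewrite /Q2 /= in_itv.
  exact: interval_closed.
have le1 t : Q1 t -> t <= 2^-1 by case/andP.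
have le2 t : Q2 t -> 2^-1 <= t by case/andP.
have mid_ t : (Q1 `|` Q2) t -> t = 2^-1 -> Q1 t /\ Q2 t.
  by move=> _ ->; rewrite /Q1 /Q2 /= !lexx invr_ge0 ler0n invf_le1 // ler1n.
have eqm t : Q1 t -> Q2 t -> (g1 \o (fun t => 2 * t)) t = (g2 \o (fun t => 2 * t - 1)) t.
  move=> /le1 h /le2 h'; have -> : t = 2^-1 by apply/eqP; rewrite eq_le h h'.
  by rewrite /= divff ?pnatr_eq0 // subrr.
have [H [lH e1 e2]] := lift_glue (p := id) cid le1 le2 cl1 cl2 L1 L2 mid_ eqm.
exists H; rewrite U12; split=> //.
  by rewrite e1 /= ?mulr0 // /Q1 /= lexx invr_ge0 ler0n.
rewrite e2 /= ?mulr1; last by rewrite /Q2 /= lexx invf_le1 // ler1n.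
by congr g2; ring.
Qed.

(** The straight contraction of [g] to [z] in the half-plane is pushed down by [D]. *)
Lemma closed_lift_null x f g : is_loop x f -> is_lift D unitI f g -> g 0 = g 1 ->
  loop_homotopic x f (fun=> x).
Proof.
move=> [_ f0 f1] l e; set z := g 0.
have I0 : unitI 0 by rewrite /unitI /= ler01 lexx.
have I1 : unitI 1 by rewrite /unitI /= ler01 lexx.
have [z0 dz _] := l 0 I0.
exists (fun q => D (pt (g q.1) z q.2)); split.
- apply/withinP => -[t u] [/=]; rewrite !in_itv /= => It Iu.
  have [gt0 _ cg] := l t It.
  have p0 : 0 < (pt (g t) z u).2 by exact: pt_H.
  move=> V /(D_cont HA gD p0).
  have cpt : pt v.1 z v.2 @[v --> (g t, u)] --> pt (g t) z u.
    have c11 : v.1 @[v --> (g t, u)] --> g t by exact: cvg_fst.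
    have c12 : v.2 @[v --> (g t, u)] --> u by exact: cvg_snd.
    have d1 : v.1.1 @[v --> (g t, u)] --> (g t).1 by apply: (cvg_comp _ _ c11); exact: cvg_fst.
    have d2 : v.1.2 @[v --> (g t, u)] --> (g t).2 by apply: (cvg_comp _ _ c11); exact: cvg_snd.
    apply: (cvg_pairR (F := nbhs (g t, u))).
      exact: (cvgD d1 (cvgM c12 (cvgB (cvg_cst _) d1))).
    exact: (cvgD d2 (cvgM c12 (cvgB (cvg_cst _) d2))).
  move=> /cpt [[V1 V2] /= [n1 n2] hV].
  have := cg _ n1 => m1.
  have c1 : (fst : R * R -> R) v @[v --> (t, u)] --> t by exact: cvg_fst.
  have c2 : (snd : R * R -> R) v @[v --> (t, u)] --> u by exact: cvg_snd.
  have m2 := c1 _ m1; have m3 := c2 _ n2.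
  near=> q => -[/=]; rewrite !in_itv /= => Iq1 Iq2.
  apply: (hV (g q.1, q.2)); split=> /=; last by near: q.
  by move: Iq1; near: q.
- move=> t It; have [? d _] := l t It; split=> /=; first by rewrite pt0.
  by rewrite pt1 dz.
- move=> u Iu /=; have ptz : pt z z u = z by case: (z) => a b; rewrite /pt /= !subrr !mulr0 !addr0.
  by rewrite -e -/z ptz dz f0.
Unshelve. all: by end_near. Qed.

Definition deck M := mdet M = 1 /\ forall w, 0 < w.2 -> D (mob M w) = D w.

Lemma good_mob M w : mdet M = 1 -> 0 < w.2 -> good A (D \o mob M) w.
Proof.
move=> hM w0; have [c [N [Ac hN h]]] := gD (mob_H hM w0).
exists c, (mmul N M); split=> //; first by rewrite mdetM hN hM mulr1.
have n1 := near_mob hM w0 h; have n2 := near_H w0.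
near=> v; have v0 : 0 < v.2 by near: v.
by rewrite mobM //; near: v.
Unshelve. all: by end_near. Qed.

(** Near [z] and near [w], [D] inverts the same chart up to [M1] and [M2]; [M2^-1 M1] maps [z] to
    [w] and preserves [D] near [z], hence everywhere by continuation. *)
Lemma deck_exists z w : 0 < z.2 -> 0 < w.2 -> D z = D w -> exists2 M, deck M & mob M z = w.
Proof.
move=> z0 w0 e; have [c Ac cz] := chart_at HA (D z).
have [M1 h1 n1] := good_chart HA z0 (gD z0) Ac cz.
have [M2 h2 n2] : exists2 M, mdet M = 1 & \forall v \near w, c.1 (D v) /\ c.2 (D v) = mob M v.
  by apply: (good_chart HA w0 (gD w0) Ac); rewrite -e.
pose M := mmul (madj M2) M1.
have hM : mdet M = 1 by rewrite mdetM mdet_adj h1 h2 mulr1.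
have Mz : mob M z = w.
  rewrite mobM ?mdet_adj //; have [_ <-] := nbhs_singleton n1.
  by rewrite e; have [_ ->] := nbhs_singleton n2; rewrite mobK.
exists M => //; split=> // v v0.
have n3 : \forall v \near z, c.1 (D (mob M v)) /\ c.2 (D (mob M v)) = mob M2 (mob M v).
  by apply: (near_mob (P := fun v => c.1 (D v) /\ c.2 (D v) = mob M2 v) hM z0); rewrite Mz.
have n4 := near_H z0.
suff /nbhs_singleton : agree (D \o mob M) D v by [].
apply: (agree_seg HA hS z0 v0) => [t ht|t ht|].
- by apply: good_mob => //; exact: pt_H.
- by apply: gD; exact: pt_H.
rewrite /agree; near=> u; have u0 : 0 < u.2 by near: u.
have [k1 e1] : c.1 (D u) /\ c.2 (D u) = mob M1 u by near: u.
have [k2 e2] : c.1 (D (mob M u)) /\ c.2 (D (mob M u)) = mob M2 (mob M u) by near: u.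
apply: (chart_inj HA Ac k2 k1); rewrite e1 e2 mobM ?mdet_adj // mobVK ?mob_H //.
Unshelve. all: by end_near. Qed.

(** [D] is injective at scale [e0], so [z] is fixed; points near [z] then also move by less than
    [e0] and are fixed, and the identity theorem concludes. *)
Lemma deck_free M z : deck M -> 0 < z.2 -> hd (mob M z) z < e0 ->
  forall w, 0 < w.2 -> mob M w = w.
Proof.
move=> [hM dM] z0 hz.
have fz : mob M z = z by apply: (D_inj HA hS e0_gt0 He0 gD) => //; [exact: mob_H | rewrite dM].
move=> w w0; rewrite -[RHS]mob1; apply: mob_agree w w0 => //; first exact: mdet1.
  exact: z0.
have n1 : \forall u \near z, hd u z < e0 / 12 by apply: near_hd; rewrite ?divr_gt0.
have n2 : \forall u \near z, hd (mob M u) z < e0 / 12 by apply: (near_mob (P := fun u => hd u z < e0 / 12) hM z0); rewrite fz.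
have n3 := near_H z0.
rewrite /agree; near=> u; have u0 : 0 < u.2 by near: u.
rewrite mob1; apply: (D_inj HA hS e0_gt0 He0 gD) => //; [exact: mob_H | | exact: dM].
rewrite (_ : e0 = 12 * (e0 / 12)); last by field.
apply: (hd_triangle u0 z0) => //; [exact: mob_H | by move: e0_le1; lra | by near: u |].
by rewrite hdC; near: u.
Unshelve. all: by end_near. Qed.
End Deck.

(** * The holonomy representation *)

Lemma mob_eq (R : realType) (M N : mat2 R) : mdet M = 1 -> mdet N = 1 ->
  (forall w, 0 < w.2 -> mob M w = mob N w) -> M = N \/ M = mscale (-1) N.
Proof.
move=> hM hN h.
have hP : mdet (mmul (madj N) M) = 1 by rewrite mdetM mdet_adj hM hN mulr1.
have f w : 0 < w.2 -> mob (mmul (madj N) M) w = w.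
  by move=> w0; rewrite mobM ?mdet_adj // h // mobK.
have e : M = mmul N (mmul (madj N) M) by rewrite mmulA mmul_adj hN mscale1 mmul1m.
have [e1|e1] := mob_fix3 hP ltr01 ltr01 (f (0, 1) ltr01) (f (0 + 1, 1) ltr01); [left | right].
  by rewrite e e1 mmulm1.
by rewrite e e1 mscaleAr mmulm1.
Qed.

(* Holonomy of a closed surface: faithful, free with displacements bounded
   below, cocompact, and multiplicative only up to sign. *)
Definition fuchsian (R : realType) (G : groupType) (rho : G -> mat2 R) :=
  [/\ forall g, mdet (rho g) = 1,
      forall g h, rho (g * h)%g = mmul (rho g) (rho h) \/
                  rho (g * h)%g = mscale (-1) (mmul (rho g) (rho h)),
      exists2 e : R, 0 < e & forall g, g <> 1%g -> forall w, 0 < w.2 -> e <= hd (mob (rho g) w) w &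
      exists2 z : R * R, 0 < z.2 & exists K : R, forall w, 0 < w.2 ->
        exists g, hd w (mob (rho g) z) < K].

(** [rho g] is a deck transformation that sends [z] to the end of the lift from [z] of a loop of
    class [g]. This determines its action, but the matrix is chosen from a pair of opposite
    signs. *)
Theorem surface_fuchsian (R : realType) (S : topologicalType) (x : S) (G : groupType) :
  closed_orientable_hyperbolic_surface R S -> is_fundamental_group R x G ->
  exists rho : G -> mat2 R, fuchsian rho.
Proof.
move=> [cS nS hS [A HA]] [cls [cl_surj cl_eq clM]].
have [e0 [e0_gt0 e0_le1 He0]] := unif_ball HA cS.
have [c Ac cx] := chart_at HA x.
have z0 := chart_H HA Ac cx; set z := c.2 x in z0.
have [D gD Dz] : exists2 D : R * R -> S, (forall w, 0 < w.2 -> good A D w) & D z = x.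
  pose D0 w := xget x [set s | c.1 s /\ c.2 s = w].
  have D0P : \forall w \near z, c.1 (D0 w) /\ c.2 (D0 w) = w.
    have : \forall w \near z, (c.2 @` c.1) w.
      apply: open_nbhs_nbhs; split; last by exists x.
      by apply: (chart_image HA Ac) => //; exact: chart_open HA _ Ac.
    apply: filterS => w [s cs es]; rewrite /D0.
    by case: xgetP => [t _ //|/(_ s)[]].
  have gD0 : good A D0 z.
    exists c, (mid R); split=> //; first exact: mdet1.
    by apply: filterS D0P => w; rewrite mob1.
  have [D gD ag] := good_global HA hS e0_gt0 He0 z0 gD0.
  exists D => //; rewrite -(nbhs_singleton ag).
  by have [k1 k2] := nbhs_singleton D0P; exact: (chart_inj HA Ac).
have I0 : @unitI R 0 by rewrite /unitI /= ler01 lexx.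
have I1 : @unitI R 1 by rewrite /unitI /= ler01 lexx.
have liftz f : is_loop x f -> exists2 g, is_lift D (@unitI R) f g & g 0 = z.
  move=> lf; apply: (plift_exists HA hS e0_gt0 e0_le1 He0 gD) => //; first exact: loop_wcont lf.
  by case: lf => _ -> _.
have lift_loop f g : is_lift D (@unitI R) f g -> f 0 = x -> f 1 = x -> is_loop x f.
  move=> l f0 f1; split=> //; rewrite -unit_itv; apply/withinP => t It V.
  have [p d cc] := l t It; rewrite -d => /(D_cont HA gD p) /cc.
  apply: filterS => t' + It' => /(_ It') /=; have [_ -> _] := l t' It'.
  by [].
have deckz f g : is_loop x f -> is_lift D (@unitI R) f g -> g 0 = z -> exists2 M, deck D M & mob M z = g 1.
  move=> lf l g0; have [p0 d0 _] := l 0 I0; have [p1 d1 _] := l 1 I1.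
  apply: (deck_exists HA hS gD) => //; rewrite d1; case: lf => _ _ ->; exact: Dz.
have deckU M N : deck D M -> deck D N -> mob M z = mob N z -> M = N \/ M = mscale (-1) N.
  move=> [hM dM] [hN dN] e; apply: mob_eq => // w w0.
  have hP : mdet (mmul (madj N) M) = 1 by rewrite mdetM mdet_adj hM hN mulr1.
  have dP : deck D (mmul (madj N) M).
    split=> // v v0; rewrite mobM ?mdet_adj // -dN ?mobVK ?dM //; try exact: mob_H.
    by apply: mob_H; rewrite ?mdet_adj //; exact: mob_H.
  have fz : hd (mob (mmul (madj N) M) z) z < e0.
    by rewrite mobM ?mdet_adj // e mobK // hdxx.
  have := deck_free HA hS e0_gt0 e0_le1 He0 gD dP z0 fz w0.
  by rewrite mobM ?mdet_adj // => h; rewrite -{2}h mobVK ?mob_H //.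
have ex g : exists M, deck D M /\ forall f ft, is_loop x f -> cls f = g ->
    is_lift D (@unitI R) f ft -> ft 0 = z -> mob M z = ft 1.
  have [f lf cf] := cl_surj g; have [ft l f0] := liftz f lf.
  have [M dM Mz] := deckz f ft lf l f0; exists M; split=> // f' ft' lf' cf' l' f0'.
  rewrite Mz; apply: (homotopy_end HA hS e0_gt0 e0_le1 He0 gD _ l l').
    by apply/(cl_eq _ _ lf lf'); rewrite cf cf'.
  by rewrite f0 f0'.
have [rho rhoP] := choice ex.
have rdet g : mdet (rho g) = 1 by have [[]] := rhoP g.
exists rho; split=> //.
- move=> g h; have [dg eg] := rhoP g; have [dh eh] := rhoP h; have [dgh egh] := rhoP (g * h)%g.
  apply: deckU => //.
    split; first by rewrite mdetM !rdet mulr1.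
    move=> w w0; rewrite mobM //; case: dg => _ ->; last exact: mob_H.
    by case: dh => _ ->.
  rewrite mobM //.
  have [f1 l1 c1] := cl_surj g; have [f2 l2 c2] := cl_surj h.
  have [g1 k1 s1] := liftz f1 l1; have [g2 k2 s2] := liftz f2 l2.
  (* [rho g] applied to the lift of [f2] starts where the lift of [f1] ends, so the product loop
     lifts to a path ending at [rho g (rho h z)]. *)
  have k3 : is_lift D (@unitI R) f2 (mob (rho g) \o g2).
    move=> t It; have [p d cc] := k2 t It; split=> /=; first exact: mob_H.
      by case: dg => _ ->.
    by apply: wcont_comp cc _; exact: mob_cont.
  have e1 : g1 1 = (mob (rho g) \o g2) 0 by rewrite /= s2 (eg f1 g1).
  have [g3 [k g30 g31]] := concat_lift l1 l2 k1 k3 e1.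
  have lc : is_loop x (loop_concat f1 f2).
    apply: (lift_loop _ _ k); first by have [_ <- _] := k _ I0; rewrite g30 s1.
    have [_ <- _] := k _ I1.
    rewrite g31 /=; have [_ dg'] := dg; have [q0 q1 _] := k2 _ I1.
    by rewrite dg' // q1; case: l2.
  rewrite (egh (loop_concat f1 f2) g3) ?clM ?c1 ?c2 // ?g30 //.
  by rewrite g31 /= (eh f2 g2).
(* A displacement below [e0] makes [rho g] act trivially; the lift is then closed, so the loop is
   null-homotopic. *)
- exists e0 => // g gn w w0; rewrite leNgt; apply/negP => hw; apply: gn.
  have [dg eg] := rhoP g.
  have [f lf cf] := cl_surj g; have [ft l f0] := liftz f lf.
  have fz := deck_free HA hS e0_gt0 e0_le1 He0 gD dg w0 hw z0.
  have cst_loop : is_loop x ((fun=> x) : R -> S).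
    by split=> //; apply/withinP => u _ V /nbhs_singleton Vx; apply: filterE.
  have e1 : cls ((fun=> x) : R -> S) = 1%g.
    have := clM _ _ cst_loop cst_loop.
    have -> : loop_concat ((fun=> x) : R -> S) (fun=> x) = (fun=> x).
      by apply/funext => t; rewrite /loop_concat; case: ifP.
    by move=> /(congr1 (fun a => (cls (fun=> x))^-1 * a)%g); rewrite mulKg mulVg.
  rewrite -cf -e1; apply/cl_eq => //.
  by apply: (closed_lift_null HA gD lf l); rewrite f0 -(eg f ft) // fz.
(* By compactness every point of the surface has a preimage within a fixed [K] of [z]; a deck
   transformation carries it to [w]. *)
- have /compact_near_coveringP cS' := cS.
  have loc : forall s : S, [set: S] s -> \forall t \near s & K \near (+oo : set_system R),
      exists v, [/\ 0 < v.2, D v = t & hd v z < K].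
    move=> s _; have [v v0 Dv] := D_surj HA hS e0_gt0 He0 gD s nS z0.
    have n1 : \forall u \near v, hd u z < hd v z + 1.
      by apply: (cvgr_lt _ (hd_cont v0 z0)); rewrite ltrDl.
    have n2 := D_open HA hS e0_gt0 He0 gD v0 n1; rewrite Dv in n2.
    exists ([set t | exists w, [/\ hd w z < hd v z + 1, 0 < w.2 & D w = t]], [set K | hd v z + 1 < K]).
      by split=> /=; [exact: n2 | apply: nbhs_pinfty_gt; exact: num_real].
    by case=> t K /= [[w [hw w0 Dw]] hK]; exists w; split=> //; exact: lt_trans hK.
  have [K hK] := @filter_ex _ (+oo : set_system R) _ _ (cS' R (+oo : set_system R) _ _ loc).
  exists z => //; exists K => w w0.
  have [v [v0 Dv hv]] := hK (D w) I.
  have [M [hM dM] Mv] := deck_exists HA hS gD v0 w0 Dv.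
  (* The segment from [z] to [M z] projects to a loop, and [rho] of its class sends [z] to [M z]. *)
  pose ft (t : R) := pt z (mob M z) t.
  have Mz0 : 0 < (mob M z).2 by exact: mob_H.
  have lft : is_lift D (@unitI R) (D \o ft) ft.
    move=> t It; split=> //; first exact: pt_H.
    move=> V nV; have h : \forall s \near t, V (ft s) := @pt_cont R z (mob M z) t V nV.
    by near=> s => _; near: s.
  have lf : is_loop x (D \o ft).
    by apply: (lift_loop _ _ lft); rewrite /= /ft ?pt0 ?pt1 ?dM.
  exists (cls (D \o ft)).
  have [_ eg] := rhoP (cls (D \o ft)).
  rewrite (eg _ ft lf erefl lft (pt0 _ _)) /ft pt1 -Mv hd_mob //.
Unshelve. all: by end_near. Qed.

(** * Dirichlet tessellations in the Klein model *)

Section Tessellation.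
Variables (R : realType) (G : groupType) (fa fb fc : G -> R).
Implicit Types (p q r g h : G) (v : R * R).

(* In the coordinates [(x, x^2 + y^2)] the comparison of the distances from a
   point to two points of an orbit is affine; [cell] then defines the Dirichlet
   cells, and [klein] the image of the half-plane. *)
Definition afn g v := fa g + fb g * v.1 + fc g * v.2.
Definition klein v := v.1 ^+ 2 < v.2.
Definition cell v g := forall h, afn g v <= afn h v.
(* Orientation of the triangle of the gradients of [afn p], [afn q], [afn r]. *)
Definition dor p q r := (fb q - fb p) * (fc r - fc p) - (fc q - fc p) * (fb r - fb p).
(** Motion parallel to the line where [afn p = afn q]; by [afn_along] the difference [afn r - afn p]
    changes at the rate [dor p q r]. *)
Definition along p q v (s : R) := (v.1 - s * (fc q - fc p), v.2 + s * (fb q - fb p)).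

Lemma dorC p q r : dor q p r = - dor p q r.
Proof. by rewrite /dor; ring. Qed.
Lemma dorCA p q r : dor q r p = dor p q r.
Proof. by rewrite /dor; ring. Qed.
Lemma afn_along p q r v s : afn r (along p q v s) - afn p (along p q v s) =
  afn r v - afn p v + s * dor p q r.
Proof. by rewrite /dor /afn /along /=; ring. Qed.
Lemma dor_pq p q : dor p q q = 0.
Proof. by rewrite /dor; ring. Qed.

(** The convex geometry of the Dirichlet cells, separated from the group action. [tess_gen] excludes
    collinear gradients among cells that meet, [tess_opt] puts these gradients in convex position
    (see [not_inside]), [tess_near] is local finiteness in semicontinuous form, and [tess_bd] keeps
    each cell away from the ideal boundary. *)
Record tess : Prop := Tess {
  tess_gen : forall p q r v, klein v -> cell v p -> cell v q -> cell v r ->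
    p <> q -> q <> r -> p <> r -> dor p q r != 0;
  tess_grad : forall p q, fb p = fb q -> fc p = fc q -> p = q;
  tess_opt : forall g, exists o : R * R, forall h, h <> g -> afn g o < afn h o;
  tess_fin : forall v, klein v -> exists s : seq G, forall h, cell v h -> h \in s;
  tess_ne : forall v, klein v -> exists g, cell v g;
  tess_near : forall v, klein v -> \forall v' \near v, klein v' /\ forall h, cell v' h -> cell v h;
  tess_bd : forall g, exists B : R, exists2 c : R, 0 < c & forall v, klein v -> cell v g ->
    [/\ `|v.1| <= B, `|v.2| <= B & c <= v.2 - v.1 ^+ 2] }.

Hypothesis HT : tess.
Let Hgen := tess_gen HT.
Let Hgrad := tess_grad HT.
Let Hopt := tess_opt HT.
Let Hfin := tess_fin HT.
Let Hne := tess_ne HT.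
Let Hnear := tess_near HT.
Let Hbd := tess_bd HT.

Lemma cell_eq v p q : cell v p -> cell v q -> afn p v = afn q v.
Proof. by move=> hp hq; apply/eqP; rewrite eq_le hp hq. Qed.

(** With the gradient of [p] inside the triangle of the other three, a positive combination of
    [afn q - afn p], [afn r - afn p] and [afn s - afn p] is constant. It vanishes at [v], but is
    positive where [p] is the strict minimum. *)
Lemma not_inside v p q r s : cell v p -> cell v q -> cell v r -> cell v s ->
  0 < dor q r p -> 0 < dor r s p -> 0 < dor s q p -> False.
Proof.
move=> hp hq hr hs h1 h2 h3.
have [qp [rp sp]] : q <> p /\ r <> p /\ s <> p.
  split; [|split] => e; move: h1 h2 h3; rewrite e /dor; lra.
have [w ho] := Hopt p.
have l1 := ho _ qp; have l2 := ho _ rp; have l3 := ho _ sp.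
have e1 := cell_eq hp hq; have e2 := cell_eq hp hr; have e3 := cell_eq hp hs.
have E : dor r s p * (afn q w - afn p w) + dor s q p * (afn r w - afn p w) + dor q r p * (afn s w - afn p w)
  = dor r s p * (afn q v - afn p v) + dor s q p * (afn r v - afn p v) + dor q r p * (afn s v - afn p v).
  by rewrite /dor /afn; ring.
have : 0 < dor r s p * (afn q w - afn p w) + dor s q p * (afn r w - afn p w) + dor q r p * (afn s w - afn p w).
  by rewrite !addr_gt0 // mulr_gt0 // subr_gt0.
by rewrite E -e1 -e2 -e3 !subrr !mulr0 !addr0 ltxx.
Qed.

(* The cells at a point are cyclically ordered: [nth p0 t i] follows [nth p0 (p0 :: t) i]. *)
Lemma cell_cycle v p0 : klein v -> cell v p0 -> exists t, [/\ uniq (p0 :: t),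
  forall h, (h \in p0 :: t) <-> cell v h &
  forall i, (i <= size t)%N -> forall r, r \in p0 :: t ->
    r <> nth p0 (p0 :: t) i -> r <> nth p0 t i -> 0 < dor (nth p0 (p0 :: t) i) (nth p0 t i) r].
Proof.
move=> kv c0; have [s0 hs0] := Hfin kv.
pose s1 := [seq h <- undup s0 | `[< cell v h >] && (h != p0)].
(* Order by angle seen from [p0]. Transitivity could only fail with [p0] inside a triangle of other
   gradients, which [not_inside] excludes. *)
pose le p q := (p == q) || (0 < dor p0 p q).
pose P := mem s1; pose t := sort le s1.
have s1P h : (h \in s1) -> cell v h /\ h <> p0.
  by rewrite mem_filter => /andP[/andP[/asboolP ? /eqP ?] _].
have dn p q : p \in s1 -> q \in s1 -> p <> q -> dor p0 p q != 0.
  move=> /s1P[cp np] /s1P[cq nq] pq; apply: (Hgen kv) => //; exact: nesym.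
have tot : {in P &, total le}.
  move=> p q hp hq; rewrite /le; have [//|/eqP pq] := eqVneq p q.
  have := dn p q hp hq pq; rewrite neq_lt => /orP[h|->]; last by rewrite orbT.
  have -> : dor p0 q p = - dor p0 p q by rewrite /dor; ring.
  by rewrite oppr_gt0 h !orbT.
have trans : {in P & &, transitive le}.
  move=> q p r hq hp hr; rewrite /le; case: eqP => [->|pq] /=; first by case: eqP.
  move=> l1; case: eqP => [<-|qr] /= ; first by rewrite l1 orbT.
  move=> l2; have [//|/eqP pr] := eqVneq p r.
  have := dn p r hp hr pr; rewrite neq_lt => /orP[h|->]; last by rewrite orbT.
  exfalso; have [cp _] := s1P _ hp; have [cq _] := s1P _ hq; have [cr _] := s1P _ hr.
  apply: (not_inside c0 cp cq cr).
  - by rewrite dorCA.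
  - by rewrite dorCA.
  - by rewrite dorCA; move: h; rewrite /dor; lra.
have allP : all P s1 by apply/allP.
have st : sorted le t by apply: sort_sorted_in allP.
have allt : all P t by rewrite all_sort.
have ut : uniq t by rewrite sort_uniq filter_uniq // undup_uniq.
have memt h : (h \in t) = (h \in s1) by rewrite mem_sort.
have lt_t i j : (i < j < size t)%N -> 0 < dor p0 (nth p0 t i) (nth p0 t j).
  move=> /andP[ij js]; have is_ := ltn_trans ij js.
  have := sorted_ltn_nth_in trans p0 allt st i j is_ js ij.
  by rewrite /le nth_uniq // ltn_eqF.
have ct i : (i < size t)%N -> cell v (nth p0 t i).
  by move=> h; have /s1P[] : nth p0 t i \in s1 by rewrite -memt mem_nth.
(* Otherwise the gradient of the middle cell would lie inside the triangle formed by [p0] and the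
   two outer ones. *)
have lt3 i j k : (i < j < k)%N -> (k < size t)%N -> 0 < dor (nth p0 t i) (nth p0 t j) (nth p0 t k).
  move=> /andP[ij jk] ks; have js := ltn_trans jk ks; have is_ := ltn_trans ij js.
  have /(_ _)/(_ _)/(_ _) n0 := Hgen kv (ct i is_) (ct j js) (ct k ks).
  have : dor (nth p0 t i) (nth p0 t j) (nth p0 t k) != 0.
    by apply: n0; apply/eqP; rewrite nth_uniq // ltn_eqF // (ltn_trans ij).
  rewrite neq_lt => /orP[h|//]; exfalso.
  apply: (not_inside (ct j js) c0 (ct i is_) (ct k ks)).
  - by apply: lt_t; rewrite ij.
  - by move: h; rewrite /dor; lra.
  - by rewrite -dorCA -dorCA; rewrite dorCA dorCA -dorCA; apply: lt_t; rewrite jk.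
exists t; split.
- by rewrite /= ut memt mem_filter eqxx andbF.
- move=> h; rewrite inE memt mem_filter; split.
    by case/orP => [/eqP -> //|/andP[/andP[/asboolP]]].
  move=> ch; have [//|hp] := eqVneq h p0.
  by rewrite mem_undup hs0 // andbT /= andbT; apply/asboolP.
- have mem_s k : (k < size t)%N -> nth p0 t k \in p0 :: t by move=> h; rewrite inE mem_nth ?orbT.
  case=> [|i] /= hi r; rewrite inE => /orP[/eqP -> // n1 n2|/(nthP p0)[k hk <-] n1 n2].
  + case: (posnP k) => [k0|k0]; first by case: n2; rewrite k0.
    by apply: lt_t; rewrite k0.
  + by move: hi; rewrite leq_eqVlt => /orP[/eqP hi|hi]; [case: n2; rewrite nth_default ?hi | rewrite dorCA; apply: lt_t; rewrite ltnSn].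
  + move: hi; rewrite leq_eqVlt => /orP[/eqP hi|hi].
      rewrite [nth p0 t i.+1]nth_default ?hi // -dorCA; apply: lt_t.
      rewrite -hi ltnSn andbT; move: hk; rewrite -hi ltnS leq_eqVlt => /orP[/eqP ki|//].
      by case: n1; rewrite ki.
    case: (ltngtP k i) => [ki|ki|ki]; last by case: n1; rewrite ki.
      by rewrite dorCA; apply: lt3; rewrite ?ki ?ltnSn.
    move: ki; rewrite leq_eqVlt => /orP[/eqP ki|ki]; first by case: n2; rewrite ki.
    by apply: lt3; rewrite ?ltnSn.
Qed.

Definition edge p q := p <> q /\ exists v v', [/\ v <> v', klein v /\ klein v',
  cell v p /\ cell v q & cell v' p /\ cell v' q].

(* [v] is the end of the edge between the cells [p] and [q] at which
   [p], [q] are consecutive in the positive cyclic order. *)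
Definition vert v p q := [/\ klein v, cell v p /\ cell v q, p <> q,
  (exists r, [/\ cell v r, r <> p & r <> q]) &
  forall r, cell v r -> r <> p -> r <> q -> 0 < dor p q r].

Lemma edgeC p q : edge p q -> edge q p.
Proof.
by move=> [pq [v [v' [vv kk [? ?] [? ?]]]]]; split; [exact: nesym | exists v, v'].
Qed.

Lemma along0 p q v : along p q v 0 = v.
Proof. by case: v => a b; rewrite /along /= !mul0r subr0 addr0. Qed.

Lemma alongD p q v s t : along p q (along p q v s) t = along p q v (s + t).
Proof. by rewrite /along /=; congr pair; ring. Qed.

Lemma on_line v v' p q : p <> q -> cell v p -> cell v q -> cell v' p -> cell v' q ->
  exists s, v' = along p q v s.
Proof.
move=> pq h1 h2 h3 h4; have := cell_eq h1 h2; have := cell_eq h3 h4.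
rewrite /afn => e1 e2.
have e : (fb q - fb p) * (v'.1 - v.1) + (fc q - fc p) * (v'.2 - v.2) = 0 by lra.
have [b0|b0] := eqVneq (fb q - fb p) 0.
  have c0 : fc q - fc p != 0.
    by apply/eqP => c0; apply: pq; apply: Hgrad; lra.
  exists (- (v'.1 - v.1) / (fc q - fc p)).
  move: e; rewrite b0 mul0r add0r => /eqP; rewrite mulf_eq0 (negPf c0) /= subr_eq0 => /eqP e.
  rewrite /along b0 mulr0 addr0 -e mulfVK // opprK addrC subrK.
  by case: (v').
exists ((v'.2 - v.2) / (fb q - fb p)).
rewrite /along mulfVK // [v.2 + _]addrC subrK [LHS]surjective_pairing; congr pair.
have -> : (v'.2 - v.2) / (fb q - fb p) * (fc q - fc p) = - (v'.1 - v.1).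
  have e3 : (v'.2 - v.2) * (fc q - fc p) = - (v'.1 - v.1) * (fb q - fb p) by lra.
  by rewrite mulrAC e3 mulfK.
by lra.
Qed.

Lemma along_cont p q v (t : R) : along p q v s @[s --> t] --> along p q v t.
Proof.
have h (a b : R) : (a + s * b) @[s --> t] --> a + t * b.
  by apply: (cvgD (cvg_cst a) (cvgM _ (cvg_cst b))); exact: cvg_id.
have h' (a b : R) : (a - s * b) @[s --> t] --> a - t * b.
  by apply: (cvgB (cvg_cst a) (cvgM _ (cvg_cst b))); exact: cvg_id.
exact: (cvg_pairR (h' _ _) (h _ _)).
Qed.

Lemma afn_cont g v : afn g w @[w --> v] --> afn g v.
Proof.
have c1 : (fst : R * R -> R) x @[x --> v] --> v.1 by exact: cvg_fst.
have c2 : (snd : R * R -> R) x @[x --> v] --> v.2 by exact: cvg_snd.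
exact: (cvgD (cvgD (cvg_cst _) (cvgM (cvg_cst _) c1)) (cvgM (cvg_cst _) c2)).
Qed.

Lemma depth_cont v : (w.2 - w.1 ^+ 2) @[w --> v] --> v.2 - v.1 ^+ 2.
Proof.
have c1 : (fst : R * R -> R) x @[x --> v] --> v.1 by exact: cvg_fst.
have c2 : (snd : R * R -> R) x @[x --> v] --> v.2 by exact: cvg_snd.
by apply: (cvgB c2); rewrite expr2; exact: (cvgM c1 c1).
Qed.

Lemma sup_ge0 (E : set R) (F : R -> R) : has_sup E -> F t @[t --> sup E] --> F (sup E) ->
  (forall t, E t -> 0 <= F t) -> 0 <= F (sup E).
Proof.
move=> hE cF h; rewrite leNgt; apply/negP => neg.
have nF : \forall t \near sup E, F t < 0 by exact: (cvgr_lt _ cF).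
have /nbhs_ballP[e /= e0 he] := nF.
have [t Et te] := sup_adherent e0 hE.
have : F t < 0.
  apply: he; rewrite /ball /= ger0_norm; first by lra.
  by rewrite subr_ge0; apply: ub_le_sup => //; case: hE.
by rewrite ltNge h.
Qed.

(** By [afn_along], moving from [v] against the direction of [along p q] lets the third cell [r]
    beat [p]; so the vertex is the rear end of the common edge. *)
Lemma vert_uniq v v' p q : vert v p q -> vert v' p q -> v = v'.
Proof.
move=> [kv [h1 h2] pq [r [cr rp rq]] hr] [kv' [h1' h2'] _ [r' [cr' rp' rq']] hr'].
have [s vs] := on_line pq h1 h2 h1' h2'.
case: (ltgtP s 0) => [s0|s0|s0]; last by rewrite vs s0 along0.
  have := h1' r; rewrite -subr_ge0 vs afn_along (cell_eq cr h1) subrr add0r.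
  by rewrite nmulr_rge0 // leNgt hr.
have := h1 r'; rewrite -subr_ge0.
have := afn_along p q r' v s; rewrite -vs (cell_eq cr' h1') subrr => /esym/eqP.
rewrite addr_eq0 => /eqP ->; rewrite oppr_ge0 pmulr_rle0 // leNgt.
by rewrite hr'.
Qed.

Lemma along_neq p q v s : p <> q -> s != 0 -> v <> along p q v s.
Proof.
move=> pq s0 e; apply: pq; apply: Hgrad.
  have /(congr1 snd) /= h := e; have : s * (fb q - fb p) = 0 by lra.
  by move/eqP; rewrite mulf_eq0 (negPf s0) subr_eq0 => /eqP ->.
have /(congr1 fst) /= h := e; have : s * (fc q - fc p) = 0 by lra.
by move/eqP; rewrite mulf_eq0 (negPf s0) subr_eq0 => /eqP ->.
Qed.

Lemma cells_along p q v s : afn p v = afn q v -> cell (along p q v s) p <-> cell (along p q v s) q.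
Proof.
move=> e; have := afn_along p q q v s; rewrite e dor_pq subrr mulr0 addr0 => /eqP.
by rewrite subr_eq0 => /eqP e'; split=> h r; [rewrite e' | rewrite -e'].
Qed.

(** A short step forward from [v] meets only cells of [v], and every cell other than [p] and [q]
    loses to [p] there, so [p] and [q] share a second point. *)
Lemma edge_consecutive v p q : klein v -> cell v p -> cell v q -> p <> q ->
  (forall r, cell v r -> r <> p -> r <> q -> 0 < dor p q r) -> edge p q.
Proof.
move=> kv h1 h2 pq hr; split=> //.
have n1 := @along_cont p q v 0; rewrite along0 in n1.
have /nbhs_ballP[e /= e0 he] := n1 _ (Hnear kv).
have [k hk] : klein (along p q v (e / 2)) /\ forall h, cell (along p q v (e / 2)) h -> cell v h.
  by apply: he; rewrite /ball /= sub0r normrN ger0_norm; lra.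
exists v, (along p q v (e / 2)).
have hpq := @cells_along p q v (e / 2) (cell_eq h1 h2).
have cp : cell (along p q v (e / 2)) p.
  have [r cr] := Hne k; have [rp|rp] := pselect (r = p); first by rewrite rp in cr.
  have [rq|rq] := pselect (r = q); first by rewrite rq in cr; apply/hpq.
  have cvr := hk r cr.
  have := cr p; rewrite -subr_le0 afn_along (cell_eq cvr h1) subrr add0r.
  by rewrite pmulr_rle0 ?leNgt ?hr // divr_gt0.
split=> //; last by split=> //; apply/hpq.
by apply: along_neq => //; apply: lt0r_neq0; rewrite divr_gt0.
Qed.

Lemma vert_edge v p q : vert v p q -> edge p q.
Proof. by move=> [kv [h1 h2] pq _ hr]; exact: edge_consecutive hr. Qed.

(** Move backward along the edge as long as it lasts. [tess_bd] bounds the motion and keeps its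
    limit in the model; just beyond the limit another cell takes over, and it is a cell at the limit
    by [tess_near]. *)
Lemma edge_vert p q : edge p q -> exists v, vert v p q.
Proof.
move=> [pq [v1 [v2 [vv [k1 k2] [c1p c1q] [c2p c2q]]]]].
wlog [s s0 vs] : v1 v2 vv k1 k2 c1p c1q c2p c2q / exists2 s, 0 < s & v2 = along p q v1 s.
  move=> W; have [s vs] := on_line pq c1p c1q c2p c2q.
  case: (ltgtP s 0) => [s0|s0|s0]; last by case: vv; rewrite vs s0 along0.
    apply: (W v2 v1) => //; first exact: nesym.
    by exists (- s); rewrite ?oppr_gt0 // vs alongD subrr along0.
  by apply: (W v1 v2) => //; exists s.
pose a t := along p q v1 (- t).
pose E := [set t : R | [/\ 0 <= t, klein (a t), cell (a t) p & cell (a t) q]].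
have E0 : E 0 by rewrite /E /= /a oppr0 along0.
have [B [c c0 hB]] := Hbd p.
have Eb : has_ubound E.
  have nz : 0 < `|fc q - fc p| + `|fb q - fb p|.
    rewrite lt_neqAle addr_ge0 // andbT eq_sym; apply/eqP => h.
    have n1 : `|fc q - fc p| >= 0 by []. have n2 : `|fb q - fb p| >= 0 by [].
    have /normr0_eq0 h1 : `|fc q - fc p| = 0 by lra.
    have /normr0_eq0 h2 : `|fb q - fb p| = 0 by lra.
    by apply: pq; apply: Hgrad; lra.
  exists ((`|v1.1| + `|v1.2| + 2 * B) / (`|fc q - fc p| + `|fb q - fb p|)) => t [t0 kt ct _].
  have [b1 b2 _] := hB _ kt ct; rewrite ler_pdivlMr //.
  have e1 : t * `|fc q - fc p| <= `|v1.1| + B.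
    rewrite -{1}(ger0_norm t0) -normrM.
    have -> : t * (fc q - fc p) = (a t).1 - v1.1 by rewrite /a /along /=; ring.
    by apply: (le_trans (ler_normB _ _)); rewrite addrC lerD.
  have e2 : t * `|fb q - fb p| <= `|v1.2| + B.
    rewrite -{1}(ger0_norm t0) -normrM.
    have -> : t * (fb q - fb p) = v1.2 - (a t).2 by rewrite /a /along /=; ring.
    by apply: (le_trans (ler_normB _ _)); rewrite lerD.
  by lra.
have Es : has_sup E by split=> //; exists 0.
set m := sup E in Es.
have m0 : 0 <= m by apply: ub_le_sup.
have ca t : a s @[s --> t] --> a t.
  have cN : (- u : R) @[u --> t] --> - t by apply: cvgN; exact: cvg_id.
  exact: (cvg_comp _ _ cN (along_cont (p := p) (q := q) (v := v1) (t := - t))).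
have ka : klein (a m).
  have : 0 <= (fun t => ((a t).2 - (a t).1 ^+ 2) - c) m.
    apply: (@sup_ge0 E (fun t => ((a t).2 - (a t).1 ^+ 2) - c)) => // [|t [t0 kt ct _]]; last by have [_ _] := hB _ kt ct; rewrite subr_ge0.
    by apply: cvgB; [exact: (cvg_comp _ _ (ca m) (@depth_cont (a m))) | exact: cvg_cst].
  by rewrite /klein /=; lra.
have cla g : (forall t, E t -> cell (a t) g) -> cell (a m) g.
  move=> h r; rewrite -subr_ge0.
  suff : 0 <= (fun t => afn r (a t) - afn g (a t)) m by [].
  apply: (@sup_ge0 E (fun t => afn r (a t) - afn g (a t))) => // [|t /h]; last by move=> /(_ r); rewrite subr_ge0.
  by apply: cvgB; exact: (cvg_comp _ _ (ca m) (@afn_cont _ (a m))).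
have cp : cell (a m) p by apply: cla => t [].
have cq : cell (a m) q by apply: cla => t [].
have v2a : v2 = along p q (a m) (m + s) by rewrite /a alongD vs; congr along; ring.
exists (a m); split=> //.
- have /nbhs_ballP[e /= e0 he] := ca m _ (Hnear ka).
  have [kt ht] : klein (a (m + e / 2)) /\ forall h, cell (a (m + e / 2)) h -> cell (a m) h.
    by apply: he; rewrite /ball /= opprD addrA subrr sub0r normrN ger0_norm; lra.
  have hpq := @cells_along p q v1 (- (m + e / 2)) (cell_eq c1p c1q).
  have nE : ~ E (m + e / 2).
    move=> En; have : m + e / 2 <= m by apply: ub_le_sup.
    by lra.
  have [r cr] := Hne kt; exists r; split; first exact: ht.
    by move=> e1; rewrite e1 in cr; apply: nE; split=> //; [lra | apply/hpq].
  by move=> e1; rewrite e1 in cr; apply: nE; split=> //; [lra | apply/hpq].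
- move=> r cr rp rq.
  have n0 : dor p q r != 0 by apply: (Hgen ka cp cq cr) => //; exact: nesym.
  have := c2p r; rewrite -subr_ge0 v2a afn_along (cell_eq cr cp) subrr add0r pmulr_rge0; last by lra.
  by rewrite le_eqVlt eq_sym (negPf n0).
Qed.

(** The edge leaves [v] in a direction [s], and survival of [p] there forces [s * dor p q r' > 0]
    for every third cell [r'] at [v]: the signs all agree. *)
Lemma edge_at v p q r : klein v -> cell v p -> cell v q -> edge p q ->
  cell v r -> r <> p -> r <> q -> vert v p q \/ vert v q p.
Proof.
move=> kv cp cq [pq [v1 [v2 [vv [k1 k2] [c1p c1q] [c2p c2q]]]]] cr rp rq.
have [w [vw kw cwp cwq]] : exists w, [/\ v <> w, klein w, cell w p & cell w q].
  by have [e|n] := pselect (v = v1); [exists v2; rewrite e | exists v1].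
have [s ws] := on_line pq cp cq cwp cwq.
have s0 : s != 0 by apply/eqP => s0; apply: vw; rewrite ws s0 along0.
have sd r' : cell v r' -> r' <> p -> r' <> q -> 0 < s * dor p q r'.
  move=> cr' rp' rq'; have n0 : dor p q r' != 0 by apply: (Hgen kv cp cq cr') => //; exact: nesym.
  have := cwp r'; rewrite -subr_ge0 ws afn_along (cell_eq cr' cp) subrr add0r.
  by rewrite le_eqVlt eq_sym mulf_eq0 (negPf s0) (negPf n0).
case: (ltgtP s 0) => [sn|sp|]; last by move=> e; rewrite e eqxx in s0.
  right; split=> //; [exact: nesym | by exists r | move=> r' cr' rq' rp'].
  by have := sd r' cr' rp' rq'; rewrite nmulr_rgt0 // -oppr_gt0 -dorC.
left; split=> //; [by exists r | move=> r' cr' rp' rq'].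
by have := sd r' cr' rp' rq'; rewrite pmulr_rgt0.
Qed.

Lemma vert_succ_uniq v p q q' : vert v p q -> vert v p q' -> q = q'.
Proof.
move=> [_ [_ cq] pq _ hr] [_ [_ cq'] pq' _ hr'].
have [//|/eqP n] := eqVneq q q'.
have H1 := hr q' cq' (nesym pq') (nesym n); have H2 := hr' q cq (nesym pq) n.
by exfalso; move: H1 H2; rewrite /dor; lra.
Qed.

Lemma vert_pred_uniq v p q q' : vert v q p -> vert v q' p -> q = q'.
Proof.
move=> [_ [cq _] pq _ hr] [_ [cq' _] pq' _ hr'].
have [//|/eqP n] := eqVneq q q'.
have H1 := hr q' cq' (nesym n) pq'; have H2 := hr' q cq n pq.
by exfalso; move: H1 H2; rewrite /dor; lra.
Qed.

Lemma vert_cycle v p q : vert v p q -> exists t, [/\ uniq (p :: t),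
  forall h, (h \in p :: t) <-> cell v h, nth p t 0 = q &
  forall i, (i <= size t)%N -> vert v (nth p (p :: t) i) (nth p t i)].
Proof.
move=> vpq; have [kv [cp cq] pq [r [cr rp rq]] hr] := vpq.
have [t [ut mt ht]] := cell_cycle kv cp.
have s1 : (1 < size t)%N.
  have : (size [:: p; q; r] <= size (p :: t))%N.
    apply: uniq_leq_size => [|x]; last by rewrite !inE => /or3P[]/eqP->; apply/mt.
    by rewrite /= !inE !negb_or; apply/andP; split; [apply/andP; split; apply/eqP; [|exact: nesym]|rewrite andbT; apply/eqP; exact: nesym].
  by [].
(* At [i = size t] the default value [p] of [nth] closes the cycle. *)
have V i : (i <= size t)%N -> vert v (nth p (p :: t) i) (nth p t i).
  move=> hi.
  have ci : cell v (nth p (p :: t) i) by apply/mt; apply: mem_nth.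
  have ci' : cell v (nth p t i).
    apply/mt; move: hi; rewrite leq_eqVlt => /orP[/eqP e|h]; last by rewrite inE mem_nth ?orbT.
    by rewrite nth_default ?e // mem_head.
  have inj a b : (a <= size t)%N -> (b <= size t)%N -> nth p (p :: t) a = nth p (p :: t) b -> a = b.
    by move=> ha hb /eqP; rewrite nth_uniq // => /eqP.
  have [j hj ej] : exists2 j, (j <= size t)%N & nth p t i = nth p (p :: t) j /\ j != i.
    move: hi; rewrite leq_eqVlt => /orP[/eqP e|h].
      exists 0%N => //; rewrite nth_default ?e //; split=> //.
      by rewrite eq_sym -lt0n ?e; exact: ltnW.
    by exists i.+1 => //=; split=> //; rewrite gtn_eqF.
  have [ej1 ej2] := ej.
  have nij : nth p (p :: t) i <> nth p t i.
    by rewrite ej1 => /(inj _ _ hi hj) e; rewrite e eqxx in ej2.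
  split=> //; last first.
    by move=> r' cr' h1 h2; apply: ht => //; apply/mt.
  have [k hk /andP[ki kj]] : exists2 k, (k <= size t)%N & (k != i) && (k != j).
    have [/andP[h1 h2]|] := boolP ((0%N != i) && (0%N != j)); first by exists 0%N; rewrite ?h1.
    rewrite negb_and !negbK => h0.
    have [/andP[h1 h2]|] := boolP ((1%N != i) && (1%N != j)); first by exists 1%N; rewrite ?h1 // ltnW.
    rewrite negb_and !negbK => h1.
    exists 2%N => //; move: h0 h1 ej2; clear.
    by move=> /orP[] /eqP <- /orP[] // /eqP <-.
  exists (nth p (p :: t) k); split; first by apply/mt; apply: mem_nth.
    by move=> /(inj _ _ hk hi) e; rewrite e eqxx in ki.
  by rewrite ej1 => /(inj _ _ hk hj) e; rewrite e eqxx in kj.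
exists t; split=> //.
by apply: (vert_succ_uniq (V 0%N isT) vpq).
Qed.

Lemma cells_connected v (Phi : G -> Prop) p q : klein v ->
  (forall g h, cell v g -> cell v h -> edge g h -> Phi g -> Phi h) ->
  cell v p -> Phi p -> cell v q -> Phi q.
Proof.
move=> kv hPhi cp Pp cq; have [t [ut mt ht]] := cell_cycle kv cp.
have Pi i : (i <= size t)%N -> Phi (nth p (p :: t) i).
  elim: i => [//|i IH] hi /=; have hi' := ltnW hi.
  apply: hPhi (IH hi').
  - by apply/mt; apply: mem_nth.
  - by apply/mt; rewrite inE mem_nth ?orbT.
  apply: (edge_consecutive kv).
  - by apply/mt; apply: mem_nth.
  - by apply/mt; rewrite inE mem_nth ?orbT.
  - have : nth p (p :: t) i != nth p (p :: t) i.+1 by rewrite nth_uniq // ltn_eqF.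
    by move/eqP.
  - by move=> r cr r1 r2; apply: ht => //; apply/mt.
have /mt qt := cq.
by have := Pi (index q (p :: t)); rewrite nth_index // -ltnS index_mem; apply.
Qed.

Lemma vert_next v p q : vert v p q -> exists r, vert v q r.
Proof.
move=> vpq; have [t [ut mt t0 V]] := vert_cycle vpq.
exists (nth p t 1); have := V 1%N; rewrite /= t0; apply.
rewrite ltnNge leqn0 size_eq0; apply/negP => /eqP e; move: t0 vpq; rewrite e /= => -> [].
by [].
Qed.
End Tessellation.

(** * The presentation of a group acting on a tessellation *)

Definition letters (G : groupType) (rels : seq (seq G)) : seq G := flatten rels.

(* [rels] presents [G]; every letter and its inverse occur exactly once. *)
Record surface_presentation (G : groupType) (rels : seq (seq G)) : Prop := SurfacePresentation {
  sp_uniq : uniq (letters rels);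
  sp_ne1 : forall x, x \in letters rels -> x <> 1%g;
  sp_inv : forall x, x \in letters rels -> x^-1%g \in letters rels;
  sp_rel : forall r, r \in rels -> (\prod_(x <- r) x)%g = 1%g;
  sp_gen : forall g, exists2 w : seq G, {subset w <= letters rels} & (\prod_(x <- w) x)%g = g;
  sp_univ : forall (K : groupType) (f : G -> K),
    (forall x, x \in letters rels -> f x^-1%g = (f x)^-1%g) ->
    (forall r, r \in rels -> (\prod_(x <- r) f x)%g = 1%g) ->
    exists2 phi : G -> K, {morph phi : x y / (x * y)%g} & {in letters rels, phi =1 f} }.

(** * Products along the orbits of an injective map *)

Section Orbits.
Variables (T : finType) (nu : T -> T).
Hypothesis nu_inj : injective nu.

Lemma prod_traject (K : groupType) (F : T -> K) x n :
  (\prod_(y <- traject nu x n) F y = \prod_(j < n) F (iter j nu x))%g.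
Proof.
elim: n => [|n IH]; first by rewrite big_nil big_ord0.
by rewrite trajectSr big_rcons big_ord_recr /= IH.
Qed.

Lemma prod_orbit_conj (K : groupType) (F : T -> K) r x : fconnect nu r x ->
  (\prod_(y <- orbit nu r) F y = 1 -> \prod_(y <- orbit nu x) F y = 1)%g.
Proof.
move=> rx; have ord : fingraph.order nu x = fingraph.order nu r.
  by apply: eq_card => y; rewrite !inE; apply/esym/(same_connect (fconnect_sym nu_inj) rx).
have /iter_findex e := rx; rewrite /orbit ord !prod_traject.
set m := findex nu r x in e; set k := fingraph.order nu r.
have split_prod a b y : (\prod_(j < a + b) F (iter j nu y) =
    (\prod_(j < a) F (iter j nu y)) * \prod_(j < b) F (iter j nu (iter a nu y)))%g.
  elim: b => [|b IH]; first by rewrite addn0 big_ord0 mulg1.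
  by rewrite addnS !big_ord_recr /= IH mulgA -iterD addnC.
move=> h; have := split_prod m k r; rewrite addnC split_prod h mul1g iter_order // e.
by move/esym/(canRL (mulKg _)); rewrite mulVg.
Qed.

Lemma uniq_orbits (s : seq T) : uniq s -> {in s &, forall x y, x != y -> ~~ fconnect nu x y} ->
  uniq (flatten [seq orbit nu x | x <- s]).
Proof.
elim: s => //= x s IH /andP[xs us] h; rewrite cat_uniq orbit_uniq /= (IH us) ?andbT.
  apply/hasPn => y /flattenP[l /mapP[z zs ->]]; rewrite -!fconnect_orbit => zy.
  apply/negP => xy; have := h x z (mem_head _ _) _; rewrite inE zs orbT => /(_ isT).
  have -> : x != z by apply: contraNneq xs => ->.
  move=> /(_ isT) /negP; apply; apply: (connect_trans xy).
  by rewrite fconnect_sym.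
by move=> y z ys zs; apply: h; rewrite inE ?ys ?zs orbT.
Qed.
End Orbits.

Definition kap (R : realType) (w : R * R) : R * R := (w.1, w.1 ^+ 2 + w.2 ^+ 2).
Definition unkap (R : realType) (v : R * R) : R * R := (v.1, Num.sqrt (v.2 - v.1 ^+ 2)).

(** * Relators at the vertices and continuation of homomorphisms *)

Section Action.
Variables (R : realType) (G : groupType) (fa fb fc : G -> R).
Notation cell := (cell fa fb fc).
Notation vert := (vert fa fb fc).
Notation edge := (edge fa fb fc).
Notation dor := (dor fb fc).
Hypothesis HT : tess fa fb fc.
Variable ag : G -> R * R -> R * R.
Hypothesis ag_H : forall g (w : R * R), 0 < w.2 -> 0 < (ag g w).2.
Hypothesis ag_cont : forall g (w : R * R), 0 < w.2 -> ag g u @[u --> w] --> ag g w.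
Hypothesis ag1 : forall w : R * R, 0 < w.2 -> ag 1%g w = w.
Hypothesis agM : forall g h (w : R * R), 0 < w.2 -> ag (g * h)%g w = ag g (ag h w).
Hypothesis Hcell : forall g h (w : R * R), 0 < w.2 -> cell (kap (ag g w)) (g * h)%g <-> cell (kap w) h.
Hypothesis Hdor : forall g p q r (w : R * R), 0 < w.2 -> cell (kap w) p -> cell (kap w) q -> cell (kap w) r ->
  0 < dor p q r -> 0 < dor (g * p)%g (g * q)%g (g * r)%g.
Hypothesis Hfree : forall g (w : R * R), 0 < w.2 -> ag g w = w -> g = 1%g.
Hypothesis Hnb : exists s : seq G, forall v g, klein v -> cell v 1%g -> cell v g -> g \in s.
Variable z0 : R * R.
Hypothesis z0_H : 0 < z0.2.
Hypothesis cell_z0 : forall p, cell (kap z0) p <-> p = 1%g.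
Implicit Types (p q r g h x : G) (v w : R * R).

Lemma kap_klein w : 0 < w.2 -> klein (kap w).
Proof. by move=> w0; rewrite /klein /= ltrDl exprn_gt0. Qed.

Lemma unkap_H v : klein v -> 0 < (unkap v).2.
Proof. by move=> kv; rewrite sqrtr_gt0 subr_gt0. Qed.

Lemma unkapK v : klein v -> kap (unkap v) = v.
Proof.
move=> kv; rewrite /kap /= sqr_sqrtr ?subr_ge0 ?ltW // addrC subrK.
by case: (v).
Qed.

Lemma kapK w : 0 < w.2 -> unkap (kap w) = w.
Proof.
move=> w0; rewrite /unkap /= addrC addKr sqrtr_sqr ger0_norm ?ltW //.
by case: (w).
Qed.

Definition vertH w p q := 0 < w.2 /\ vert (kap w) p q.

Lemma edge_vertH p q : edge p q -> exists w, vertH w p q.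
Proof.
move=> /(edge_vert HT)[v vv]; have [kv _ _ _ _] := vv.
by exists (unkap v); split; [exact: unkap_H | rewrite unkapK].
Qed.

Lemma vertH_edge w p q : vertH w p q -> edge p q.
Proof. by case=> _ /(vert_edge HT). Qed.

Lemma vertH_uniq w w' p q : vertH w p q -> vertH w' p q -> w = w'.
Proof.
by move=> [w0 h] [w0' h']; rewrite -(kapK w0) (vert_uniq HT h h') kapK.
Qed.

Lemma vertH_act g w p q : vertH w p q -> vertH (ag g w) (g * p)%g (g * q)%g.
Proof.
move=> [w0 [kv [cp cq] pq [r [cr rp rq]] hr]]; split; first exact: ag_H.
split; [by apply: kap_klein; exact: ag_H | | by move/mulgI | |].
- by split; [exact: ((Hcell g _ w0).2 cp) | exact: ((Hcell g _ w0).2 cq)].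
- by exists (g * r)%g; split; [exact: ((Hcell g _ w0).2 cr) | move/mulgI | move/mulgI].
move=> r'; rewrite -[r'](mulKVg g) => /(Hcell g _ w0) cr' rp' rq'.
apply: (Hdor g w0 cp cq cr').
by apply: hr; [exact: cr' | move=> e; apply: rp'; rewrite e | move=> e; apply: rq'; rewrite e].
Qed.

Lemma edge_act g p q : edge p q -> edge (g * p)%g (g * q)%g.
Proof. by move=> /edge_vertH[w /(vertH_act g)/vertH_edge]. Qed.

Lemma edge1 p q : edge p q -> edge 1%g (p^-1 * q)%g.
Proof. by move=> /(edge_act p^-1%g); rewrite mulVg. Qed.

Lemma edge_inv x : edge 1%g x -> edge 1%g x^-1%g.
Proof. by move=> /edgeC/edge1; rewrite mulg1. Qed.

(** [(vn x).2] is the letter that follows [x] when the cells around the vertex [(vn x).1] are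
    visited in cyclic order, beginning with 1 and [x]. *)
Lemma nu_ex : exists vn : G -> (R * R) * G, forall x, edge 1%g x ->
  vertH (vn x).1 1%g x /\ vertH (vn x).1 x (x * (vn x).2)%g.
Proof.
have h x : exists c : (R * R) * G, edge 1%g x -> vertH c.1 1%g x /\ vertH c.1 x (x * c.2)%g.
  have [ex|] := pselect (edge 1%g x); last by exists (z0, 1%g).
  have [w [w0 vw]] := edge_vertH ex; have [r vr] := vert_next HT vw.
  by exists (w, (x^-1 * r)%g) => _; rewrite mulKVg.
by have [vn hvn] := choice h; exists vn.
Qed.

(** The successor [nu] permutes the letters because predecessors around a vertex are unique too; its
    orbits are the relators, so each letter occurs once. The product over an orbit fixes a vertex
    and is 1 by freeness. Conversely every vertex is a translate of one read by [nu], so the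
    relators suffice to integrate [f] around it. *)
Lemma relators_exist : exists rels : seq (seq G), [/\ uniq (flatten rels),
  forall x, x \in flatten rels <-> edge 1%g x,
  forall rl, rl \in rels -> (\prod_(x <- rl) x)%g = 1%g &
  forall (K : groupType) (f : G -> K),
    (forall x, edge 1%g x -> f x^-1%g = (f x)^-1%g) ->
    (forall rl, rl \in rels -> (\prod_(x <- rl) f x)%g = 1%g) ->
    forall w : R * R, 0 < w.2 -> exists t : G -> K, forall p q, cell (kap w) p -> cell (kap w) q ->
      edge p q -> t q = (t p * f (p^-1 * q))%g].
Proof.
have [vn hvn] := nu_ex; pose vt x := (vn x).1; pose nu x := (vn x).2.
have vtP x : edge 1%g x -> vertH (vt x) 1%g x by case/hvn.
have nuP x : edge 1%g x -> vertH (vt x) x (x * nu x)%g by case/hvn.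
have nuE x : edge 1%g x -> edge 1%g (nu x).
  by move=> /nuP/vertH_edge/edge1; rewrite mulKg.
have vt_nu x : edge 1%g x -> vt (nu x) = ag x^-1%g (vt x).
  move=> ex; apply: (vertH_uniq (vtP _ (nuE _ ex))).
  by have := vertH_act x^-1%g (nuP _ ex); rewrite mulVg mulKg.
have nu_inj x y : edge 1%g x -> edge 1%g y -> nu x = nu y -> x = y.
  move=> ex ey e; apply: invg_inj.
  have := vertH_act x^-1%g (vtP _ ex); rewrite mulVg mulg1 -vt_nu //.
  have := vertH_act y^-1%g (vtP _ ey); rewrite mulVg mulg1 -vt_nu // -e.
  by move=> [_ h1] [_ h2]; exact: (vert_pred_uniq h2 h1).
have [s hs] := Hnb.
pose en := [seq x <- undup s | `[< edge 1%g x >]].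
have enP x : (x \in en) <-> edge 1%g x.
  rewrite mem_filter mem_undup; split; first by case/andP => /asboolP.
  move=> ex; have [w [w0 [kv [c1 cx] _ _ _]]] := edge_vertH ex.
  by rewrite (hs _ _ kv c1 cx) andbT; apply/asboolP.
have en_val (x : seq_sub en) : edge 1%g (val x) by apply/enP; exact: valP.
have nu_en (x : seq_sub en) : nu (val x) \in en by apply/enP; apply: nuE.
pose nuT (x : seq_sub en) : seq_sub en := SeqSub (nu_en x).
have nuT_inj : injective nuT.
  by move=> x y /(congr1 val) /= e; apply: val_inj; apply: nu_inj.
(* [pp x n] is the [n]-th cell met around the vertex [vt x], starting from the cell of 1. *)
pose pp (x : seq_sub en) n := (\prod_(j < n) val (iter j nuT x))%g.
have ppS (x : seq_sub en) n : pp x n.+1 = (pp x n * val (iter n nuT x))%g.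
  by rewrite /pp big_ord_recr.
have ppP (x : seq_sub en) n : vertH (vt (val x)) (pp x n) (pp x n.+1) /\
    vt (val (iter n nuT x)) = ag (pp x n)^-1%g (vt (val x)).
  have [v0 _] := vtP _ (en_val x).
  elim: n => [|n [IH1 IH2]].
    rewrite /pp big_ord0 big_ord_recr big_ord0 /= mul1g invg1 ag1 //.
    by split=> //; exact: (vtP _ (en_val x)).
  have e : vt (val (iter n.+1 nuT x)) = ag (pp x n.+1)^-1%g (vt (val x)).
    have -> : val (iter n.+1 nuT x) = nu (val (iter n nuT x)) by [].
    rewrite (vt_nu _ (en_val _)) IH2 -agM //; congr ag.
    by rewrite /pp big_ord_recr /= invgM.
  split=> //; have := vertH_act (pp x n.+1) (vtP _ (en_val (iter n.+1 nuT x))).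
  rewrite e -agM // mulgV ag1 // mulg1.
  have -> : pp x n.+2 = (pp x n.+1 * val (iter n.+1 nuT x))%g by rewrite /pp big_ord_recr.
  by [].
(* After a full orbit the letter [x] returns, so the product fixes [vt x]. *)
have pp_order (x : seq_sub en) : pp x (fingraph.order nuT x) = 1%g.
  have [v0 _] := vtP _ (en_val x).
  have [_] := ppP x (fingraph.order nuT x); rewrite iter_order // => e.
  by apply: invg_inj; rewrite (Hfree v0 (esym e)) invg1.
pose rels : seq (seq G) := [seq map val (orbit nuT x) | x : seq_sub en <- enum (froots nuT)].
have flatE : flatten rels = map val (flatten [seq orbit nuT x | x : seq_sub en <- enum (froots nuT)]).
  by rewrite map_flatten -map_comp.
have memfl x : x \in flatten rels <-> edge 1%g x.
  rewrite flatE; split; first by case/mapP => y _ ->.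
  move=> /enP ex; apply/mapP; exists (SeqSub ex) => //.
  apply/flatten_mapP; exists (froot nuT (SeqSub ex)).
    by rewrite mem_enum; apply: roots_root; exact: fconnect_sym.
  by rewrite -fconnect_orbit fconnect_sym // connect_root.
exists rels; split=> //.
- rewrite flatE map_inj_uniq; last exact: val_inj.
  apply: uniq_orbits => //; first exact: enum_uniq.
  move=> x y; rewrite !mem_enum => /eqP rx /eqP ry; apply: contra => xy.
  by have /(fingraph.rootP (fconnect_sym nuT_inj)) := xy; rewrite rx ry => ->.
- move=> r /mapP[x _ ->]; rewrite big_map /orbit.
  by rewrite (prod_traject nuT (fun y : seq_sub en => val y)); exact: pp_order.
move=> K f fV frel w w0.
have orb1 (x : seq_sub en) : (\prod_(y <- orbit nuT x) f (val y))%g = 1%g.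
  apply: (prod_orbit_conj nuT_inj (r := froot nuT x)).
    by rewrite fconnect_sym // connect_root.
  rewrite -(big_map val xpredT f); apply: frel; apply/mapP; exists (froot nuT x) => //.
  by rewrite mem_enum; apply: roots_root; exact: fconnect_sym.
have kw := kap_klein w0; have [p cp] := tess_ne HT kw.
have symm (t : G -> K) : (forall h h', vert (kap w) h h' -> t h' = (t h * f (h^-1 * h'))%g) ->
    forall h h', vert (kap w) h' h -> t h' = (t h * f (h^-1 * h'))%g.
  move=> ht h h' vh; rewrite (ht _ _ vh) -mulgA.
  have -> : (h^-1 * h' = (h'^-1 * h)^-1)%g by rewrite invgM invgK.
  by rewrite fV ?mulgV ?mulg1 //; apply: edge1 (vert_edge HT vh).
have [[q [r [cq cr qp rp qr]]]|no3] := pselect (exists q r,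
    [/\ cell (kap w) q, cell (kap w) r, q <> p, r <> p & q <> r]); last first.
  exists (fun h => if h == p then 1%g else f (p^-1 * h)%g) => h h' ch ch' ee.
  have [hh _] := ee.
  have [hp|/eqP hp] := eqVneq h p.
    have [e|/eqP h'p] := eqVneq h' p; last by rewrite hp mul1g.
    by case: hh; rewrite hp e.
  have [e'|/eqP h'p] := eqVneq h' p; last by case: no3; exists h, h'.
  rewrite e' in ee *.
  have -> : (h^-1 * p = (p^-1 * h)^-1)%g by rewrite invgM invgK.
  by rewrite fV ?mulgV //; apply: edge1; exact: edgeC.
have [t [ut mt V]] : exists t, [/\ uniq (p :: t), forall h, (h \in p :: t) <-> cell (kap w) h &
    forall i, (i <= size t)%N -> vert (kap w) (nth p (p :: t) i) (nth p t i)].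
  have [t [ut mt ht]] := cell_cycle HT kw cp.
  have tp : nth p t 0 <> p.
    case: (t) ut mt => [|x t'] /= ut mt; last by move: ut; rewrite inE negb_or => /andP[/andP[/eqP/nesym]].
    by have := (mt q).2 cq; rewrite inE => /eqP.
  have vp : vert (kap w) p (nth p t 0).
    split=> //; [split=> //; apply/mt| exact: nesym | |].
    - by case: (t) tp => // x t' _; rewrite inE mem_head orbT.
    - have [e|n] := pselect (q = nth p t 0); last by exists q.
      by exists r; split=> //; rewrite -e; exact: nesym.
    - by move=> r' cr' n1 n2; apply: (ht 0%N) => //; apply/mt.
  by have [t' [u' m' _ V']] := vert_cycle HT vp; exists t'.
have v0 := V 0%N isT; rewrite /= in v0.
have ex : edge 1%g (p^-1 * nth p t 0)%g by apply: edge1; apply: vert_edge v0.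
have exn := (enP _).2 ex; pose x : seq_sub en := SeqSub exn.
have vtx : vt (val x) = ag p^-1%g w.
  apply: (vertH_uniq (vtP _ ex)); have := vertH_act p^-1%g (conj w0 v0).
  by rewrite mulVg.
have Vp n : vert (kap w) (p * pp x n)%g (p * pp x n.+1)%g.
  have [h _] := ppP x n; have [_] := vertH_act p h.
  by rewrite vtx -agM // mulgV ag1.
have sE i : (i <= size t)%N -> nth p (p :: t) i = (p * pp x i)%g.
  elim: i => [|i IH] hi; first by rewrite /pp big_ord0 mulg1.
  have := V i (ltnW hi); rewrite IH ?(ltnW hi) // => v1.
  exact: (vert_succ_uniq v1 (Vp i)).
(* An orbit shorter than the cycle of cells would repeat a cell, a longer one a letter. *)
have nE : fingraph.order nuT x = (size t).+1.
  apply/eqP; rewrite eqn_leq; apply/andP; split; last first.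
    rewrite ltnNge; apply/negP => le.
    have e := sE _ le; rewrite pp_order mulg1 in e.
    have : nth p (p :: t) (fingraph.order nuT x) == nth p (p :: t) 0 by rewrite e.
    by rewrite nth_uniq // gtn_eqF // fingraph.order_gt0.
  rewrite leqNgt; apply/negP => lt.
  have e1 : (p * pp x (size t).+1)%g = p.
    have := V (size t) (leqnn _); rewrite [nth p t _]nth_default // sE // => v1.
    exact: (vert_succ_uniq (Vp (size t)) v1).
  have pn : pp x (size t).+1 = 1%g by apply: (mulgI p); rewrite e1 mulg1.
  have it : iter (size t).+1 nuT x = x.
    apply: val_inj; have := Vp (size t).+1; rewrite e1 => v1.
    have e2 := vert_succ_uniq v0 v1; rewrite /= -/(iter _ _ _) in e2.
    by rewrite [val x]/= e2 ppS pn mul1g mulKg.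
  have := orbit_uniq nuT x; rewrite /orbit => uo.
  have := nth_uniq x (s := traject nuT x (fingraph.order nuT x)) (i := (size t).+1) (j := 0).
  rewrite size_traject lt fingraph.order_gt0 => /(_ isT isT uo).
  by rewrite !nth_traject ?fingraph.order_gt0 // it eqxx.
(* The potential is a partial product of [f] along the orbit; [orb1] makes it consistent where the
   cycle closes. *)
pose thN m := (\prod_(j < m) f (val (iter j nuT x)))%g.
have thS m : thN m.+1 = (thN m * f (val (iter m nuT x)))%g by rewrite /thN big_ord_recr.
pose th h := thN (index h (p :: t)).
have thV h h' : vert (kap w) h h' -> th h' = (th h * f (h^-1 * h'))%g.
  move=> vh; have [_ [ch ch'] _ _ _] := vh.
  have /mt hin := ch; have hi : (index h (p :: t) <= size t)%N by rewrite -ltnS -[(size t).+1]/(size (p :: t)) index_mem.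
  have hE := sE _ hi; rewrite nth_index // in hE.
  have h'E : h' = (p * pp x (index h (p :: t)).+1)%g.
    by apply: (vert_succ_uniq vh); rewrite {1}hE; exact: Vp.
  have fE : f (h^-1 * h')%g = f (val (iter (index h (p :: t)) nuT x)).
    congr f; rewrite h'E {1}hE invgM -mulgA mulKg ppS.
    by rewrite mulKg.
  rewrite fE /th -thS.
  move: hi; rewrite leq_eqVlt => /orP[/eqP e|lt].
    have -> : h' = p by rewrite h'E e -nE pp_order mulg1.
    rewrite index_head /thN big_ord0 e -nE -(prod_traject nuT (fun y : seq_sub en => f (val y))); apply/esym; exact: orb1.
  have -> : index h' (p :: t) = (index h (p :: t)).+1; last by [].
  by rewrite h'E -sE // index_uniq.
exists th => h h' ch ch' ee.
have [r' [cr' rh rh']] : exists r', [/\ cell (kap w) r', r' <> h & r' <> h'].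
  have [e1|n1] := pselect (p = h \/ p = h'); last by exists p; split=> // e; apply: n1; [left | right].
  have [e2|n2] := pselect (q = h \/ q = h'); last by exists q; split=> // e; apply: n2; [left | right].
  exists r; split=> // e; move: e1 e2 rp qp qr; rewrite e => -[->|->] [->|->] //.
by case: (edge_at HT kw ch ch' ee cr' rh rh') => vv; [exact: thV | exact: symm].
Qed.

Lemma kap_cont w : kap u @[u --> w] --> kap w.
Proof.
have c1 : (fst : R * R -> R) x @[x --> w] --> w.1 by exact: cvg_fst.
have c2 : (snd : R * R -> R) x @[x --> w] --> w.2 by exact: cvg_snd.
apply: (cvg_pairR c1); rewrite !expr2.
exact: (cvgD (cvgM c1 c1) (cvgM c2 c2)).
Qed.

Lemma near_cell w : 0 < w.2 -> \forall u \near w, forall h, cell (kap u) h -> cell (kap w) h.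
Proof.
move=> w0; have n1 : \forall u \near w, klein (kap u) /\ forall h, cell (kap u) h -> cell (kap w) h.
  exact: (kap_cont (tess_near HT (kap_klein w0))).
by apply: filterS n1 => u [].
Qed.

(** Continuation along the segment from [z0], whose only cell is 1. *)
Lemma cell_seg (Phi : R * R -> G -> Prop) w : 0 < w.2 ->
  (forall u : R * R, 0 < u.2 -> exists2 U, nbhs u U & forall u' u'', U u' -> U u'' -> 0 < u'.2 -> 0 < u''.2 ->
     (forall p, cell (kap u') p -> Phi u' p) -> forall p, cell (kap u'') p -> Phi u'' p) ->
  Phi z0 1%g -> forall p, cell (kap w) p -> Phi w p.
Proof.
move=> w0 loc P1; rewrite -[w](pt1 z0).
apply: (seg_ind (P := fun t => forall p, cell (kap (pt z0 w t)) p -> Phi (pt z0 w t) p)); last first.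
  by rewrite pt0 => p /cell_z0 ->.
move=> t ht; have [U nU hU] := loc _ (pt_H z0_H w0 ht).
exists (pt z0 w @^-1` U); first exact: pt_cont.
by move=> s s' Us Us' hs hs'; apply: hU => //; exact: pt_H.
Qed.

(** Along the segment from [z0] to [g z0] the cells that meet are joined by edges, and each edge
    crossed multiplies the word by a letter. *)
Lemma edges_generate g : exists2 ws : seq G, (forall x, x \in ws -> edge 1%g x) & (\prod_(x <- ws) x)%g = g.
Proof.
pose Phi (u : R * R) p := exists2 ws : seq G, (forall x, x \in ws -> edge 1%g x) & (\prod_(x <- ws) x)%g = p.
have w0 : 0 < (ag g z0).2 by exact: ag_H.
apply: (cell_seg (Phi := Phi) w0); last by rewrite -{2}[g]mulg1; apply/(Hcell g _ z0_H)/cell_z0.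
- move=> u u0; exists [set u' | forall h, cell (kap u') h -> cell (kap u) h]; first exact: near_cell.
  move=> u' u'' hu' hu'' u'0 u''0 P' q /hu'' cq.
  have [p cp] := tess_ne HT (kap_klein u'0).
  apply: (cells_connected HT (Phi := Phi u) (kap_klein u0) _ (hu' _ cp) (P' _ cp) cq).
  move=> p' q' _ _ ee [ws hws e]; exists (rcons ws (p'^-1 * q')%g).
    by move=> x; rewrite mem_rcons inE => /orP[/eqP ->|/hws //]; exact: edge1.
  by rewrite big_rcons /= e mulKVg.
- by exists [::] => //; rewrite big_nil.
Qed.

Section Potential.
Variables (K : groupType) (f : G -> K).
(* [t] integrates [f] over the cells at [w]; continuing such potentials over the
   half-plane defines the homomorphism extending [f]. *)
Definition pot w (t : G -> K) := forall p q, cell (kap w) p -> cell (kap w) q ->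
  edge p q -> t q = (t p * f (p^-1 * q))%g.
Hypothesis LP : forall w, 0 < w.2 -> exists t, pot w t.

Lemma pot_agree w t t' p q : 0 < w.2 -> pot w t -> pot w t' -> cell (kap w) p -> t p = t' p ->
  cell (kap w) q -> t q = t' q.
Proof.
move=> w0 h h' cp e; apply: (cells_connected HT (Phi := fun g => t g = t' g) (kap_klein w0) _ cp e).
by move=> g g' cg cg' ee eg; rewrite (h g g') // (h' g g') // eg.
Qed.

(** A locally constant choice of potentials over [Q]: nearby potentials agree on the cells they
    share. *)
Definition potQ (Q : set (R * R)) (th : R * R -> G -> K) := forall w, Q w -> pot w (th w) /\
  \forall u \near w, Q u -> forall p, cell (kap u) p -> th u p = th w p.

Lemma potQ_seg Q Q' th th' z w : potQ Q th -> potQ Q' th' -> 0 < z.2 -> 0 < w.2 ->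
  (forall t, 0 <= t <= 1 -> Q (pt z w t) /\ Q' (pt z w t)) ->
  (forall p, cell (kap z) p -> th z p = th' z p) -> forall p, cell (kap w) p -> th w p = th' w p.
Proof.
move=> h h' z0' w0 hs; rewrite -{1 2 3}(pt0 z w) -{4 5 6}(pt1 z w).
apply: (seg_ind (P := fun t => forall p, cell (kap (pt z w t)) p -> th (pt z w t) p = th' (pt z w t) p)).
move=> t ht; have u0 := pt_H z0' w0 ht; have [Qt Qt'] := hs t ht.
have [p1 n1] := h _ Qt; have [p2 n2] := h' _ Qt'; have n3 := near_cell u0.
exists [set s | [/\ Q (pt z w s) -> forall p, cell (kap (pt z w s)) p -> th (pt z w s) p = th (pt z w t) p,
    Q' (pt z w s) -> forall p, cell (kap (pt z w s)) p -> th' (pt z w s) p = th' (pt z w t) p &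
    forall p, cell (kap (pt z w s)) p -> cell (kap (pt z w t)) p]].
  have m1 := pt_cont n1; have m2 := pt_cont n2; have m3 := pt_cont n3.
  by near=> s; split; near: s.
move=> s s' [a1 a2 a3] [b1 b2 b3] hs1 hs1' e q cq.
have [Qs Qs'] := hs s hs1; have [Qq Qq'] := hs s' hs1'.
have [p cp] := tess_ne HT (kap_klein (pt_H z0' w0 hs1)).
rewrite b1 // b2 //; apply: (pot_agree u0 p1 p2 (a3 _ cp)); last exact: b3.
by rewrite -a1 // -a2 //; exact: e.
Unshelve. all: by end_near. Qed.

Lemma potQ_scale Q th k : potQ Q th -> potQ Q (fun w p => k * th w p)%g.
Proof.
move=> h w Qw; have [h1 h2] := h w Qw; split.
  by move=> p q cp cq ee; rewrite (h1 p q) // mulgA.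
by apply: filterS h2 => u hu Qu p cp; rewrite hu.
Qed.

Lemma potQ_glue (p : R * R -> R) m (Q1 Q2 : set (R * R)) (x : R * R) : continuous p ->
  (forall w, Q1 w -> p w <= m) -> (forall w, Q2 w -> m <= p w) -> closed Q1 -> closed Q2 ->
  (forall w, (Q1 `|` Q2) w -> 0 < w.2) ->
  (forall w, (Q1 `|` Q2) w -> p w = m -> Q1 w /\ Q2 w) ->
  (forall w t, 0 <= t <= 1 -> Q1 w -> Q2 w -> (Q1 `&` Q2) (pt x w t)) ->
  (Q1 `&` Q2) x -> (exists th, potQ Q1 th) -> (exists th, potQ Q2 th) -> exists th, potQ (Q1 `|` Q2) th.
Proof.
move=> cp q1 q2 cl1 cl2 QH qm conv [x1 x2] [th1 h1] [th2' h2'].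
have x0 : 0 < x.2 by apply: QH; left.
have [g cg] := tess_ne HT (kap_klein x0).
(* Left multiples of potentials are potentials, so the second one is rescaled to match the first at
   [x]. *)
pose th2 w p := (th1 x g * (th2' x g)^-1 * th2' w p)%g.
have h2 : potQ Q2 th2 by exact: potQ_scale.
have ex h : cell (kap x) h -> th1 x h = th2 x h.
  apply: (pot_agree x0 (h1 _ x1).1 (h2 _ x2).1 cg).
  by rewrite /th2 mulgKV.
have e12 w : Q1 w -> Q2 w -> forall h, cell (kap w) h -> th1 w h = th2 w h.
  move=> Q Q'; apply: (potQ_seg h1 h2 x0 _ _ ex); first by apply: QH; left.
  by move=> t ht; have [? ?] := conv w t ht Q Q'.
pose th w h := if p w <= m then th1 w h else th2 w h.
have t1 w h : Q1 w -> th w h = th1 w h by move=> /q1; rewrite /th => ->.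
have t2 w h : Q2 w -> cell (kap w) h -> th w h = th2 w h.
  move=> Q ch; rewrite /th; case: ifP => // pm.
  have pe : p w = m by apply/eqP; rewrite eq_le pm q2.
  by have [? ?] := qm w (or_intror Q) pe; exact: e12.
have near_out (Q : set (R * R)) w (P : R * R -> Prop) : closed Q -> ~ Q w -> \forall u \near w, Q u -> P u.
  move=> cQ nQ; have : nbhs w (~` Q) by apply: open_nbhs_nbhs; split=> //; rewrite openC.
  by apply: filterS => ? ? /[dup].
exists th => w Qw; have w0 := QH w Qw; split.
  move=> a b ca cb ee; case: Qw => Q.
    by rewrite !t1 //; apply: (h1 _ Q).1.
  by rewrite !t2 //; apply: (h2 _ Q).1.
have n3 := near_cell w0.
have n1 : \forall u \near w, Q1 u -> forall h, cell (kap u) h -> th1 u h = th w h.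
  have [Q|] := pselect (Q1 w); last exact: near_out.
  by apply: filterS (h1 _ Q).2 => u hu Qu h ch; rewrite hu // t1.
have n2 : \forall u \near w, Q2 u -> forall h, cell (kap u) h -> th2 u h = th w h.
  have [Q|] := pselect (Q2 w); last exact: near_out.
  near=> u => Qu h ch; rewrite t2 //; last by move: h ch; near: u.
  by move: Qu h ch; near: u; exact: (h2 _ Q).2.
near=> u => -[Qu|Qu] h ch.
  by rewrite t1 //; move: Qu h ch; near: u.
by rewrite t2 //; move: Qu h ch; near: u.
Unshelve. all: by end_near. Qed.

Lemma potQ_rect (a b c d : R) : a <= b -> 0 < c -> c <= d -> exists th, potQ (rect a b c d) th.
Proof.
move=> ab c0 cd.
have rectP a' b' c' d' z w t : 0 <= t <= 1 -> rect a' b' c' d' z -> rect a' b' c' d' w ->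
    rect a' b' c' d' (pt z w t) :> Prop.
  by move=> ht [z1 z2] [w1 w2]; have [] := pt_rect ht z1 z2 w1 w2.
have recH a' b' c' d' (w : R * R) : c <= c' -> rect a' b' c' d' w -> 0 < w.2.
  by move=> cc [_ /andP[h _]]; apply: lt_le_trans h; exact: lt_le_trans cc.
apply: (rect_ind (P := fun a b c d => exists th, potQ (rect a b c d) th)) => //.
- move=> x y hx /andP[cy yd]; have w0 : 0 < ((x, y) : R * R).2 by exact: lt_le_trans cy.
  have [t ht] := LP w0; have /nbhs_ballP[e /= e0 he] := near_cell w0.
  exists e => // a' b' c' d' /andP[a1 a2] /andP[b1 b2] /andP[c1 c2] /andP[d1 d2] dx dy.
  exists (fun=> t) => w Qw; split; last by near=> u.
  have sub : forall h, cell (kap w) h -> cell (kap (x, y)) h.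
    apply: he; case: Qw => /andP[h1 h2] /andP[h3 h4].
    by split; rewrite /ball /= ltr_norml; apply/andP; split; lra.
  by move=> p q /sub cp /sub cq; exact: ht.
- move=> a' m b' c' d' ha hb hc' hd' P1 P2.
  have cc : c <= c' by case/andP: hc'.
  have E : rect a' b' c' d' = rect a' m c' d' `|` rect m b' c' d'.
    apply/seteqP; split=> [w [/andP[h1 h2] h3]|w [] [/andP[h1 h2] h3]].
    + by case: (leP w.1 m) => wm; [left | right]; rewrite /rect /= h3 ?h1 ?wm ?h2 ?ltW.
    + by rewrite /rect /= h3 h1 (le_trans h2) //; case/andP: hb.
    + by rewrite /rect /= h3 h2 (le_trans _ h1) //; case/andP: ha.
  have Qx : (rect a' m c' d' `&` rect m b' c' d') (m, c').
    by rewrite /rect /= !lexx; case/andP: ha hb hc' => ? -> /andP[-> ?] /andP[? ->].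
  rewrite E; apply: (@potQ_glue fst m _ _ (m, c')) => //; try exact: rect_closed.
  + by move=> ?; exact: cvg_fst.
  + by move=> w [/andP[]].
  + by move=> w [/andP[]].
  + by move=> w; rewrite -E; exact: recH.
  + move=> w Qw wm; case: Qx Qw => [[/= /andP[x1 x2] _] [/= /andP[x3 x4] _]] [] [_ q2];
      by split; split=> //; rewrite wm ?x1 ?x2 ?x3 ?x4.
  + by move=> q t ht q1 q2; split; apply: rectP => //; case: Qx.
- move=> a' b' c' m d' ha hb hc' hd' P1 P2.
  have cc : c <= c' by case/andP: hc'.
  have E : rect a' b' c' d' = rect a' b' c' m `|` rect a' b' m d'.
    apply/seteqP; split=> [w [h3 /andP[h1 h2]]|w [] [h3 /andP[h1 h2]]].
    + by case: (leP w.2 m) => wm; [left | right]; rewrite /rect /= h3 ?h1 ?wm ?h2 ?ltW.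
    + by rewrite /rect /= h3 h1 (le_trans h2) //; case/andP: hd'.
    + by rewrite /rect /= h3 h2 (le_trans _ h1) //; case/andP: hc'.
  have Qx : (rect a' b' c' m `&` rect a' b' m d') (a', m).
    by rewrite /rect /= !lexx; case/andP: hc' hd' ha => ? -> /andP[-> ?] /andP[? ->].
  rewrite E; apply: (@potQ_glue snd m _ _ (a', m)) => //; try exact: rect_closed.
  + by move=> ?; exact: cvg_snd.
  + by move=> w [_ /andP[]].
  + by move=> w [_ /andP[]].
  + by move=> w; rewrite -E; exact: recH.
  + move=> w Qw wm; case: Qx Qw => [[_ /= /andP[x1 x2]] [_ /= /andP[x3 x4]]] [] [q2 _];
      by split; split=> //; rewrite wm ?x1 ?x2 ?x3 ?x4.
  + by move=> q t ht q1 q2; split; apply: rectP => //; case: Qx.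
Unshelve. all: by end_near. Qed.

(** The value at the cell [p] of the potential normalized to 1 at [z0] and continued over any
    rectangle. It is a relation because the rectangle varies; [val_fun] shows independence. *)
Definition val_at w p (k : K) := exists a b c d th,
  [/\ 0 < c, rect a b c d z0 /\ rect a b c d w, potQ (rect a b c d) th, th z0 1%g = 1%g & th w p = k].

Lemma val_fun w p k k' : 0 < w.2 -> cell (kap w) p -> val_at w p k -> val_at w p k' -> k = k'.
Proof.
move=> w0 cp [a [b [c [d [th [c0 [Qz Qw] h h1 <-]]]]]] [a' [b' [c' [d' [th' [c0' [Qz' Qw'] h' h1' <-]]]]]].
apply: (potQ_seg h h' z0_H w0 _ _ cp) => [t ht|q /cell_z0 ->]; last by rewrite h1 h1'.
case: Qz Qw Qz' Qw' => [z1 z2] [w1 w2] [z1' z2'] [w1' w2'].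
by split; [have [] := pt_rect ht z1 z2 w1 w2 | have [] := pt_rect ht z1' z2' w1' w2'].
Qed.

Lemma val_near w : 0 < w.2 -> exists2 th : R * R -> G -> K, pot w (th w) &
  \forall u \near w, forall p, cell (kap u) p -> cell (kap w) p /\ forall k, val_at u p k <-> th w p = k.
Proof.
move=> w0.
pose a := Num.min z0.1 w.1 - 1; pose b := Num.max z0.1 w.1 + 1.
pose c := Num.min z0.2 w.2 / 2; pose d := Num.max z0.2 w.2 + 1.
have c0 : 0 < c by rewrite divr_gt0 // lt_min z0_H.
have m1 : Num.min z0.1 w.1 <= z0.1 /\ Num.min z0.1 w.1 <= w.1 by rewrite !ge_min !lexx orbT.
have m2 : z0.1 <= Num.max z0.1 w.1 /\ w.1 <= Num.max z0.1 w.1 by rewrite !le_max !lexx orbT.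
have m3 : Num.min z0.2 w.2 <= z0.2 /\ Num.min z0.2 w.2 <= w.2 by rewrite !ge_min !lexx orbT.
have m4 : z0.2 <= Num.max z0.2 w.2 /\ w.2 <= Num.max z0.2 w.2 by rewrite !le_max !lexx orbT.
have [h1 h1'] := m1; have [h2 h2'] := m2; have [h3 h3'] := m3; have [h4 h4'] := m4.
have hc : c < Num.min z0.2 w.2 by rewrite ltr_pdivrMr // ltr_pMr ?ltr1n // lt_min z0_H.
have Qz : rect a b c d z0 by rewrite /rect /= /a /b /d; split; apply/andP; split; lra.
have Qw : rect a b c d w by rewrite /rect /= /a /b /d; split; apply/andP; split; lra.
have [th' hth'] := @potQ_rect a b c d ltac:(rewrite /a /b; lra) c0 ltac:(rewrite /d; lra).
pose th u p := ((th' z0 1)^-1 * th' u p)%g.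
have hth : potQ (rect a b c d) th by exact: potQ_scale.
have th1 : th z0 1%g = 1%g by rewrite /th mulVg.
have [pw nw] := hth w Qw; exists th => //.
have nQ : \forall u \near w, rect a b c d u.
  have c1 : (fst : R * R -> R) x @[x --> w] --> w.1 by exact: cvg_fst.
  have c2 : (snd : R * R -> R) x @[x --> w] --> w.2 by exact: cvg_snd.
  have l1 : \forall u \near w, a < u.1 by apply: (cvgr_gt _ c1); rewrite /a; lra.
  have l2 : \forall u \near w, u.1 < b by apply: (cvgr_lt _ c1); rewrite /b; lra.
  have l3 : \forall u \near w, c < u.2 by apply: (cvgr_gt _ c2); lra.
  have l4 : \forall u \near w, u.2 < d by apply: (cvgr_lt _ c2); rewrite /d; lra.
  by near=> u; split; apply/andP; split; apply: ltW; near: u.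
have n3 := near_cell w0; have n4 := near_H w0.
near=> u => p cp; have Qu : rect a b c d u by near: u.
have u0 : 0 < u.2 by near: u.
have e : th u p = th w p by move: Qu p cp; near: u.
split; first by move: p cp {e}; near: u.
move=> k; split=> [v|<-]; last by exists a, b, c, d, th.
by apply: (val_fun u0 cp) v; exists a, b, c, d, th.
Unshelve. all: by end_near. Qed.

Lemma val_ex w p : 0 < w.2 -> cell (kap w) p -> exists k, val_at w p k.
Proof.
move=> w0 cp; have [th _ /nbhs_singleton /(_ p cp)[_ h]] := val_near w0.
by exists (th w p); apply/h.
Qed.

Lemma val_pot w p q k : 0 < w.2 -> cell (kap w) p -> cell (kap w) q -> edge p q ->
  val_at w p k -> val_at w q (k * f (p^-1 * q))%g.
Proof.
move=> w0 cp cq ee; have [th hp /nbhs_singleton h] := val_near w0.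
by move=> /(h p cp).2 <-; apply/(h q cq).2; exact: hp.
Qed.

(** Cells are convex in the coordinates [kap], so the two points are joined there by a segment
    inside the cell, along which the value is locally constant. *)
Lemma val_cell w w' p k : 0 < w.2 -> 0 < w'.2 -> cell (kap w) p -> cell (kap w') p ->
  val_at w p k -> val_at w' p k.
Proof.
move=> w0 w'0 cw cw'; pose v (t : R) := pt (kap w) (kap w') t.
have kv t : 0 <= t <= 1 -> klein (v t).
  move=> /andP[t0 t1]; rewrite /klein /v /pt /=.
  have e : 0 <= t * (1 - t) * (w.1 - w'.1) ^+ 2 by rewrite mulr_ge0 ?sqr_ge0 // mulr_ge0 // subr_ge0.
  have [->|tn] := eqVneq t 0; first by rewrite !mul0r !addr0 ltrDl exprn_gt0.
  have tp : 0 < t by rewrite lt_neqAle eq_sym tn.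
  have e1 : 0 < t * w'.2 ^+ 2 by rewrite mulr_gt0 // exprn_gt0.
  have e2 : 0 <= (1 - t) * w.2 ^+ 2 by rewrite mulr_ge0 ?subr_ge0 // sqr_ge0.
  by move: e e1 e2; nra.
have cv t : 0 <= t <= 1 -> cell (v t) p.
  move=> /andP[t0 t1] r; have := cw r; have := cw' r; rewrite /v /pt /afn /=.
  set A := kap w; set B := kap w' => h1 h2.
  have := mulr_ge0 t0 (_ : 0 <= _ - _); rewrite -subr_ge0 in h1; move=> /(_ _ _ h1) e1.
  have t1' : 0 <= 1 - t by rewrite subr_ge0.
  rewrite -subr_ge0 in h2; have e2 := mulr_ge0 t1' h2.
  by move: e1 e2; lra.
have : val_at (unkap (v 0)) p k -> val_at (unkap (v 1)) p k.
  apply: (seg_ind (P := fun t => val_at (unkap (v t)) p k)) => t ht.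
  have u0 := unkap_H (kv t ht); have [th _ h] := val_near u0.
  have uc : unkap (v s) @[s --> t] --> unkap (v t).
    have c1 : (v s).1 @[s --> t] --> (v t).1 by apply: (cvg_comp _ _ (pt_cont (t := t))); exact: cvg_fst.
    have c2 : (v s).2 @[s --> t] --> (v t).2 by apply: (cvg_comp _ _ (pt_cont (t := t))); exact: cvg_snd.
    apply: (cvg_pairR c1).
    have c3 : ((v s).2 - (v s).1 ^+ 2) @[s --> t] --> (v t).2 - (v t).1 ^+ 2.
      by rewrite expr2; exact: (cvgB c2 (cvgM c1 c1)).
    exact: (cvg_comp _ _ c3 (@sqrt_continuous R _)).
  exists [set s | forall p, cell (kap (unkap (v s))) p -> forall k, val_at (unkap (v s)) p k <-> th (unkap (v t)) p = k].
    have n1 := uc _ h; near=> s => p' cp'.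
    by have [_] : cell (kap (unkap (v t))) p' /\ forall k, val_at (unkap (v s)) p' k <-> th (unkap (v t)) p' = k
      by move: p' cp'; near: s.
  move=> s s' hs hs' Is Is'.
  have cs : cell (kap (unkap (v s))) p by rewrite unkapK; [exact: cv | exact: kv].
  have cs' : cell (kap (unkap (v s'))) p by rewrite unkapK; [exact: cv | exact: kv].
  by move=> /(hs p cs) /(hs' p cs').
by rewrite /v pt0 pt1 !kapK.
Unshelve. all: by end_near. Qed.

(** [phi g] is the value at the cell [g]. Translating by [g] preserves [p^-1 q], hence the defining
    equation of potentials; so values at [g u] are [phi g] times values at [u], as they are at
    [z0]. *)
Lemma pot_hom : exists2 phi : G -> K, {morph phi : x y / (x * y)%g} & forall x, edge 1%g x -> phi x = f x.
Proof.
have cz g : cell (kap (ag g z0)) g by rewrite -{2}[g]mulg1; apply/(Hcell g _ z0_H)/cell_z0.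
have az g : 0 < (ag g z0).2 by exact: ag_H.
have ex g : exists k, val_at (ag g z0) g k by exact: val_ex.
have [phi hphi] := choice ex.
have c1 : cell (kap z0) 1%g by apply/cell_z0.
have v1 : val_at z0 1%g 1%g.
  have [k vk] := val_ex z0_H c1; have [a [b [c [d [th [c0 [Qz _] h h1 e]]]]]] := vk.
  by exists a, b, c, d, th.
exists phi; last first.
  move=> x ex'; have [w [w0 [kw [cw1 cwx] _ _ _]]] := edge_vertH ex'.
  apply: (val_fun (az x) (cz x) (hphi x)).
  apply: (val_cell w0 (az x) cwx (cz x)).
  by have := val_pot w0 cw1 cwx ex' (val_cell z0_H w0 c1 cw1 v1); rewrite invg1 !mul1g.
move=> g h; apply: (val_fun (az _) (cz _) (hphi _)).
rewrite agM //; move: (phi h) (hphi h) => k; move: k.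
apply: (@cell_seg (fun u p => forall k, val_at u p k -> val_at (ag g u) (g * p)%g (phi g * k)%g) (ag h z0) (az h) _ _ h (cz h)).
- move=> u u0; have gu0 := ag_H g u0.
  have [th pu nu] := val_near u0; have [th' pu' nu'] := val_near gu0.
  exists [set u' | (forall p, cell (kap u') p -> cell (kap u) p /\ forall k, val_at u' p k <-> th u p = k) /\
     forall p, cell (kap (ag g u')) p -> cell (kap (ag g u)) p /\ forall k, val_at (ag g u') p k <-> th' (ag g u) p = k].
    by have n' := @ag_cont g u u0 _ nu'; near=> u'; split; near: u'.
  move=> u' u'' [a1 a2] [b1 b2] u'0 u''0 P' p cp k.
  have [p0 cp0] := tess_ne HT (kap_klein u'0).
  have cu0 := (a1 _ cp0).1; have [cup hp] := b1 _ cp.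
  have cgp0 := (Hcell g _ u'0).2 cp0; have cgp := (Hcell g _ u''0).2 cp.
  move/hp => <-; apply/(b2 _ cgp).2; move: (cgp) => /b2[cgp' _].
  have e0 : th' (ag g u) (g * p0)%g = (phi g * th u p0)%g.
    by apply/(a2 _ cgp0).2; apply: P' => //; apply/(a1 _ cp0).2.
  apply: (cells_connected HT (Phi := fun q => th' (ag g u) (g * q)%g = (phi g * th u q)%g) (kap_klein u0) _ cu0 e0 cup).
  move=> q q' cq cq' ee eq.
  rewrite (pu' _ _ ((Hcell g _ u0).2 cq) ((Hcell g _ u0).2 cq') (edge_act g ee)) (pu _ _ cq cq' ee) eq.
  by rewrite invgM -!mulgA mulKg.
- by move=> k vk; rewrite -(val_fun z0_H c1 v1 vk) !mulg1; exact: hphi.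
Unshelve. all: by end_near. Qed.
End Potential.

Theorem tess_presentation : exists rels : seq (seq G), surface_presentation rels.
Proof.
have [rels [ur mr r1 lp]] := relators_exist; exists rels; split=> //.
- by move=> x /mr[n _] x1; apply: n.
- by move=> x /mr ex; apply/mr; exact: edge_inv.
- by move=> g; have [ws hws e] := edges_generate g; exists ws => // x /hws ex; apply/mr.
move=> K f fV fr.
have [phi phiM phiE] : exists2 phi : G -> K, {morph phi : x y / (x * y)%g} & forall x, edge 1%g x -> phi x = f x.
  by apply: pot_hom => w w0; apply: lp w w0 => // x /mr; exact: fV.
by exists phi => // x /mr; exact: phiE.
Qed.
End Action.

(** * Fuchsian groups are presented by their Dirichlet tessellation *)

Section FuchsianTess.
Variables (R : realType) (G : groupType) (rho : G -> mat2 R).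
Hypothesis rho_det : forall g, mdet (rho g) = 1.
Hypothesis rhoM : forall g h, rho (g * h)%g = mmul (rho g) (rho h) \/
  rho (g * h)%g = mscale (-1) (mmul (rho g) (rho h)).
Variable e : R.
Hypothesis e_gt0 : 0 < e.
Hypothesis rho_far : forall g, g <> 1%g -> forall w, 0 < w.2 -> e <= hd (mob (rho g) w) w.
Variable z0 : R * R.
Hypothesis z0_H : 0 < z0.2.
Variable K : R.
Hypothesis cocompact : forall w, 0 < w.2 -> exists g, hd w (mob (rho g) z0) < K.
Implicit Types (g h p q r : G) (w v : R * R).

Let P g := mob (rho g) z0.
(** Chosen so that [afn g (kap w) = w.2 * (hd w (P g) + 2)], see [afnE]: comparing these values
    compares distances to orbit points. *)
Let fa g := ((P g).1 ^+ 2 + (P g).2 ^+ 2) / (P g).2.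
Let fb g := - 2 * (P g).1 / (P g).2.
Let fc g := (P g).2^-1.
Let P_H g : 0 < (P g).2.
Proof. exact: mob_H. Qed.

Lemma rho_mobM g h w : 0 < w.2 -> mob (rho (g * h)%g) w = mob (rho g) (mob (rho h) w).
Proof. by move=> w0; case: (rhoM g h) => ->; rewrite ?mobN mobM. Qed.

Lemma rho_mob1 w : 0 < w.2 -> mob (rho 1%g) w = w.
Proof.
move=> w0; have := rho_mobM 1%g 1%g w0; rewrite mulg1 => /(congr1 (mob (madj (rho 1%g)))).
by rewrite !mobK ?mob_H // => ->.
Qed.

Lemma orbit_sep g h : g <> h -> e <= hd (P g) (P h).
Proof.
move=> gh; have n : (h^-1 * g)%g <> 1%g.
  by move=> /(congr1 (fun x => h * x)%g); rewrite mulKVg mulg1.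
have := rho_far n z0_H; rewrite -(hd_mob (rho_det h)) ?mob_H // -rho_mobM //.
by rewrite mulKVg.
Qed.

Lemma orbit_inj g h : P g = P h -> g = h.
Proof.
move=> E; apply: contrapT => /orbit_sep; rewrite E hdxx leNgt.
by rewrite e_gt0.
Qed.

Lemma afnE g w : 0 < w.2 -> afn fa fb fc g (kap w) = w.2 * (hd w (P g) + 2).
Proof.
move=> w0; have := P_H g; rewrite /afn /fa /fb /fc /hd /kap.
move: (P g) => p p0 /=; have pn := lt0r_neq0 p0; have wn := lt0r_neq0 w0.
by field; rewrite pn wn.
Qed.

Lemma cellE g w : 0 < w.2 -> cell fa fb fc (kap w) g <-> forall h, hd w (P g) <= hd w (P h).
Proof.
by move=> w0; split=> H h; have := H h; rewrite !afnE // ler_pM2l // lerD2r.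
Qed.

Lemma afn_lt g h w : 0 < w.2 -> (afn fa fb fc g (kap w) < afn fa fb fc h (kap w)) = (hd w (P g) < hd w (P h)).
Proof. by move=> w0; rewrite !afnE // ltr_pM2l // ltrD2r. Qed.

Lemma K_gt0 : 0 < K.
Proof. have [g hg] := cocompact z0_H; apply: le_lt_trans hg; apply: hd_ge0 => //; exact: P_H g. Qed.

(** [hd w v < K] bounds [w.2 / v.2 + v.2 / w.2] by [K + 2], and the squared horizontal distance by
    [K * w.2 * v.2]. *)
Lemma hd_region w v : 0 < w.2 -> 0 < v.2 -> hd w v < K ->
  [/\ v.2 < (K + 2) * w.2, w.2 < (K + 2) * v.2 & `|v.1 - w.1| < (K + 2) * w.2].
Proof.
move=> w0 v0; rewrite /hd ltr_pdivrMr ?mulr_gt0 // => h; have K0 := K_gt0.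
have s1 := sqr_ge0 (w.1 - v.1); have s2 := sqr_ge0 (w.2 - v.2).
have b1 : v.2 < (K + 2) * w.2.
  by rewrite -(ltr_pM2l v0); move: (exprn_gt0 2 w0) h s1; nra.
have b2 : w.2 < (K + 2) * v.2.
  by rewrite -(ltr_pM2l w0); move: (exprn_gt0 2 v0) h s1; nra.
split=> //; have p0 : 0 < (K + 2) * w.2 by rewrite mulr_gt0 // addr_gt0.
rewrite -[ltRHS]ger0_norm ?ltW // -ltr_sqr ?nnegrE // !real_normK ?num_real //.
have t1 : K * (w.2 * v.2) < K * (w.2 * ((K + 2) * w.2)) by rewrite !ltr_pM2l.
have t2 : 0 < w.2 ^+ 2 * (2 * K + 4) by rewrite mulr_gt0 ?exprn_gt0 //; lra.
by move: h s2 t1 t2; nra.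
Qed.

(** A small rectangle contains at most one orbit point, because orbit points are [e]-separated. *)
Lemma orbit_fin (a b c d : R) : a <= b -> 0 < c -> c <= d ->
  exists s : seq G, forall g, rect a b c d (P g) -> g \in s.
Proof.
move=> ab c0 cd.
apply: (rect_ind (P := fun a b c d => exists s : seq G, forall g, rect a b c d (P g) -> g \in s)) => //.
- move=> x y hx /andP[cy yd]; have y0 : 0 < y := lt_le_trans c0 cy.
  have [del d0 hdel] := hd_small y0 e_gt0; exists del => // a' b' c' d' /andP[a1 a2] /andP[b1 b2] /andP[c1 c2] /andP[d1 d2] dx dy.
  have [[g0 Qg0]|no] := pselect (exists g, rect a' b' c' d' (P g)); last first.
    by exists [::] => g Qg; case: no; exists g.
  exists [:: g0] => g Qg; rewrite inE; apply/eqP; apply: contrapT => /orbit_sep.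
  rewrite leNgt => /negP; apply.
  case: Qg Qg0 => /andP[??] /andP[??] [/andP[??] /andP[??]].
  by apply: hdel; rewrite ?ltr_norml; lra.
- move=> a' m b' c' d' ha hb hc' hd' [s1 h1] [s2 h2]; exists (s1 ++ s2) => g [/andP[g1 g2] g3].
  rewrite mem_cat; apply/orP; case: (leP (P g).1 m) => gm; [left; apply: h1 | right; apply: h2];
    by split; rewrite // ?g1 ?gm ?(ltW gm).
- move=> a' b' c' m d' ha hb hc' hd' [s1 h1] [s2 h2]; exists (s1 ++ s2) => g [g3 /andP[g1 g2]].
  rewrite mem_cat; apply/orP; case: (leP (P g).2 m) => gm; [left; apply: h1 | right; apply: h2];
    by split; rewrite // ?g1 ?gm ?(ltW gm).
Qed.

Lemma orbit_near_fin (x1 x2 y1 y2 : R) : x1 <= x2 -> 0 < y1 -> y1 <= y2 ->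
  exists s : seq G, forall w g, rect x1 x2 y1 y2 w -> hd w (P g) < K -> g \in s.
Proof.
move=> x12 y10 y12; have K0 := K_gt0; have K2 : 0 < K + 2 by lra.
have y20 : 0 < y2 := lt_le_trans y10 y12.
have c0 : 0 < y1 / (K + 2) by rewrite divr_gt0.
have [|||s hs] := @orbit_fin (x1 - (K + 2) * y2) (x2 + (K + 2) * y2) (y1 / (K + 2)) ((K + 2) * y2) => //.
- have : 0 < (K + 2) * y2 by rewrite mulr_gt0.
  by move: x12; lra.
- rewrite ler_pdivrMr //; apply: (le_trans y12); rewrite mulrAC ler_peMl ?ltW //.
  have k1 : 1 <= K + 2 by lra.
  by nra.
exists s => w g [/andP[w1 w2] /andP[w3 w4]] hw; have w0 := lt_le_trans y10 w3.
have [b1 b2 b3] := hd_region w0 (P_H g) hw; apply: hs.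
have b4 : (K + 2) * w.2 <= (K + 2) * y2 by rewrite ler_pM2l.
move: b3; rewrite ltr_norml => /andP[b5 b6].
split; apply/andP; split; try lra.
by rewrite ler_pdivrMr // mulrC; lra.
Qed.

(** The coefficient triples transform by the symmetric square of [rho g], whose determinant is the
    cube of that of [rho g]. *)
Lemma det3_inv g p q r : let det3 p q r := fa p * (fb q * fc r - fc q * fb r)
   - fa q * (fb p * fc r - fc p * fb r) + fa r * (fb p * fc q - fc p * fb q) in
  det3 (g * p)%g (g * q)%g (g * r)%g = det3 p q r.
Proof.
move=> det3.
have hF s : [/\ fa (g * s)%g = e11 (rho g) ^+ 2 * fa s - e11 (rho g) * e12 (rho g) * fb s + e12 (rho g) ^+ 2 * fc s,
  fb (g * s)%g = - 2 * e11 (rho g) * e21 (rho g) * fa s + (e11 (rho g) * e22 (rho g) + e12 (rho g) * e21 (rho g)) * fb s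
     - 2 * e12 (rho g) * e22 (rho g) * fc s &
  fc (g * s)%g = e21 (rho g) ^+ 2 * fa s - e21 (rho g) * e22 (rho g) * fb s + e22 (rho g) ^+ 2 * fc s].
  have hd1 := rho_det g; have p0 := P_H s.
  have d0 := mden_gt0 hd1 p0.
  have PM : P (g * s)%g = mob (rho g) (P s) by rewrite /P rho_mobM.
  rewrite /fa /fb /fc PM; move: (P s) d0 p0 => [x y] d0 p0; rewrite mobE /= hd1 mul1r; move: d0 p0 hd1; rewrite /mden /mdet /=.
  set a := e11 _; set b := e12 _; set c := e21 _; set d := e22 _.
  move=> d0 p0 hd1; have dn := lt0r_neq0 d0; have yn := lt0r_neq0 p0.
  split.
  - have E : ((a * x + b) * (c * x + d) + a * c * y ^+ 2) ^+ 2 + y ^+ 2 =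
       ((a * x + b) ^+ 2 + (a * y) ^+ 2) * ((c * x + d) ^+ 2 + (c * y) ^+ 2).
      transitivity (((a * x + b) * (c * x + d) + a * c * y ^+ 2) ^+ 2 + (a * d - b * c) ^+ 2 * y ^+ 2).
        by rewrite hd1 expr1n mul1r.
      by ring.
    rewrite !expr_div_n -mulrDl E; field.
    by rewrite yn dn.
  - by field; rewrite yn dn.
  - by field; rewrite yn dn.
rewrite {1}/det3; have [-> -> ->] := hF p; have [-> -> ->] := hF q; have [-> -> ->] := hF r.
have hd1 := rho_det g; rewrite /mdet in hd1.
transitivity ((e11 (rho g) * e22 (rho g) - e12 (rho g) * e21 (rho g)) ^+ 3 * det3 p q r).
  by rewrite /det3; ring.
by rewrite hd1 expr1n mul1r.
Qed.

Lemma gradient_inj p q : fb p = fb q -> fc p = fc q -> p = q.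
Proof.
rewrite /fb /fc => h1 h2; apply: orbit_inj.
have e2 : (P p).2 = (P q).2 by exact: invr_inj.
have e1 : (P p).1 = (P q).1.
  move: h1; rewrite e2 => /(mulIf _); rewrite invr_eq0 (gt_eqF (P_H q)) => /(_ isT).
  by move=> h; lra.
by rewrite [LHS]surjective_pairing [RHS]surjective_pairing e1 e2.
Qed.

(** The coefficient triples lie on the quadric [fa * fc - fb ^+ 2 / 4 = 1]. Collinear gradients with
    equal values at [v] would put three of its points on one line. A line in a non-isotropic
    direction meets it at most twice, and on this direction the form takes the nonzero value
    [- hd (P p) (P q)]. *)
Lemma cells_general p q r v : klein v -> cell fa fb fc v p -> cell fa fb fc v q ->
  cell fa fb fc v r -> p <> q -> q <> r -> p <> r -> dor fb fc p q r != 0.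
Proof.
move=> kv cp cq cr pq qr pr; apply/eqP; rewrite /dor => d0.
have := cell_eq cp cq; have := cell_eq cp cr; rewrite /afn => Er Eq.
have quad s : fa s * fc s - fb s ^+ 2 / 4 = 1.
  by rewrite /fa /fb /fc; field; rewrite gt_eqF ?P_H.
have Qne : (fa q - fa p) * (fc q - fc p) - (fb q - fb p) ^+ 2 / 4 != 0.
  have -> : (fa q - fa p) * (fc q - fc p) - (fb q - fb p) ^+ 2 / 4 = - hd (P p) (P q).
    by rewrite /fa /fb /fc /hd; field; rewrite !gt_eqF ?P_H.
  by rewrite oppr_eq0 gt_eqF // (lt_le_trans e_gt0) // orbit_sep.
have [t [tb tc]] : exists t, fb r - fb p = t * (fb q - fb p) /\ fc r - fc p = t * (fc q - fc p).
  have [c0|c0] := eqVneq (fc q - fc p) 0; last first.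
    exists ((fc r - fc p) / (fc q - fc p)); rewrite mulfVK //; split=> //.
    apply: (mulIf c0); rewrite mulrAC mulfVK //; lra.
  have b0 : fb q - fb p != 0.
    by apply/eqP => b0; apply: pq; apply: gradient_inj; lra.
  exists ((fb r - fb p) / (fb q - fb p)); rewrite mulfVK //; split=> //.
  move: d0; rewrite c0 mul0r subr0 mulr0 => /eqP; rewrite mulf_eq0 (negPf b0) /=.
  by move/eqP.
have ta : fa r - fa p = t * (fa q - fa p).
  have -> : fa r - fa p = - ((fb r - fb p) * v.1 + (fc r - fc p) * v.2) by lra.
  have -> : fa q - fa p = - ((fb q - fb p) * v.1 + (fc q - fc p) * v.2) by lra.
  by rewrite tb tc; ring.
have : t * (t - 1) * ((fa q - fa p) * (fc q - fc p) - (fb q - fb p) ^+ 2 / 4) = 0.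
  transitivity ((fa r * fc r - fb r ^+ 2 / 4) - (1 - t) * (fa p * fc p - fb p ^+ 2 / 4) - t * (fa q * fc q - fb q ^+ 2 / 4)).
    have -> : fa r = fa p + t * (fa q - fa p) by lra.
    have -> : fb r = fb p + t * (fb q - fb p) by lra.
    have -> : fc r = fc p + t * (fc q - fc p) by lra.
    by field.
  by rewrite !quad; ring.
move/eqP; rewrite mulf_eq0 (negPf Qne) orbF mulf_eq0 subr_eq0 => /orP[]/eqP t0.
  by apply: pr; apply: gradient_inj; move: tb tc; rewrite t0 !mul0r => ? ?; lra.
by apply: qr; apply: gradient_inj; move: tb tc; rewrite t0 !mul1r => ? ?; lra.
Qed.

Lemma seq_argmin (F : G -> R) (s : seq G) g : g \in s -> exists2 m, m \in s & forall h, h \in s -> F m <= F h.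
Proof.
elim: s g => // x s IH g _; case: s IH => [|y s] IH.
  by exists x; rewrite ?mem_head // => h; rewrite inE => /eqP ->.
have [m ms hm] := IH y (mem_head _ _).
case: (leP (F x) (F m)) => xm.
  exists x; first exact: mem_head.
  by move=> h; rewrite inE => /orP[/eqP ->|/hm] //; exact: le_trans.
exists m; first by rewrite inE ms orbT.
by move=> h; rewrite inE => /orP[/eqP ->|/hm] //; exact: ltW.
Qed.

Lemma near_seq (Q : G -> R * R -> Prop) (s : seq G) v : (forall h, \forall u \near v, Q h u) ->
  \forall u \near v, forall h, h \in s -> Q h u.
Proof.
move=> h; elim: s => [|x s IH]; first by near=> u.
have hx := h x; near=> u => y; rewrite inE => /orP[/eqP ->|]; first by near: u.
by move: y; near: u.
Unshelve. all: by end_near. Qed.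

Lemma addr_subKl (x y : R) : x + y - x = y. Proof. by ring. Qed.

(** Column operations at a common value [c] reduce the invariant determinant to [c] times the
    orientation; as the values [c] are positive in the half-plane, the action preserves
    orientations. *)
Lemma det3_dor (c : R) v p q r : afn fa fb fc p v = c -> afn fa fb fc q v = c -> afn fa fb fc r v = c ->
  fa p * (fb q * fc r - fc q * fb r) - fa q * (fb p * fc r - fc p * fb r)
    + fa r * (fb p * fc q - fc p * fb q) = c * dor fb fc p q r.
Proof.
rewrite /afn /dor => hp hq hr.
have -> : fa p = c - fb p * v.1 - fc p * v.2 by rewrite -hp; ring.
have -> : fa q = c - fb q * v.1 - fc q * v.2 by rewrite -hq; ring.
have -> : fa r = c - fb r * v.1 - fc r * v.2 by rewrite -hr; ring.
by ring.
Qed.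

Lemma fuchsian_tess : tess fa fb fc.
Proof.
have kl v : klein v -> exists2 w, 0 < w.2 & v = kap w.
  by move=> kv; exists (unkap v); [exact: unkap_H | rewrite unkapK].
have cellK w g : 0 < w.2 -> cell fa fb fc (kap w) g -> hd w (P g) < K.
  by move=> w0 /(cellE _ w0) h; have [g' hg'] := cocompact w0; exact: le_lt_trans (h g') hg'.
split.
- exact: cells_general.
- exact: gradient_inj.
- move=> g; exists (kap (P g)) => h hg; rewrite afn_lt // hdxx (lt_le_trans e_gt0) //.
  by apply: orbit_sep; exact: nesym.
- move=> v /kl[w w0 ->]; have [s hs] := @orbit_near_fin w.1 w.1 w.2 w.2 (lexx _) w0 (lexx _).
  exists s => h /(cellK _ _ w0); apply: hs; by rewrite /rect /= !lexx.
- move=> v /kl[w w0 ->]; have [s hs] := @orbit_near_fin w.1 w.1 w.2 w.2 (lexx _) w0 (lexx _).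
  have Qw : rect w.1 w.1 w.2 w.2 w by rewrite /rect /= !lexx.
  have [g hg] := cocompact w0; have gs := hs w g Qw hg.
  have [m ms hm] := seq_argmin (fun h => hd w (P h)) gs; exists m; apply/(cellE _ w0) => h.
  case: (ltP (hd w (P h)) K) => hK; first by apply: hm; exact: hs hK.
  by apply: le_trans hK; apply: ltW; apply: le_lt_trans hg; exact: hm.
- move=> v kv; have [w w0 vw] := kl v kv.
  have w2 : 0 < w.2 / 2 by rewrite divr_gt0.
  have [|||s hs] := @orbit_near_fin (w.1 - 1) (w.1 + 1) (w.2 / 2) (2 * w.2) => //; try lra.
  (* These bounds hold the height within a factor 2 of [w.2], so near [v] only the finitely many
     cells in [s] can occur; each of them that misses [v] loses strictly there, hence nearby. *)
  have n1 : \forall u \near v, w.2 ^+ 2 / 4 < u.2 - u.1 ^+ 2.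
    by apply: (cvgr_gt _ (@depth_cont R v)); rewrite vw /kap /= addr_subKl; move: (exprn_gt0 2 w0); lra.
  have n2 : \forall u \near v, u.2 - u.1 ^+ 2 < 4 * w.2 ^+ 2.
    by apply: (cvgr_lt _ (@depth_cont R v)); rewrite vw /kap /= addr_subKl; move: (exprn_gt0 2 w0); lra.
  have c1 : (fst : R * R -> R) x @[x --> v] --> v.1 by exact: cvg_fst.
  have n3 : \forall u \near v, w.1 - 1 < u.1 by apply: (cvgr_gt _ c1); rewrite vw /=; lra.
  have n4 : \forall u \near v, u.1 < w.1 + 1 by apply: (cvgr_lt _ c1); rewrite vw /=; lra.
  have n5 : \forall u \near v, forall h, h \in s -> cell fa fb fc u h -> cell fa fb fc v h.
    apply: near_seq => h; have [ch|] := pselect (cell fa fb fc v h); first by near=> u.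
    move=> /existsNP[h' /negP]; rewrite -ltNge -subr_gt0 => lt.
    have cc : (afn fa fb fc h u - afn fa fb fc h' u) @[u --> v] --> afn fa fb fc h v - afn fa fb fc h' v.
      exact: (cvgB (@afn_cont R G fa fb fc h v) (@afn_cont R G fa fb fc h' v)).
    have n6 : \forall u \near v, 0 < afn fa fb fc h u - afn fa fb fc h' u by exact: (cvgr_gt _ cc).
    near=> u => /(_ h'); rewrite leNgt => /negP; case.
    by rewrite -subr_gt0; near: u.
  near=> u.
  have m1 : w.2 ^+ 2 / 4 < u.2 - u.1 ^+ 2 by near: u.
  have m2 : u.2 - u.1 ^+ 2 < 4 * w.2 ^+ 2 by near: u.
  have ku : klein u by rewrite /klein -subr_gt0; apply: lt_trans m1; rewrite divr_gt0 ?exprn_gt0.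
  split=> // h ch; have [x x0 ux] := kl u ku.
  have q1 : w.2 / 2 < x.2.
    rewrite -ltr_sqr ?nnegrE ?ltW //; move: m1; rewrite ux /kap /= addr_subKl expr_div_n; lra.
  have q2 : x.2 < 2 * w.2.
    rewrite -ltr_sqr ?nnegrE ?ltW ?mulr_gt0 //; move: m2; rewrite ux /kap /= addr_subKl exprMn; lra.
  have hin : h \in s.
    apply: (hs x); last by apply: cellK => //; rewrite -ux.
    split; apply/andP; split; apply: ltW => //.
      by have -> : x.1 = u.1; [rewrite ux | near: u].
    by have -> : x.1 = u.1; [rewrite ux | near: u].
  by move: h hin ch; near: u.
- move=> g; have K0 := K_gt0; have K2 : 0 < K + 2 by lra.
  set p := P g; have p0 : 0 < p.2 := P_H g.
  have r0 : 0 < (K + 2) * p.2 by rewrite mulr_gt0.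
  exists (`|p.1| + (K + 2) * p.2 + (`|p.1| + (K + 2) * p.2) ^+ 2 + ((K + 2) * p.2) ^+ 2).
  exists ((p.2 / (K + 2)) ^+ 2); first by rewrite exprn_gt0 // divr_gt0.
  move=> v kv; have [w w0 ->] := kl v kv => /(cellK _ _ w0); rewrite hdC => hK.
  have [b1 b2 b3] := hd_region p0 w0 hK.
  have n1 : `|w.1| <= `|p.1| + (K + 2) * p.2.
    have -> : w.1 = p.1 + (w.1 - p.1) by ring.
    by apply: (le_trans (ler_normD _ _)); rewrite lerD2l ltW.
  have n0 : 0 <= `|p.1| + (K + 2) * p.2 by rewrite addr_ge0 // ltW.
  have n2 : w.1 ^+ 2 <= (`|p.1| + (K + 2) * p.2) ^+ 2 by rewrite -real_normK ?num_real // lerXn2r ?nnegrE.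
  have n3 : w.2 ^+ 2 <= ((K + 2) * p.2) ^+ 2 by rewrite lerXn2r ?nnegrE ?ltW //.
  have s1 := sqr_ge0 w.1; have s2 := sqr_ge0 w.2.
  split=> /=.
  + by apply: (le_trans n1); rewrite -addrA lerDl addr_ge0 ?sqr_ge0.
  + rewrite ger0_norm; last by rewrite addr_ge0.
    by rewrite -addrA; apply: (le_trans (lerD n2 n3)); rewrite lerDr.
  + rewrite addr_subKl; have q0 : p.2 / (K + 2) <= w.2 by rewrite ler_pdivrMr // mulrC ltW.
    have q1 : 0 <= p.2 / (K + 2) by rewrite divr_ge0 // ltW.
    by rewrite lerXn2r // ?nnegrE // ltW.
Unshelve. all: by end_near. Qed.

Lemma rho_presentation : exists rels : seq (seq G), surface_presentation rels.
Proof.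
have cell_act g h w : 0 < w.2 -> cell fa fb fc (kap (mob (rho g) w)) (g * h)%g <-> cell fa fb fc (kap w) h.
  move=> w0; have gw0 : 0 < (mob (rho g) w).2 by exact: mob_H.
  have E s : hd (mob (rho g) w) (P (g * s)%g) = hd w (P s) by rewrite /P rho_mobM // hd_mob // mob_H.
  rewrite (cellE _ gw0) (cellE _ w0); split=> H s; first by rewrite -!E.
  by rewrite -[s](mulKVg g) !E.
have cellK w g : 0 < w.2 -> cell fa fb fc (kap w) g -> hd w (P g) < K.
  by move=> w0 /(cellE _ w0) h; have [g' hg'] := cocompact w0; exact: le_lt_trans (h g') hg'.
have afn_gt0 g w : 0 < w.2 -> 0 < afn fa fb fc g (kap w).
  move=> w0; rewrite afnE // mulr_gt0 // ltr_wpDl //.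
  by apply: hd_ge0 => //; exact: P_H g.
have P1 : P 1%g = z0 by exact: rho_mob1.
refine (@tess_presentation _ _ fa fb fc fuchsian_tess (fun g => mob (rho g)) _ _ _ _ _ _ _ _ z0 z0_H _).
- by move=> g w w0; exact: mob_H.
- by move=> g w w0; exact: mob_cont.
- exact: rho_mob1.
- exact: rho_mobM.
- exact: cell_act.
- move=> g p q r w w0 cp cq cr.
  have gw0 : 0 < (mob (rho g) w).2 by exact: mob_H.
  have gp := (cell_act g p w w0).2 cp; have gq := (cell_act g q w w0).2 cq.
  have gr := (cell_act g r w w0).2 cr.
  have := det3_inv g p q r => /=.
  rewrite (det3_dor (erefl _) (cell_eq cq cp) (cell_eq cr cp)).
  rewrite (det3_dor (erefl _) (cell_eq gq gp) (cell_eq gr gp)) => E d0.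
  by rewrite -(pmulr_rgt0 _ (afn_gt0 (g * p)%g _ gw0)) E mulr_gt0 // afn_gt0.
- move=> g w w0 f; apply: contrapT => /rho_far /(_ w w0); rewrite f hdxx leNgt.
  by rewrite e_gt0.
- have K0 := K_gt0; have r0 : 0 < K + 2 by lra.
  have [|||s hs] := @orbit_near_fin (z0.1 - (K + 2) * z0.2) (z0.1 + (K + 2) * z0.2) (z0.2 / (K + 2)) ((K + 2) * z0.2).
  + have : 0 < (K + 2) * z0.2 by rewrite mulr_gt0.
    by lra.
  + by rewrite divr_gt0.
  + rewrite ler_pdivrMr // mulrAC ler_peMl ?ltW //.
    have k1 : 1 <= K + 2 by lra.
    by nra.
  exists s => v g kv c1 cg; have w0 := unkap_H kv; set w := unkap v in w0.
  have vw : v = kap w by rewrite unkapK.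
  rewrite vw in c1 cg.
  have h1 := cellK _ _ w0 c1; have h2 := cellK _ _ w0 cg.
  rewrite P1 hdC in h1; apply: hs h2.
  have [b1 b2 b3] := hd_region z0_H w0 h1.
  move: b3; rewrite ltr_norml => /andP[b5 b6].
  split; apply/andP; split; try lra.
  by rewrite ler_pdivrMr // mulrC ltW.
- move=> p; rewrite (cellE _ z0_H); split=> [/(_ 1%g)|-> h].
    rewrite P1 hdxx => h; apply: orbit_inj; rewrite P1; apply/esym; apply: (hd_eq0 z0_H (P_H p)).
    by apply/eqP; rewrite eq_le h hd_ge0 //; exact: P_H p.
  by rewrite P1 hdxx hd_ge0 //; exact: P_H h.
Qed.
End FuchsianTess.

Theorem fuchsian_presentation (R : realType) (G : groupType) (rho : G -> mat2 R) :
  fuchsian rho -> exists rels : seq (seq G), surface_presentation rels.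
Proof.
by case=> h1 h2 [e e0 h3] [z z0 [K h4]]; exact: (rho_presentation h1 h2 e0 h3 z0 h4).
Qed.

(** * Traces *)

Section Trace.
Variables (R : realType).
Implicit Types (M B : mat2 R).

(** Elliptic and parabolic maps have arbitrarily small displacement. If [c = 0], [M] acts as a
    translation, short at great height. Otherwise, on the line [x = (a - d) / (2 c)], the numerator
    in [hd_self] is the square of [(4 - tr^2) / (4 c) - c y^2], which vanishes for a suitable [y] or
    is small against [y] near 0. *)
Lemma displacement_trace M (e : R) : mdet M = 1 -> 0 < e ->
  (forall w : R * R, 0 < w.2 -> e <= hd (mob M w) w) -> 4 < mtr M ^+ 2.
Proof.
move=> hd1 e0 he; rewrite ltNge; apply/negP => tr4.
have disc : (e11 M - e22 M) ^+ 2 + 4 * e12 M * e21 M <= 0.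
  move: tr4 hd1; rewrite /mtr /mdet; set a := e11 M; set b := e12 M; set c := e21 M; set d := e22 M => tr4 hd1.
  have -> : (a - d) ^+ 2 + 4 * b * c = (a + d) ^+ 2 - 4 * (a * d - b * c) by ring.
  by rewrite hd1; lra.
have [c0|c0] := eqVneq (e21 M) 0.
  have ad : e22 M - e11 M = 0.
    by apply/eqP; rewrite -sqrf_eq0 -sqrrN opprB eq_le sqr_ge0 andbT; move: disc; rewrite c0 mulr0 addr0.
  set y := Num.sqrt ((e12 M ^+ 2 + 1) / e).
  have b1 : 0 < e12 M ^+ 2 + 1 by rewrite ltr_wpDl ?sqr_ge0.
  have y0 : 0 < y by rewrite sqrtr_gt0 divr_gt0.
  have := he (0, y) y0; rewrite hd_self //= c0 ad.
  have -> : (0 * (0 ^+ 2 - y ^+ 2) + 0 * 0 - e12 M) ^+ 2 + (2 * 0 * 0 * y + 0 * y) ^+ 2 = e12 M ^+ 2 by ring.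
  rewrite ler_pdivlMr ?exprn_gt0 // /y sqr_sqrtr; last by rewrite divr_ge0 ?ltW.
  have -> : e * ((e12 M ^+ 2 + 1) / e) = e12 M ^+ 2 + 1 by field; rewrite gt_eqF.
  by lra.
have yd : exists2 y : R, 0 < y & (4^-1 * (4 - mtr M ^+ 2) / e21 M - e21 M * y ^+ 2) ^+ 2 < e * y ^+ 2.
  set D := 4 - mtr M ^+ 2; have D0 : 0 <= D by rewrite subr_ge0.
  have c20 : 0 < e21 M ^+ 2 by rewrite exprn_even_gt0.
  have c40 : 0 < 4 * e21 M ^+ 2 by rewrite mulr_gt0.
  move: D0; rewrite le_eqVlt => /orP[/eqP/esym D0|D0].
    exists (Num.sqrt (e / (4 * e21 M ^+ 2))); first by rewrite sqrtr_gt0 divr_gt0 // mulr_gt0.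
    rewrite sqr_sqrtr; last by apply: divr_ge0; exact: ltW.
    rewrite D0 mulr0 mul0r sub0r.
    have -> : (- (e21 M * (e / (4 * e21 M ^+ 2)))) ^+ 2 = e * (e / (4 * e21 M ^+ 2)) / 4 by field.
    have : 0 < e * (e / (4 * e21 M ^+ 2)) by rewrite mulr_gt0 // divr_gt0 // mulr_gt0.
    by lra.
  exists (Num.sqrt (D / (4 * e21 M ^+ 2))); first by rewrite sqrtr_gt0 divr_gt0 // mulr_gt0.
  rewrite sqr_sqrtr; last by apply: divr_ge0; exact: ltW.
  have -> : 4^-1 * D / e21 M - e21 M * (D / (4 * e21 M ^+ 2)) = 0 by field.
  by rewrite expr0n mulr_gt0 // divr_gt0 // mulr_gt0.
have [y y0 hy] := yd.
have := he ((e11 M - e22 M) / (2 * e21 M), y) y0; rewrite hd_self //= ler_pdivlMr ?exprn_gt0 // leNgt => /negP; apply.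
apply: le_lt_trans hy; rewrite le_eqVlt; apply/orP; left; apply/eqP.
have -> : 2 * e21 M * ((e11 M - e22 M) / (2 * e21 M)) * y + (e22 M - e11 M) * y = 0 by field.
rewrite expr0n addr0; congr (_ ^+ 2); rewrite /mtr.
have -> : 4 - (e11 M + e22 M) ^+ 2 = 4 * mdet M - (e11 M + e22 M) ^+ 2 by rewrite hd1 mulr1.
by rewrite /mdet; field.
Qed.

End Trace.

(** * Small primes *)

Section SmallPrime.
Local Open Scope nat_scope.

Lemma central_bin_lb n : 2 ^ n <= 'C(n.*2, n).
Proof.
elim: n => // n IH; rewrite doubleS binS expnS mul2n -addnn leq_add //.
  by rewrite (leq_trans IH) // binS leq_addl.
by case: n IH => // n IH; rewrite (leq_trans IH) // [in X in _ <= X]binS leq_addr.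
Qed.

Lemma bin_ub n m : 'C(n, m) <= 2 ^ n.
Proof.
have [nm|mn] := ltnP n m; first by rewrite bin_small.
rewrite -[2]/(1 + 1) expnDn (bigD1 (Ordinal (mn : m < n.+1))) //= !exp1n !muln1.
exact: leq_addr.
Qed.

Lemma sum_trunc_log p N M : 1 < p -> 0 < N -> \sum_(1 <= k < M.+1) (p ^ k <= N : nat) <= trunc_log p N.
Proof.
move=> p1 N0; elim: M => [|M IH]; first by rewrite big_geq.
rewrite big_nat_recr //=; have [le|//] := leqP (p ^ M.+1) N; last by rewrite addn0.
have : M.+1 <= trunc_log p N by apply: trunc_log_max.
apply: leq_trans; rewrite addn1 ltnS.
apply: leq_trans (_ : \sum_(1 <= k < M.+1) 1 <= M); last by rewrite sum_nat_const_nat subn1 muln1.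
by apply: leq_sum => i _; exact: leq_b1.
Qed.

(** Legendre's formula: with integer quotients, each term [2n / p^k - 2 (n / p^k)] is 0 or 1, and it
    is 0 once [p^k] exceeds [2n]. *)
Lemma logn_central_bin p n : prime p -> 0 < n -> p ^ logn p 'C(n.*2, n) <= n.*2.
Proof.
move=> pp n0; have p1 := prime_gt1 pp; have n20 : 0 < n.*2 by rewrite double_gt0.
apply: leq_trans (trunc_logP p1 n20); rewrite leq_exp2l //.
have nn : n <= n.*2 by rewrite -addnn leq_addr.
have E : logn p (n.*2)`! = logn p 'C(n.*2, n) + (logn p n`! + logn p n`!).
  rewrite -(bin_fact nn) -[n.*2 - n]/(n.*2 - n) -{2}addnn addnK.
  by rewrite !lognM ?muln_gt0 ?fact_gt0 ?bin_gt0.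
have E2 : logn p n`! = \sum_(1 <= k < n.*2.+1) n %/ p ^ k.
  rewrite logn_fact // [RHS](big_cat_nat (n := n.+1)) //= [X in _ + X]big1_seq ?addn0 //.
  move=> k /andP[_]; rewrite mem_index_iota => /andP[nk _].
  by rewrite divn_small // (ltn_trans nk) // ltn_expl.
have : logn p 'C(n.*2, n) + (logn p n`! + logn p n`!) <= trunc_log p n.*2 + (logn p n`! + logn p n`!).
  rewrite -E logn_fact // E2 -!big_split /=.
  apply: leq_trans (leq_add (sum_trunc_log n.*2 p1 n20) (leqnn _)).
  rewrite -big_split /=; apply: leq_sum => k _; set q := p ^ k.
  have q0 : 0 < q by rewrite expn_gt0 prime_gt0.
  rewrite addnn; have [h|h] := leqP q n.*2; last by rewrite divn_small // (divn_small (leq_ltn_trans nn h)).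
  rewrite -ltnS ltn_divLR // -doubleS.
  have := ltn_ceil n q0; move: (n %/ q) => t ht; nia.
by rewrite leq_add2r.
Qed.

Lemma prod_primes_dvd (s : seq nat) h : uniq s -> all prime s -> (forall p, p \in s -> p %| h) ->
  \prod_(p <- s) p %| h.
Proof.
elim: s => [|p s IH] /=; first by rewrite big_nil dvd1n.
move=> /andP[ps us] /andP[pp As] H; rewrite big_cons Gauss_dvd.
  by rewrite H ?mem_head // IH // => q qs; rewrite H // inE qs orbT.
rewrite big_seq; apply: (big_ind (coprime p)) => [|x y hx hy|q qs]; first exact: coprimen1.
  by rewrite coprimeMr hx hy.
rewrite prime_coprime // dvdn_prime2 //; last by move/allP: As => /(_ q qs).
by apply: contraNN ps => /eqP ->.
Qed.

(** Each of the at most [r] primes up to [r] contributes at most [n.*2]. A prime beyond [r], the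
    square root of [n.*2], occurs to the first power, and the product of these primes divides
    [h]. *)
Lemma central_bin_primes n r h : 0 < n -> 0 < h -> n.*2 = r ^ 2 -> (forall p, prime p -> p <= n.*2 -> p %| h) ->
  'C(n.*2, n) <= n.*2 ^ r * h.
Proof.
move=> n0 h0 nr H; set m := 'C(n.*2, n); have m0 : 0 < m by rewrite bin_gt0 -addnn leq_addr.
have n20 : 0 < n.*2 by rewrite double_gt0.
have {1}-> : m = \prod_(p <- primes m) p ^ logn p m.
  by rewrite {1}[m]prod_prime_decomp // prime_decompE big_map.
have pm p : p \in primes m -> [/\ prime p, p <= n.*2 & p ^ logn p m <= n.*2].
  rewrite mem_primes => /and3P[pp _ pdv]; have le := logn_central_bin pp n0; split=> //.
  by apply: leq_trans le; rewrite -{1}[p]expn1 leq_exp2l ?prime_gt1 // -pfactor_dvdn.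
rewrite (bigID (fun p => p <= r)) /=; apply: leq_mul.
  apply: (@leq_trans (\prod_(p <- primes m | p <= r) n.*2)).
    by rewrite big_seq_cond [X in _ <= X]big_seq_cond; apply: leq_prod => p /andP[/pm[]].
  rewrite -big_filter big_const_seq count_predT iter_muln_1 leq_pexp2l //.
  rewrite -[X in _ <= X](size_iota 1 r); apply: uniq_leq_size; first by rewrite filter_uniq ?primes_uniq.
  move=> p; rewrite mem_filter mem_iota => /andP[pr /pm[/prime_gt0 p0 _ _]].
  by rewrite p0 add1n ltnS.
apply: (@leq_trans (\prod_(p <- [seq p <- primes m | ~~ (p <= r)]) p)).
  rewrite big_filter big_seq_cond [X in _ <= X]big_seq_cond; apply: leq_prod => p /andP[/pm[pp _ le] rp].
  rewrite -ltnNge in rp; rewrite -[X in _ <= X]expn1 leq_exp2l ?prime_gt1 // leqNgt; apply/negP => l1.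
  move: le; rewrite leqNgt => /negP; apply; rewrite nr.
  apply: (@leq_trans (p ^ 2)); first by rewrite ltn_exp2r.
  by rewrite leq_exp2l // prime_gt1.
apply: dvdn_leq => //; apply: prod_primes_dvd.
- by rewrite filter_uniq ?primes_uniq.
- by apply/allP => p; rewrite mem_filter => /andP[_ /pm[]].
- by move=> p; rewrite mem_filter => /andP[_ /pm[pp le _]]; exact: H.
Qed.

Lemma prime_ndvd_fact p n : prime p -> n < p -> ~~ (p %| n`!).
Proof.
move=> pp; elim: n => [|n IH] np; first by rewrite fact0 dvdn1 neq_ltn prime_gt1 ?orbT.
by rewrite factS Euclid_dvdM // negb_or IH ?(ltnW np) // gtnNdvd.
Qed.

Lemma prime_dvd_central p j : prime p -> 2 ^ j < p -> p <= 2 ^ j.+1 -> p %| 'C(2 ^ j.+1, 2 ^ j).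
Proof.
move=> pp jp pj; have le : 2 ^ j <= 2 ^ j.+1 by rewrite leq_exp2l.
have E : 2 ^ j.+1 - 2 ^ j = 2 ^ j by rewrite expnS mul2n -addnn addnK.
have : p %| (2 ^ j.+1)`! by rewrite dvdn_fact // prime_gt0.
rewrite -(bin_fact le) E !Euclid_dvdM // orbb => /orP[//|].
by move/negP: (prime_ndvd_fact pp jp).
Qed.

(** The primes between consecutive powers of 2 divide a central binomial coefficient. [Q] serves to
    discard the primes up to [B * l] at a cost exponential in [l] only. *)
Lemma dyadic_product J : exists Q, [/\ 0 < Q, Q <= 2 ^ (2 ^ J.+1) & forall p, prime p -> p <= 2 ^ J -> p %| Q].
Proof.
elim: J => [|J [Q [Q0 Ql Qp]]].
  by exists 1; split=> // p /prime_gt1 p1; rewrite leqNgt p1.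
exists (Q * 'C(2 ^ J.+1, 2 ^ J)); split.
- by rewrite muln_gt0 Q0 /= bin_gt0 leq_exp2l ?leqnSn.
- by rewrite [2 ^ J.+2]expnS mul2n -addnn expnD leq_mul // bin_ub.
- move=> p pp pJ; have [le|lt] := leqP p (2 ^ J); first by rewrite dvdn_mulr // Qp.
  by rewrite dvdn_mull // prime_dvd_central.
Qed.

(* Otherwise every prime below [2n = 4^k] divides [h] or the dyadic product, and
   the central binomial coefficient [>= 2^n] would be too small, by
   [central_bin_primes]. *)
Lemma small_prime_nondivisor (B E : nat) : exists C, forall l h, 0 < l -> 0 < h -> h <= E ^ l ->
  exists p, [/\ prime p, B * l < p, p <= C * l & ~~ (p %| h)].
Proof.
(* [L = D * l] dominates the logarithms of [h] and of the dyadic product. As [4 ^ u < 4 * L], taking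
   [n.*2 = 4 ^ (u + 6)] keeps the primes up to [4 ^ 7 * L]; the 6 secures [8 * k < 2 ^ k]. *)
set D := E + 4 * B.+1; exists (4 ^ 7 * D) => l h l0 h0 hE.
set L := D * l; have L1 : 1 < L by rewrite /L /D; nia.
set u := up_log 4 L; have /andP[u1 u2] : 4 ^ u.-1 < L <= 4 ^ u by exact: up_log_bounds.
have u0 : 0 < u by rewrite up_log_gt0.
set k := u + 6; set n := 2 ^ (k.*2.-1); have k0 : 0 < k by rewrite /k addnC.
have n2 : n.*2 = (2 ^ k) ^ 2.
  by rewrite -mul2n /n -expnS prednK ?double_gt0 // -expnM muln2.
have n24 : n.*2 = 4 ^ k by rewrite n2 -[4]/(2 ^ 2) -!expnM mulnC.
apply: contrapT => no.
have [J [J1 J2]] : exists J, B.+1 * l <= 2 ^ J /\ 2 ^ J <= 2 * (B.+1 * l).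
  have [h1|h1] := leqP (B.+1 * l) 1; first by exists 0; nia.
  exists (up_log 2 (B.+1 * l)); have /andP[v1 v2] := up_log_bounds (leqnn 2) h1.
  split=> //; have v0 : 0 < up_log 2 (B.+1 * l) by rewrite up_log_gt0.
  by move: v1; rewrite -{2}(prednK v0) expnS; move: (2 ^ _) => t; nia.
have [Q [Q0 Q1 Q2]] := dyadic_product J.
have n0 : 0 < n by rewrite expn_gt0.
have := @central_bin_primes n (2 ^ k) (h * Q) n0; rewrite muln_gt0 h0 Q0 => /(_ isT n2).
move=> H; have {}H : 'C(n.*2, n) <= n.*2 ^ 2 ^ k * (h * Q).
  apply: H => p pp pn; have [le|lt] := leqP p (2 ^ J); first by rewrite dvdn_mull // Q2.
  rewrite dvdn_mulr //; apply: contrapT => /negP nd; apply: no; exists p; split=> //.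
    by apply: leq_ltn_trans lt; apply: leq_trans J1; rewrite leq_mul.
  apply: (leq_trans pn); rewrite n24 /k expnD.
  rewrite -{1}(prednK u0) expnS mulnAC -[X in _ <= X]mulnA -/L (expnS 4 6) leq_mul //.
  exact: ltnW.
have := leq_trans (central_bin_lb n) H; apply/negP; rewrite -ltnNge.
have E2 : h <= 2 ^ (E * l).
  apply: (leq_trans hE); rewrite expnM leq_exp2r // ltnW // ltn_expl //.
have : n.*2 ^ 2 ^ k * (h * Q) <= 2 ^ (k.*2 * 2 ^ k + (E * l + 2 ^ J.+1)).
  rewrite expnD [2 ^ (E * l + _)]expnD; apply: leq_mul; last exact: leq_mul.
  by rewrite n2 -!expnM -muln2 -mulnA.
move=> /leq_ltn_trans; apply; rewrite ltn_exp2l //.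
have k8 : 8 * k < 2 ^ k.
  rewrite /k; elim: (u) => [|v IH]; first by [].
  by rewrite addSn expnS; move: IH; move: (2 ^ _) => t; lia.
have K4 : 4 * L <= 4 ^ k.
  rewrite /k addnS expnS leq_pmul2l //; apply: (leq_trans u2); rewrite leq_exp2l //.
  by rewrite leq_addr.
have K2 : 8 * (k * 2 ^ k) < 4 ^ k.
  by rewrite mulnA -[4]/(2 * 2) expnMn ltn_mul2r k8 expn_gt0.
have KL : E * l + 2 ^ J.+1 <= L by rewrite expnS /L /D; nia.
have aux a b c n' L' : 0 < L' -> 4 * L' <= a -> 8 * b < a -> c <= L' -> n'.*2 = a -> 2 * b + c < n' by lia.
by rewrite -[k.*2]mul2n -[2 * k * _]mulnA; exact: aux (ltnW L1) K4 K2 KL n24.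
Qed.
End SmallPrime.

(** * Rings of parameters *)

(* A ring of parameters with a real point [sr_ev]: an element that does not
   vanish at the real point survives in a prime field of size linear in the
   logarithm of its norm. *)
Record spec_ring (R : realType) := SpecRing {
  sr :> idomainType;
  sr_norm : sr -> nat;
  sr_ev : {rmorphism sr -> R};
  sr_norm_eq0 : forall a, (sr_norm a == 0%N) = (a == 0);
  sr_normN : forall a, sr_norm (- a) = sr_norm a;
  sr_normD : forall a b, (sr_norm (a + b)%R <= sr_norm a + sr_norm b)%N;
  sr_normM : forall a b, (sr_norm (a * b)%R <= sr_norm a * sr_norm b)%N;
  sr_spec : forall B E : nat, exists C : nat, forall (l : nat) (h : sr), (0 < l)%N ->
    (sr_norm h <= E ^ l)%N -> sr_ev h != 0 ->
    exists p : nat, [/\ prime p, (B * l < p)%N, (p <= C * l)%N &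
      exists phi : {rmorphism sr -> 'F_p}, phi h != 0] }.

Lemma Fp_intr_neq0 p (h : int) : prime p -> ~~ (p %| `|h|%N)%N -> (h%:~R : 'F_p) != 0.
Proof.
move=> pp; have cp := pchar_Fp pp.
case: h => n; rewrite ?NegzE ?abszN /= => nd; last rewrite rmorphN oppr_eq0 /=.
  by rewrite -pmulrn -(dvdn_pcharf cp).
by rewrite -pmulrn -(dvdn_pcharf cp).
Qed.

Lemma int_spec (R : realType) (B E : nat) : exists C : nat, forall (l : nat) (h : int), (0 < l)%N ->
    (`|h| <= E ^ l)%N -> (h%:~R : R) != 0 ->
    exists p : nat, [/\ prime p, (B * l < p)%N, (p <= C * l)%N &
      exists phi : {rmorphism int -> 'F_p}, phi h != 0].
Proof.
have [C hC] := small_prime_nondivisor B E; exists C => l h l0 hE hn.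
have h0 : (0 < `|h|)%N by rewrite absz_gt0; move: hn; rewrite intr_eq0.
have [p [pp p1 p2 nd]] := hC l _ l0 h0 hE; exists p; split=> //.
by exists intr; exact: Fp_intr_neq0.
Qed.

Definition int_spec_ring (R : realType) : spec_ring R.
Proof.
apply: (@SpecRing R int absz intr) => //.
- by move=> a; rewrite absz_eq0.
- exact: abszN.
- by move=> a b; lia.
- by move=> a b; rewrite abszM.
- exact: int_spec.
Defined.

Lemma Fp_nonroot p (q : {poly 'F_p}) : prime p -> q != 0 -> (size q <= p)%N -> exists t, q.[t] != 0.
Proof.
move=> pp q0 qs; apply: contrapT => no.
have al : all (root q) (enum 'F_p).
  by apply/allP => t _; rewrite /root; apply: contrapT => /negP h; apply: no; exists t.
have := max_poly_roots q0 al (enum_uniq _); rewrite -cardE card_Fp //.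
by rewrite ltnNge qs.
Qed.

Section PolySpec.
Variables (R : realType) (A : spec_ring R) (c : R).
Notation N := (@sr_norm R A).
Implicit Types p q : {poly A}.

(* The weights [2 ^ i] make the norm control the degree as well. *)
Definition pnorm p := (\sum_(i < size p) N p`_i * 2 ^ i)%N.

Let N0 : N 0 = 0%N. Proof. by apply/eqP; rewrite sr_norm_eq0. Qed.

Lemma pnormE p n : (size p <= n)%N -> pnorm p = (\sum_(i < n) N p`_i * 2 ^ i)%N.
Proof.
move=> pn; rewrite /pnorm (big_ord_widen n (fun i => N p`_i * 2 ^ i)%N pn) big_mkcond /=.
by apply: eq_bigr => i _; case: ltnP => // h; rewrite nth_default // N0.
Qed.

Lemma pnormN p : pnorm (- p) = pnorm p.
Proof. by rewrite /pnorm size_polyN; apply: eq_bigr => i _; rewrite coefN sr_normN. Qed.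

Lemma pnormD p q : (pnorm (p + q)%R <= pnorm p + pnorm q)%N.
Proof.
rewrite (pnormE (size_polyD p q)) (pnormE (leq_maxl (size p) (size q))) (pnormE (leq_maxr (size p) (size q))).
rewrite -big_split; apply: leq_sum => i _ /=.
by rewrite coefD -mulnDl leq_mul2r sr_normD orbT.
Qed.

Lemma pnormX p : pnorm (p * 'X) = (2 * pnorm p)%N.
Proof.
rewrite (@pnormE (p * 'X) (size p).+1); last first.
  by apply: (leq_trans (size_polyMleq _ _)); rewrite size_polyX addn2.
rewrite big_ord_recl coefMX /= N0 mul0n add0n /pnorm big_distrr /=.
by apply: eq_bigr => i _; rewrite coefMX /= expnS mulnCA.
Qed.

Lemma pnormCM a p : (pnorm (a%:P * p)%R <= N a * pnorm p)%N.
Proof.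
rewrite (@pnormE (a%:P * p) (size p)); last by rewrite mul_polyC size_scale_leq.
rewrite /pnorm big_distrr /=; apply: leq_sum => i _; rewrite coefCM mulnA leq_mul2r.
by rewrite sr_normM orbT.
Qed.

Lemma pnorm_cons p a : pnorm (p * 'X + a%:P) = (2 * pnorm p + N a)%N.
Proof.
have s1 : (size (p * 'X + a%:P)%R <= (size p).+1)%N.
  rewrite (leq_trans (size_polyD _ _)) // geq_max size_polyC (leq_trans (leq_b1 _)) // andbT.
  by apply: (leq_trans (size_polyMleq _ _)); rewrite size_polyX addn2.
rewrite (pnormE s1) big_ord_recl coefD coefMX coefC /= add0r expn0 muln1 addnC /pnorm big_distrr /=.
by congr addn; apply: eq_bigr => i _; rewrite coefD coefMX coefC /= addr0 expnS mulnCA.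
Qed.

Lemma pnormM p q : (pnorm (p * q)%R <= pnorm p * pnorm q)%N.
Proof.
elim/poly_ind: p => [|p a IH].
  by rewrite mul0r /pnorm size_poly0 big_ord0.
rewrite pnorm_cons mulrDl -mulrA [X in (_ * X)]mulrC mulrA mulnDl -mulnA.
apply: (leq_trans (pnormD _ _)); rewrite leq_add ?pnormCM // pnormX leq_mul2l.
by rewrite IH orbT.
Qed.

Lemma pnorm_coef p i : (N p`_i <= pnorm p)%N.
Proof.
have [h|h] := ltnP i (size p); last by rewrite nth_default // N0.
rewrite /pnorm (bigD1 (Ordinal h)) //= (leq_trans _ (leq_addr _ _)) //.
by rewrite leq_pmulr // expn_gt0.
Qed.

Lemma pnorm_eq0 p : (pnorm p == 0%N) = (p == 0).
Proof.
apply/eqP/eqP => [h|->]; last by rewrite /pnorm size_poly0 big_ord0.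
by apply/polyP => i; rewrite coef0; apply/eqP; rewrite -sr_norm_eq0 -leqn0 -h pnorm_coef.
Qed.

Lemma pnorm_size p E l : (pnorm p <= E ^ l)%N -> (size p <= (E * l).+1)%N.
Proof.
move=> h; case E0 : (size p) => [|n] //; rewrite ltnS.
have nl : (n < size p)%N by rewrite E0.
have : (2 ^ n <= pnorm p)%N.
  rewrite /pnorm (bigD1 (Ordinal nl)) //= (leq_trans _ (leq_addr _ _)) // leq_pmull //.
  rewrite lt0n sr_norm_eq0 -[n]/(n.+1.-1) -E0 -[_`_ _]/(lead_coef p) lead_coef_eq0 -size_poly_eq0.
  by rewrite E0.
move/leq_trans => /(_ _ h) h2; rewrite -(leq_exp2l _ _ (leqnn 2)); apply: (leq_trans h2).
have [->|l0] := posnP l; first by rewrite muln0.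
by rewrite expnM leq_exp2r // ltnW // ltn_expl.
Qed.

Definition pev : {poly A} -> R := horner_eval c \o map_poly (sr_ev A).
HB.instance Definition _ := GRing.RMorphism.copy pev (horner_eval c \o map_poly (sr_ev A)).

(** Some coefficient of [h] is nonzero at the real point and survives in [F_p] by the property of
    [A]. The degree is at most [E * l] by [pnorm_size], and asking for [B + E] instead of [B] makes
    [p] larger, so the reduced polynomial has a nonroot. *)
Lemma poly_spec (B E : nat) : exists C : nat, forall (l : nat) (h : {poly A}), (0 < l)%N ->
    (pnorm h <= E ^ l)%N -> pev h != 0 ->
    exists p : nat, [/\ prime p, (B * l < p)%N, (p <= C * l)%N &
      exists phi : {rmorphism {poly A} -> 'F_p}, phi h != 0].
Proof.
have [C hC] := @sr_spec R A (B + E) E; exists C => l h l0 hE hev.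
have [i hi] : exists i, sr_ev A h`_i != 0.
  apply: contrapT => no; move/negP: hev; apply; apply/eqP; rewrite /pev /= /horner_eval.
  suff -> : map_poly (sr_ev A) h = 0 by rewrite horner0.
  by apply/polyP => i; rewrite coef_map coef0; apply/eqP; apply: contrapT => /negP h'; apply: no; exists i.
have [p [pp p1 p2 [phi hphi]]] := hC l h`_i l0 (leq_trans (pnorm_coef h i) hE) hi.
exists p; split=> //; first by apply: leq_ltn_trans p1; rewrite leq_mul2r leq_addr orbT.
have q0 : map_poly phi h != 0.
  by apply/eqP => /polyP/(_ i); rewrite coef_map coef0; apply/eqP.
have qs : (size (map_poly phi h) <= p)%N.
  apply: (leq_trans (size_poly _ _)); apply: (leq_trans (pnorm_size hE)).
  by apply: leq_trans p1; rewrite ltnS leq_mul2r leq_addl orbT.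
have [t ht] := Fp_nonroot pp q0 qs.
by exists (horner_eval t \o map_poly phi).
Qed.

Definition poly_spec_ring : spec_ring R.
Proof.
exact: (@SpecRing R {poly A} pnorm pev pnorm_eq0 pnormN pnormD pnormM poly_spec).
Defined.
End PolySpec.

Lemma spec_ring_ext (R : realType) (A : spec_ring R) (cs : seq R) :
  exists (B : spec_ring R) (i : {rmorphism A -> B}) (t : nat -> B),
    (forall a, sr_ev B (i a) = sr_ev A a) /\ forall k, (k < size cs)%N -> sr_ev B (t k) = cs`_k.
Proof.
elim: cs => [|c cs [B [i [t [h1 h2]]]]].
  by exists A, idfun, (fun=> 0).
exists (poly_spec_ring B c), (@polyC B \o i), (fun k => if k is k'.+1 then (t k')%:P else 'X); split.
  by move=> a /=; rewrite /pev /= /horner_eval map_polyC hornerC; exact: h1.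
case=> [|k] /= kc; rewrite /pev /= /horner_eval ?map_polyX ?hornerX //.
by rewrite map_polyC hornerC; exact: h2.
Qed.

(** * Projective representations over rings of parameters *)

Section Scalar.
Variable A : idomainType.
Implicit Types M N C B Z U X : mat2 A.

Definition scal M := exists k, M = mscale k (mid A).

Lemma scalP M : scal M <-> [/\ e12 M = 0, e21 M = 0 & e11 M = e22 M].
Proof.
split=> [[k ->]|]; first by rewrite /= !mulr0.
by case: M => a b c d /= [-> -> ->]; exists d; rewrite /mscale /= mulr1 mulr0.
Qed.

Lemma scalZ k M : scal M -> scal (mscale k M).
Proof. by case=> l ->; exists (k * l); rewrite mscaleA. Qed.

Lemma scalZK k M : k != 0 -> scal (mscale k M) -> scal M.
Proof.
move=> k0 /scalP /= [/eqP h1 /eqP h2 /(mulfI k0) h3]; apply/scalP; split=> //.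
  by apply/eqP; rewrite mulf_eq0 (negPf k0) in h1.
by apply/eqP; rewrite mulf_eq0 (negPf k0) in h2.
Qed.

Lemma mulKadj U X : mmul U (mmul (madj U) X) = mscale (mdet U) X.
Proof. by rewrite mmulA mmul_adj mscaleAl mmul1m. Qed.
Lemma muladjK U X : mmul (madj U) (mmul U X) = mscale (mdet U) X.
Proof. by rewrite mmulA madj_mul mscaleAl mmul1m. Qed.

Lemma scal_rot M N : mdet M != 0 -> scal (mmul M N) -> scal (mmul N M).
Proof.
move=> d0 [k h]; apply: (scalZK d0); exists (k * mdet M).
rewrite -mscaleAl -[mscale (mdet M) N]muladjK h mscaleAr mmulm1 mscaleAl madj_mul mscaleA.
by [].
Qed.

(** [C = N Z - Z adj B] gives [N C - C B = N^2 Z - (tr B) N Z + (det B) Z], which vanishes by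
    Cayley-Hamilton for [N]. *)
Lemma sylvester N B Z (C := Mat2 (e11 (mmul N Z) - e11 (mmul Z (madj B))) (e12 (mmul N Z) - e12 (mmul Z (madj B)))
    (e21 (mmul N Z) - e21 (mmul Z (madj B))) (e22 (mmul N Z) - e22 (mmul Z (madj B)))) :
  mtr N = mtr B -> mdet N = mdet B -> mmul C B = mmul N C.
Proof.
case: N B Z @C => n1 n2 n3 n4 [b1 b2 b3 b4] [z1 z2 z3 z4] C; rewrite /mtr /mdet /= => ht hd.
have E : b4 = n1 + n4 - b1 by rewrite ht; ring.
have k z x y : x - y = (n1 * n4 - n2 * n3 - (b1 * b4 - b2 * b3)) * z -> x = y.
  by rewrite hd subrr mul0r => /eqP; rewrite subr_eq0 => /eqP.
by rewrite /mmul /C /=; congr Mat2; [apply: (k z1) | apply: (k z2) | apply: (k z3) | apply: (k z4)]; rewrite E; ring.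
Qed.

Lemma commutator_scal C B V W (k : A) : k != 0 -> mmul V W = mscale (mdet W) (mid A) ->
  mscale k (mmul C B) = mmul (mmul V B) C ->
  scal (mmul C (mmul B (mmul (madj C) (mmul (madj B) W)))).
Proof.
move=> k0 VW h; apply: (scalZK k0); rewrite mmulA -mscaleAl h -!mmulA mulKadj !mscaleAr mulKadj mscaleAr VW.
by do 2 apply: scalZ; exists (mdet W).
Qed.
End Scalar.

Section Words.
Variables (G : groupType) (R : comNzRingType).
Implicit Types (f : G -> mat2 R) (w u v : seq G).

Definition mword f w := foldr (fun x M => mmul (f x) M) (mid R) w.

Lemma mword_cat f u v : mword f (u ++ v) = mmul (mword f u) (mword f v).
Proof. by elim: u => [|x u IH] /=; rewrite ?mmul1m // IH mmulA. Qed.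

Lemma eq_mword f f' w : {in w, f =1 f'} -> mword f w = mword f' w.
Proof.
elim: w => //= x w IH h; rewrite h ?mem_head // IH // => y yw.
by apply: h; rewrite inE yw orbT.
Qed.

Lemma mdet_mword f w : mdet (mword f w) = \prod_(x <- w) mdet (f x).
Proof. by elim: w => [|x w IH]; rewrite ?big_nil ?mdet1 // big_cons mdetM IH. Qed.
End Words.

Definition mmap (R S : Type) (f : R -> S) (M : mat2 R) := Mat2 (f (e11 M)) (f (e12 M)) (f (e21 M)) (f (e22 M)).

Section Map.
Variables (R S : comNzRingType) (f : {rmorphism R -> S}).
Implicit Types M N : mat2 R.
Lemma mmapM M N : mmap f (mmul M N) = mmul (mmap f M) (mmap f N).
Proof. by rewrite /mmap /mmul /= !rmorphD !rmorphM. Qed.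
Lemma mmap1 : mmap f (mid R) = mid S.
Proof. by rewrite /mmap /mid /= !rmorph0 !rmorph1. Qed.
Lemma mmap_adj M : mmap f (madj M) = madj (mmap f M).
Proof. by rewrite /mmap /madj /= !rmorphN. Qed.
Lemma mmapZ k M : mmap f (mscale k M) = mscale (f k) (mmap f M).
Proof. by rewrite /mmap /mscale /= !rmorphM. Qed.
Lemma mdet_map M : mdet (mmap f M) = f (mdet M).
Proof. by rewrite /mdet /= rmorphB !rmorphM. Qed.
Lemma mtr_map M : mtr (mmap f M) = f (mtr M).
Proof. by rewrite /mtr /= rmorphD. Qed.
Lemma mmap_word (G : groupType) (A : G -> mat2 R) w : mmap f (mword A w) = mword (mmap f \o A) w.
Proof. by elim: w => [|x w IH] /=; rewrite ?mmap1 // mmapM IH. Qed.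
End Map.

Section Proportional.
Variable R : realType.
Implicit Types M N : mat2 R.
Definition prj M N := exists2 k, k != 0 & M = mscale k N.

Lemma prjxx M : prj M M. Proof. by exists 1; rewrite ?oner_neq0 ?mscale1. Qed.
Lemma prj_sym M N : prj M N -> prj N M.
Proof. by case=> k k0 ->; exists k^-1; rewrite ?invr_eq0 // mscaleA mulVf // mscale1. Qed.
Lemma prj_trans M N P : prj M N -> prj N P -> prj M P.
Proof. by case=> k k0 -> [l l0 ->]; exists (k * l); rewrite ?mulf_neq0 // mscaleA. Qed.
Lemma prjM M N M' N' : prj M M' -> prj N N' -> prj (mmul M N) (mmul M' N').
Proof. by case=> k k0 -> [l l0 ->]; exists (k * l); rewrite ?mulf_neq0 // mscaleM. Qed.
Lemma prj_adj M N : prj M N -> prj (madj M) (madj N).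
Proof. by case=> k k0 ->; exists k; rewrite // madjZ. Qed.
Lemma prjZ k M : k != 0 -> prj (mscale k M) M.
Proof. by move=> k0; exists k. Qed.
Lemma prj_det M N : mdet N = 1 -> prj M N -> mdet M != 0.
Proof. by move=> dN [k k0 ->]; rewrite mdetZ dN mulr1 expf_neq0. Qed.
Lemma prj_sign M N : mdet M = 1 -> mdet N = 1 -> prj M N -> exists2 s : R, s ^+ 2 = 1 & M = mscale s N.
Proof. by move=> dM dN [k k0 E]; exists k; rewrite // -dM E mdetZ dN mulr1. Qed.
End Proportional.

(** * Families of matrices lying over the holonomy *)

Section Representation.
Variables (R : realType) (G : groupType) (rho : G -> mat2 R).
Hypothesis rho_det : forall g, mdet (rho g) = 1.
Hypothesis rho_mul : forall g h, prj (rho (g * h)%g) (mmul (rho g) (rho h)).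
Hypothesis rho_tr : forall g, g <> 1%g -> 4 < mtr (rho g) ^+ 2.
Implicit Types (g h x y : G) (w u v r : seq G) (rels : seq (seq G)).

Lemma rho_one : prj (rho 1%g) (mid R).
Proof.
have := rho_mul 1%g 1%g; rewrite mulg1 => h.
have := prjM (prjxx (madj (rho 1%g))) h; rewrite madj_mul rho_det mscale1 mmulA madj_mul rho_det mscale1 mmul1m.
exact: prj_sym.
Qed.

Lemma rho_inv g : prj (rho g^-1%g) (madj (rho g)).
Proof.
have := prj_trans (prj_sym (rho_mul g^-1%g g)) _; rewrite mulVg => /(_ _ rho_one) h.
have := prjM h (prjxx (madj (rho g))).
by rewrite -mmulA mmul_adj rho_det mscale1 mmulm1 mmul1m.
Qed.

Lemma rho_word (f : G -> mat2 R) w : (forall x, x \in w -> prj (f x) (rho x)) ->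
  prj (mword f w) (rho (\prod_(x <- w) x)%g).
Proof.
elim: w => [|x w IH] h /=; first by rewrite big_nil; exact: prj_sym rho_one.
rewrite big_cons; apply: prj_trans (prj_sym (rho_mul _ _)).
by apply: prjM; [apply: h (mem_head _ _) | apply: IH => y yw; apply: h; rewrite inE yw orbT].
Qed.

Lemma rho_not_scal g : g <> 1%g -> ~ scal (rho g).
Proof.
move=> /rho_tr h /scalP[h1 h2 h3]; move: h (rho_det g); rewrite /mtr /mdet h1 h2 h3; nra.
Qed.

(** Otherwise [rho x] is proportional to its adjugate; the traces agree and are nonzero, so the
    factor is 1 and [rho x] is scalar. *)
Lemma neq_inv x : x <> 1%g -> x <> x^-1%g.
Proof.
move=> x1 e; have := rho_inv x; rewrite -e => /prj_sign; rewrite mdet_adj => /(_ (rho_det x) (rho_det x)).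
move=> [s s1 E]; have tr := rho_tr x1; have d := rho_det x.
have t : mtr (rho x) = s * mtr (rho x) by rewrite {1}E mtrZ mtr_adj.
have s11 : s = 1.
  apply: (@mulIf _ (mtr (rho x))); last by rewrite mul1r -t.
  by apply/eqP => h; move: tr; rewrite h; lra.
apply: (rho_not_scal x1); apply/scalP; move: E; rewrite s11 mscale1; case: (rho x) => a b c d' [h1 h2 h3 _] /=.
by split=> //; lra.
Qed.

Section Letters.
Variable S : spec_ring R.
Implicit Type A : G -> mat2 S.
Notation ev := (sr_ev S).

(** Over the parameter ring inverses become adjugates; at the real point the matrices are those of
    [rho] up to scalars, so nontriviality can be tested there. *)
Definition lok A (L : seq G) := forall y, y \in L -> A y^-1%g = madj (A y) /\ prj (mmap ev (A y)) (rho y).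
Definition realizes A rels := lok A (flatten rels) /\ forall r, r \in rels -> scal (mword A r).

Lemma lok_word A w : lok A w -> prj (mmap ev (mword A w)) (rho (\prod_(x <- w) x)%g).
Proof. by move=> h; rewrite mmap_word; apply: rho_word => x /h[]. Qed.

Lemma prj_ev_det M g : prj (mmap ev M) (rho g) -> mdet M != 0.
Proof.
by move=> /(prj_det (rho_det g)); rewrite mdet_map; apply: contraNneq => ->; rewrite rmorph0.
Qed.

Lemma lok_det A w : lok A w -> mdet (mword A w) != 0.
Proof. by move/lok_word; exact: prj_ev_det. Qed.

Lemma lok_sub A L L' : {subset L' <= L} -> lok A L -> lok A L'.
Proof. by move=> s h y /s /h. Qed.

Definition ovr A x X y := if y == x then X else if y == x^-1%g then madj X else A y.

Lemma ovr_in A x X w : x \notin w -> x^-1%g \notin w -> {in w, ovr A x X =1 A}.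
Proof.
move=> h1 h2 y yw; rewrite /ovr; case: eqP => [e|_]; first by rewrite -e yw in h1.
by case: eqP => [e|//]; rewrite -e yw in h2.
Qed.

Lemma ovrx A x X : ovr A x X x = X. Proof. by rewrite /ovr eqxx. Qed.
Lemma ovrV A x X : x <> x^-1%g -> ovr A x X x^-1%g = madj X.
Proof. by move=> /eqP; rewrite /ovr eq_sym eqxx => /negPf ->. Qed.

Lemma ovr_lok A x X L : x <> 1%g -> lok A L -> x \notin L -> x^-1%g \notin L -> prj (mmap ev X) (rho x) ->
  lok (ovr A x X) (x :: x^-1%g :: L).
Proof.
move=> x1 hA xL xL' hX; have xx := neq_inv x1; move=> y; rewrite !inE => /or3P[/eqP ->|/eqP ->|yL].
- by rewrite ovrx ovrV.
- rewrite invgK ovrx ovrV // madjK; split=> //.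
  by rewrite mmap_adj; apply: prj_trans (prj_adj hX) (prj_sym (rho_inv x)).
- have [h1 h2] := hA y yL; have -> : ovr A x X y = A y by exact: ovr_in yL.
  split=> //; rewrite -h1 /ovr; case: eqP => [e|_]; first by move: xL'; rewrite -e invgK yL.
  by case: eqP => [/invg_inj e|//]; move: xL; rewrite -e yL.
Qed.
End Letters.

Definition realizable rels := exists (S : spec_ring R) (A : G -> mat2 S), realizes A rels.

Lemma lok_map (S T : spec_ring R) (i : {rmorphism S -> T}) (A : G -> mat2 S) L :
  (forall a, sr_ev T (i a) = sr_ev S a) -> lok A L -> lok (mmap i \o A) L.
Proof.
move=> hi h y /h[h1 h2] /=; rewrite h1 mmap_adj; split=> //.
by move: h2; rewrite /mmap /= !hi.
Qed.

Lemma scal_map (S T : idomainType) (i : {rmorphism S -> T}) (M : mat2 S) : scal M -> scal (mmap i M).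
Proof. by case=> k ->; exists (i k); rewrite mmapZ mmap1. Qed.

Lemma generic_matrices (S : spec_ring R) (M N : mat2 R) (x y : R) :
  exists (T : spec_ring R) (i : {rmorphism S -> T}) (M' N' : mat2 T) (x' y' : T),
    [/\ forall a, sr_ev T (i a) = sr_ev S a, mmap (sr_ev T) M' = M, mmap (sr_ev T) N' = N,
        sr_ev T x' = x & sr_ev T y' = y].
Proof.
have [T [i [t [h1 h2]]]] := spec_ring_ext S [:: e11 M; e12 M; e21 M; e22 M; e11 N; e12 N; e21 N; e22 N; x; y].
exists T, i, (Mat2 (t 0%N) (t 1%N) (t 2%N) (t 3%N)), (Mat2 (t 4%N) (t 5%N) (t 6%N) (t 7%N)), (t 8%N), (t 9%N).
split=> //; last 2 first; [exact: h2 | exact: h2 | |].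
  by rewrite /mmap /= !h2 //; case: (M).
by rewrite /mmap /= !h2 //; case: (N).
Qed.

(** The centralizer of a nonscalar matrix has two parameters, which become variables in
    [commutator_trivial]. *)
Lemma commuting_line (C B : mat2 R) : mmul C B = mmul B C -> ~ scal B ->
  exists x y : R, C = Mat2 (x + y * e11 B) (y * e12 B) (y * e21 B) (x + y * e22 B).
Proof.
case: C B => c1 c2 c3 c4 [b1 b2 b3 b4] [h1 h2 h3 h4] /= ns.
have [b20|b20] := eqVneq b2 0; last first.
  exists (c1 - c2 / b2 * b1), (c2 / b2); congr Mat2; first by ring.
  - by field.
  - by apply: (mulfI b20); rewrite mulrA mulrCA divff // mulr1; lra.
  - apply: (mulfI b20); have -> : b2 * (c1 - c2 / b2 * b1 + c2 / b2 * b4) = b2 * c1 - c2 * b1 + c2 * b4 by field.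
    by lra.
have [b30|b30] := eqVneq b3 0; last first.
  exists (c1 - c3 / b3 * b1), (c3 / b3); congr Mat2; first by ring.
  - by apply: (mulfI b30); rewrite mulrA mulrCA divff // mulr1; lra.
  - by field.
  - apply: (mulfI b30); have -> : b3 * (c1 - c3 / b3 * b1 + c3 / b3 * b4) = b3 * c1 - c3 * b1 + c3 * b4 by field.
    by lra.
have b14 : b1 - b4 != 0.
  by apply/eqP => e; apply: ns; apply/scalP => /=; split=> //; lra.
move: h2 h3; rewrite b20 b30 !mulr0 !mul0r !addr0 !add0r => h2 h3.
exists (c1 - (c1 - c4) / (b1 - b4) * b1), ((c1 - c4) / (b1 - b4)); rewrite !mulr0; congr Mat2; first by ring.
- by apply: (mulfI b14); lra.
- by apply: (mulfI b14); lra.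
- by field.
Qed.

Lemma rho_commutator g h (w : G) : (g * h * g^-1 * h^-1 * w = 1)%g ->
  exists2 s : R, s ^+ 2 = 1 & mmul (rho g) (rho h) = mscale s (mmul (mmul (madj (rho w)) (rho h)) (rho g)).
Proof.
move=> E; have E2 : (g * h = w^-1 * h * g)%g.
  have -> : (w^-1 = g * h * g^-1 * h^-1)%g by apply: (mulIg w); rewrite mulVg E.
  by rewrite !mulgVK.
apply: prj_sign; rewrite ?mdetM ?mdet_adj ?rho_det ?mulr1 //.
apply: prj_trans (prj_sym (rho_mul _ _)) _; rewrite E2.
apply: prj_trans (rho_mul _ _) _; apply: prjM; last exact: prjxx.
by apply: prj_trans (rho_mul _ _) _; apply: prjM (rho_inv w) (prjxx _).
Qed.

Lemma conj_trace (C B : mat2 R) (N : mat2 R) : mdet C = 1 -> mmul C B = mmul N C -> mtr B = mtr N.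
Proof.
move=> dC h; have : mtr (mmul (mmul C B) (madj C)) = mtr (mmul (mmul N C) (madj C)) by rewrite h.
rewrite -mmulA -mmulA mmul_adj dC mscale1 mmulm1 => <-.
by rewrite -[LHS]mul1r -dC /mtr /mdet /mmul /=; ring.
Qed.

(** The degenerate case of a scalar [W], left out by [commutator_generic]: if [h = 1] take [B = 1]
    and [C] free, otherwise [B] free and [C] in its centralizer. *)
Lemma commutator_trivial (S : spec_ring R) g h (W : mat2 S) : (g * h = h * g)%g -> scal W ->
  exists (T : spec_ring R) (i : {rmorphism S -> T}) (C B : mat2 T),
    [/\ forall a, sr_ev T (i a) = sr_ev S a, prj (mmap (sr_ev T) C) (rho g), prj (mmap (sr_ev T) B) (rho h) &
     scal (mmul C (mmul B (mmul (madj C) (mmul (madj B) (mmap i W)))))].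
Proof.
move=> gh sW.
have [h1|h1] := eqVneq h 1%g.
  have [T [i [C [_ [_ [_ [hi hC _ _ _]]]]]]] := generic_matrices S (rho g) (mid R) 0 0.
  exists T, i, C, (mid T); split=> //.
  - by rewrite hC; exact: prjxx.
  - by rewrite h1 mmap1; exact: prj_sym rho_one.
  by rewrite mmul1m mulKadj madj1 mmul1m; apply: scalZ; exact: scal_map.
move/eqP in h1.
have [|s s1] := @rho_commutator g h 1%g; first by rewrite gh mulgK mulgV mulg1.
have [s0 s02 ->] := prj_sign (rho_det _) (mdet1 R) rho_one.
rewrite madjZ madj1 mscaleAl mmul1m mscaleAl mscaleA => E.
have s2 : (s * s0) ^+ 2 = 1 by rewrite exprMn s1 s02 mulr1.
move: (s * s0) E s2 => {s s1 s0 s02} s; rewrite -mscaleAl => E s1.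
have tr := rho_tr h1; have t := conj_trace (rho_det g) E; rewrite mtrZ in t.
have s11 : s = 1.
  apply: (@mulIf _ (mtr (rho h))); last by rewrite mul1r -t.
  by apply/eqP => e; move: tr; rewrite e; lra.
rewrite s11 mscale1 in E.
have [x [y Cxy]] := commuting_line E (rho_not_scal h1).
have [T [i [B [_ [x' [y' [hi hB _ hx hy]]]]]]] := generic_matrices S (rho h) (mid R) x y.
pose C := Mat2 (x' + y' * e11 B) (y' * e12 B) (y' * e21 B) (x' + y' * e22 B).
exists T, i, C, B; split=> //.
- by rewrite Cxy /mmap /C /= !rmorphD !rmorphM hx hy -hB /=; exact: prjxx.
- by rewrite hB; exact: prjxx.
have CB : mmul C B = mmul B C by rewrite /mmul /C /=; congr Mat2; ring.
rewrite mmulA CB -mmulA mulKadj mscaleAr mulKadj; do 2 apply: scalZ; exact: scal_map.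
Qed.
End Representation.

(** * Solving the relators *)

Section Family.
Variables (R : realType) (G : groupType) (rho : G -> mat2 R).
Hypothesis rho_det : forall g, mdet (rho g) = 1.
Hypothesis rho_mul : forall g h, prj (rho (g * h)%g) (mmul (rho g) (rho h)).
Hypothesis rho_tr : forall g, g <> 1%g -> 4 < mtr (rho g) ^+ 2.
Implicit Types (g h x y : G) (u v w r : seq G) (rels : seq (seq G)).
Notation lok := (lok rho).
Notation realizes := (realizes rho).
Notation realizable := (realizable rho).

(** [D = B - adj B] has square [(tr B)^2 - 4 det B], so with [Z = C D] the formula of [sylvester]
    returns a multiple of [C]. This tells which value [Z] must take at the real point. *)
Lemma adj_split (B : mat2 R) (D := Mat2 (e11 B - e22 B) (2 * e12 B) (2 * e21 B) (e22 B - e11 B)) (m : R)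
   (C N : mat2 R) (Z := mmul C D) : mdet B = 1 -> mmul N C = mscale m (mmul C B) ->
  Mat2 (e11 (mmul N Z) - e11 (mmul Z (madj (mscale m B)))) (e12 (mmul N Z) - e12 (mmul Z (madj (mscale m B))))
    (e21 (mmul N Z) - e21 (mmul Z (madj (mscale m B)))) (e22 (mmul N Z) - e22 (mmul Z (madj (mscale m B))))
  = mscale (m * (mtr B ^+ 2 - 4)) C.
Proof.
move=> dB E; have {}E : mmul N Z = mscale m (mmul C (mmul B D)) by rewrite /Z mmulA E mscaleAl mmulA.
rewrite E /Z -mmulA madjZ mscaleAr mscaleAr.
have -> : mtr B ^+ 2 - 4 = mtr B ^+ 2 - 4 * mdet B by rewrite dB mulr1.
rewrite /D /mtr /mdet; case: B C {dB D Z E} => b1 b2 b3 b4 [c1 c2 c3 c4]; rewrite /mscale /mmul /madj /=.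
by congr Mat2; ring.
Qed.

(* The equation [C B C^-1 B^-1 W = 1] up to scalars: with [V] the adjugate of
   [W] and [k^2 = det V], the condition [tr (V B) = k tr B] is linear in [B],
   and then [C B' = N C] with [B' = k B], [N = V B] is solved by
   [C = N Z - Z adj B'] for every [Z], by Cayley-Hamilton. *)
Lemma commutator_generic (S : spec_ring R) g h (w : G) (W : mat2 S) (d : S) :
  (g * h * g^-1 * h^-1 * w = 1)%g -> w <> 1%g -> prj (mmap (sr_ev S) W) (rho w) -> mdet W = d ^+ 2 ->
  exists (T : spec_ring R) (i : {rmorphism S -> T}) (C B : mat2 T),
    [/\ forall a, sr_ev T (i a) = sr_ev S a, prj (mmap (sr_ev T) C) (rho g), prj (mmap (sr_ev T) B) (rho h) &
     scal (mmul C (mmul B (mmul (madj C) (mmul (madj B) (mmap i W)))))].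
Proof.
move=> E w1 [k k0 Wk] Wd.
have h1 : h <> 1%g.
  by move=> h1; apply: w1; move: E; rewrite h1 invg1 !mulg1 mulgV mul1g.
have [s s1 Es] := rho_commutator rho_det rho_mul E.
have trB : mtr (rho h) = s * mtr (mmul (madj (rho w)) (rho h)).
  by rewrite -mtrZ; apply: conj_trace (rho_det g) _; rewrite mscaleAl.
pose D := Mat2 (e11 (rho h) - e22 (rho h)) (2 * e12 (rho h)) (2 * e21 (rho h)) (e22 (rho h) - e11 (rho h)).
have [T [i [Y [Z [_ [_ [hi hY hZ _ _]]]]]]] := generic_matrices S (rho h) (mmul (rho g) D) 0 0.
pose ev := sr_ev T.
have evd : (sr_ev S d) ^+ 2 = k ^+ 2.
  by rewrite -rmorphXn -Wd -mdet_map Wk mdetZ rho_det mulr1.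
(* The square root of [det V] must evaluate to [k * s], with [s] the sign from [rho_commutator]; [d]
   does so up to sign. *)
have [kap kap2 evk] : exists2 kap : T, kap ^+ 2 = i d ^+ 2 & ev kap = k * s.
  have /eqP : (sr_ev S d - k * s) * (sr_ev S d + k * s) = 0.
    by transitivity (sr_ev S d ^+ 2 - k ^+ 2 * s ^+ 2); [ring | rewrite evd s1 mulr1 subrr].
  rewrite mulf_eq0 subr_eq0 addr_eq0 => /orP[] /eqP e.
    by exists (i d) => //; rewrite /ev hi.
  by exists (- i d); rewrite ?sqrrN // rmorphN /ev hi e opprK.
have s0 : s != 0 by apply/eqP => e; move: s1; rewrite e expr0n => /eqP; rewrite eq_sym oner_eq0.
have ks0 : k * s != 0 by rewrite mulf_neq0.
have kap0 : kap != 0 by apply/eqP => e; move: evk; rewrite e rmorph0 => /esym /eqP; apply/negP.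
pose V := madj (mmap i W).
have evV : mmap ev V = mscale k (madj (rho w)).
  rewrite /V mmap_adj -madjZ -Wk; congr madj; rewrite /mmap /= /ev !hi.
  by [].
(* The linear condition is [tr (K B) = 0]. Since [tr (K adj K) = 2 det K], it is solved by
   [B = 2 det K Y - tr (K Y) adj K] for every [Y]. *)
pose K := Mat2 (e11 V - kap) (e12 V) (e21 V) (e22 V - kap).
pose dK := 2 * mdet K; pose tK := mtr (mmul K Y).
pose B := Mat2 (dK * e11 Y - tK * e22 K) (dK * e12 Y + tK * e12 K) (dK * e21 Y + tK * e21 K) (dK * e22 Y - tK * e11 K).
have evtK : ev tK = 0.
  transitivity (k * mtr (mmul (madj (rho w)) (rho h)) - k * s * mtr (rho h)).
    rewrite /tK -mtr_map mmapM /ev hY -evk /K /mmap /= !rmorphB.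
    have := evV; rewrite /mmap /mscale /= => -[-> -> -> ->].
    by rewrite /mtr /=; ring.
  rewrite trB; transitivity ((k - k * s ^+ 2) * mtr (mmul (madj (rho w)) (rho h))); first by ring.
  by rewrite s1 mulr1 subrr mul0r.
(* At the real point [det K] is [k ^+ 2 * (2 - s * mtr (rho w))], nonzero because [|tr| > 2] for
   [w <> 1]. *)
have evdK : ev dK != 0.
  have -> : ev dK = 2 * (k ^+ 2 * (2 - s * mtr (rho w))).
    rewrite /dK rmorphM rmorph_nat; congr (_ * _); rewrite -mdet_map /K /mmap /= !rmorphB evk.
    have := evV; rewrite /mmap /mscale /= => -[-> -> -> ->].
    rewrite /mdet /mtr /=.
    transitivity (k ^+ 2 * (mdet (rho w) + s ^+ 2 - s * mtr (rho w))); first by rewrite /mdet /mtr; ring.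
    by rewrite rho_det s1; congr (_ * _); ring.
  rewrite !mulf_neq0 ?expf_neq0 //; apply/eqP => e.
  have := rho_tr w1; have : (s * mtr (rho w)) ^+ 2 = mtr (rho w) ^+ 2 by rewrite exprMn s1 mul1r.
  have -> : s * mtr (rho w) = 2 by lra.
  by lra.
have evB : mmap ev B = mscale (ev dK) (rho h).
  have := hY; rewrite -/ev => <-; rewrite /B /mmap /mscale /= !(rmorphB, rmorphD) !rmorphM evtK !mul0r.
  by rewrite !subr0 !addr0.
pose B' := mscale kap B; pose N := mmul V B.
pose C := Mat2 (e11 (mmul N Z) - e11 (mmul Z (madj B'))) (e12 (mmul N Z) - e12 (mmul Z (madj B')))
    (e21 (mmul N Z) - e21 (mmul Z (madj B'))) (e22 (mmul N Z) - e22 (mmul Z (madj B'))).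
have trN : mtr N = mtr B'.
  rewrite /N /B' mtrZ /B /tK /dK /K /mtr /mdet /mmul /=; ring.
have detN : mdet N = mdet B'.
  by rewrite /N /B' mdetM mdetZ /V mdet_adj mdet_map Wd rmorphXn kap2.
pose m := k * s * ev dK.
have evB' : mmap ev B' = mscale m (rho h) by rewrite /B' mmapZ evB mscaleA evk.
have evC : mmap ev C = mscale (m * (mtr (rho h) ^+ 2 - 4)) (rho g).
  rewrite -(@adj_split (rho h) m (rho g) (mmap ev N)) //; last first.
    rewrite /N mmapM evV evB Es mscaleM mscaleAl !mscaleA /m; congr mscale.
    by transitivity (s ^+ 2 * (k * ev dK)); [rewrite s1 mul1r | ring].
  rewrite -evB' -hZ -/ev -!mmapM -!mmap_adj -!mmapM /C /mmap /= !rmorphB.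
  by [].
have m0 : m != 0 by rewrite mulf_neq0.
exists T, i, C, B; split=> //.
- rewrite -/ev evC; apply: prjZ; rewrite mulf_neq0 // subr_eq0.
  by apply/eqP => e; have := rho_tr h1; rewrite e; lra.
- by rewrite -/ev evB; exact: prjZ.
apply: (@commutator_scal _ C B V (mmap i W) kap) => //; first by rewrite /V madj_mul.
have := @sylvester _ N B' Z trN detN; rewrite -/C => <-.
by rewrite /B' mscaleAr.
Qed.

Record paired rels : Prop := Paired {
  paired_uniq : uniq (flatten rels);
  paired_inv : forall x, x \in flatten rels -> x^-1%g \in flatten rels;
  paired_ne1 : forall x, x \in flatten rels -> x <> 1%g;
  paired_rel : forall r, r \in rels -> (\prod_(x <- r) x)%g = 1%g }.

Lemma paired_perm rels rels' : perm_eq (flatten rels) (flatten rels') ->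
  (forall r, r \in rels' -> (\prod_(x <- r) x)%g = 1%g) -> paired rels -> paired rels'.
Proof.
move=> p h [h1 h2 h3 h4]; have m := perm_mem p; split=> //.
- by rewrite -(perm_uniq p).
- by move=> x; rewrite -!m; exact: h2.
- by move=> x; rewrite -m; exact: h3.
Qed.

Definition lets (L : seq G) := [/\ uniq L, forall x, x \in L -> x^-1%g \in L & forall x, x \in L -> x <> 1%g].

Lemma lets_drop x (L L' : seq G) : perm_eq L (x :: x^-1%g :: L') -> lets L ->
  [/\ lets L', x <> 1%g, x \notin L' & x^-1%g \notin L'].
Proof.
move=> p [h1 h2 h3]; have m := perm_mem p.
move: h1; rewrite (perm_uniq p) => /= /and3P[]; rewrite inE negb_or => /andP[n1 n2] n3 u.
split=> //; last by apply: h3; rewrite m mem_head.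
split=> // y yr; last by apply: h3; rewrite m !inE yr !orbT.
have : y^-1%g \in L by apply: h2; rewrite m !inE yr !orbT.
rewrite m !inE => /or3P[/eqP e|/eqP e|//].
  by move: n3; rewrite -e invgK yr.
by move: n2; rewrite -(invg_inj e) yr.
Qed.

Lemma paired_lets rels : paired rels -> lets (flatten rels).
Proof. by case. Qed.

Lemma paired_drop x rels rels' : perm_eq (flatten rels) (x :: x^-1%g :: flatten rels') ->
  (forall r, r \in rels' -> (\prod_(x <- r) x)%g = 1%g) -> paired rels -> paired rels'.
Proof. by move=> p h /paired_lets /(lets_drop p)[[]]. Qed.

Lemma paired_notin x rels rels' : perm_eq (flatten rels) (x :: x^-1%g :: flatten rels') -> paired rels ->
  [/\ x <> 1%g, x <> x^-1%g, x \notin flatten rels' & x^-1%g \notin flatten rels'].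
Proof.
move=> p /paired_lets /(lets_drop p)[_ x1 n1 n2]; split=> //.
exact: neq_inv rho_det rho_mul rho_tr _ x1.
Qed.

Lemma realizes_perm (S : spec_ring R) (A : G -> mat2 S) rels rels' : flatten rels =i flatten rels' ->
  realizes A rels -> (forall r, r \in rels' -> scal (mword A r)) -> realizes A rels'.
Proof. by move=> m [h1 h2] h; split=> //; apply: lok_sub h1 => y; rewrite m. Qed.

Lemma realizable_perm rels rels' : rels =i rels' -> realizable rels -> realizable rels'.
Proof.
move=> m [S [A [h1 h2]]]; exists S, A; split; last by move=> r; rewrite -m; exact: h2.
by apply: lok_sub h1 => y /flattenP[r]; rewrite -m => rr yr; apply/flattenP; exists r.
Qed.

Lemma perm_rot u v rels : perm_eq (flatten ((u ++ v) :: rels)) (flatten ((v ++ u) :: rels)).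
Proof. by rewrite /= perm_cat2r perm_catC. Qed.

Lemma prod_rot u v : (\prod_(x <- u ++ v) x)%g = 1%g -> (\prod_(x <- v ++ u) x)%g = 1%g.
Proof.
rewrite !big_cat /= => h; have -> : (\prod_(x <- u) x)%g = (\prod_(x <- v) x)^-1%g.
  by apply: (mulIg (\prod_(x <- v) x)%g); rewrite h mulVg.
by rewrite mulgV.
Qed.

Lemma paired_rot u v rels : paired ((u ++ v) :: rels) -> paired ((v ++ u) :: rels).
Proof.
move=> h; apply: (paired_perm (perm_rot u v rels) _ h) => r; rewrite inE => /orP[/eqP ->|rr].
  by apply: prod_rot; apply: (paired_rel h); rewrite mem_head.
by apply: (paired_rel h); rewrite inE rr orbT.
Qed.

Lemma realizable_rot u v rels : realizable ((u ++ v) :: rels) -> realizable ((v ++ u) :: rels).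
Proof.
move=> [S [A [h1 h2]]]; exists S, A; apply: (realizes_perm (perm_mem (perm_rot u v rels))) => // r.
rewrite inE => /orP[/eqP ->|rr]; last by apply: h2; rewrite inE rr orbT.
have := h2 _ (mem_head _ _); rewrite !mword_cat; apply: scal_rot.
by apply: (lok_det rho_det rho_mul); apply: lok_sub h1 => y yu; rewrite /= !mem_cat yu.
Qed.

Lemma realizable_nil rels : flatten rels = [::] -> realizable rels.
Proof.
move=> e; exists (int_spec_ring R), (fun=> mid _); split; first by rewrite e.
move=> r rr; have -> : r = [::].
  by case: r rr => // x r rr; have : x \in flatten rels by [apply/flattenP; exists (x :: r); rewrite ?mem_head]; rewrite e.
by exists 1; rewrite mscale1.
Qed.

Lemma perm_merge x p u v rels : perm_eq (flatten ((x :: p) :: (u ++ x^-1%g :: v) :: rels))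
  (x :: x^-1%g :: flatten ((u ++ p ++ v) :: rels)).
Proof. by apply/seq.permP => P /=; rewrite !count_cat /= ?count_cat /= ?count_cat; lia. Qed.

Lemma merge_paired x p u v rels : paired ((x :: p) :: (u ++ x^-1%g :: v) :: rels) -> paired ((u ++ p ++ v) :: rels).
Proof.
move=> h; apply: (paired_drop (perm_merge x p u v rels) _ h) => r; rewrite inE => /orP[/eqP ->|rr]; last first.
  by apply: (paired_rel h); rewrite !inE rr !orbT.
have e1 : (\prod_(y <- u ++ x^-1%g :: v) y = 1)%g by apply: (paired_rel h); rewrite !inE eqxx orbT.
have := paired_rel h (mem_head _ _); move: e1; rewrite !big_cat !big_cons /= => e1 e2.
have -> : (\prod_(y <- p) y)%g = x^-1%g by apply: (mulgI x); rewrite e2 mulgV.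
exact: e1.
Qed.

(** Tietze elimination read backwards: [x] is assigned the adjugate of the word [p]. *)
Lemma merge_realizable x p u v rels : paired ((x :: p) :: (u ++ x^-1%g :: v) :: rels) ->
  realizable ((u ++ p ++ v) :: rels) -> realizable ((x :: p) :: (u ++ x^-1%g :: v) :: rels).
Proof.
move=> h [S [A [h1 h2]]]; have pm := perm_merge x p u v rels.
have [x1 xx n1 n2] := paired_notin pm h.
have hp : lok A p by apply: lok_sub h1 => y yp; rewrite /= !mem_cat yp ?orbT.
have xp : (\prod_(y <- p) y = x^-1)%g.
  have := paired_rel h (mem_head _ _); rewrite big_cons => e.
  by apply: (mulgI x); rewrite e mulgV.
pose X := madj (mword A p).
have ok : lok (ovr A x X) (x :: x^-1%g :: flatten ((u ++ p ++ v) :: rels)).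
  apply: (ovr_lok rho_det rho_mul rho_tr) => //; rewrite /X mmap_adj.
  have := prj_adj (lok_word rho_det rho_mul hp); rewrite xp => hh; apply: prj_trans hh _.
  by have := prj_adj (rho_inv rho_det rho_mul x); rewrite madjK.
have eqA w : {subset w <= flatten ((u ++ p ++ v) :: rels)} -> mword (ovr A x X) w = mword A w.
  by move=> sw; apply: eq_mword; apply: ovr_in; apply/negP => /sw; apply/negP.
have [eu ep ev] : [/\ mword (ovr A x X) u = mword A u, mword (ovr A x X) p = mword A p & mword (ovr A x X) v = mword A v].
  by split; apply: eqA => y yy; rewrite /= !mem_cat yy ?orbT.
exists S, (ovr A x X); split; first by apply: lok_sub ok => y; rewrite (perm_mem pm).
move=> r; rewrite !inE => /or3P[/eqP ->|/eqP ->|rr].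
- by rewrite /= ovrx ep /X madj_mul; exists (mdet (mword A p)).
- rewrite mword_cat /= ovrV // eu ev /X madjK -!mword_cat; apply: h2.
  by rewrite mem_head.
rewrite eqA; first by apply: h2; rewrite inE rr orbT.
by move=> y yr; apply/flattenP; exists r => //; rewrite inE rr orbT.
Qed.

Lemma cancel_paired x q rels : paired ((x :: x^-1%g :: q) :: rels) -> paired (q :: rels).
Proof.
move=> h; apply: (@paired_drop x ((x :: x^-1%g :: q) :: rels) (q :: rels) (perm_refl _) _ h).
move=> r; rewrite inE => /orP[/eqP ->|rr]; last by apply: (paired_rel h); rewrite !inE rr !orbT.
by have := paired_rel h (mem_head _ _); rewrite !big_cons mulKVg.
Qed.

(** [x] is unconstrained, so it receives a matrix of new variables evaluating to [rho x]. *)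
Lemma cancel_realizable x q rels : paired ((x :: x^-1%g :: q) :: rels) -> realizable (q :: rels) ->
  realizable ((x :: x^-1%g :: q) :: rels).
Proof.
move=> h [S [A [h1 h2]]].
have [x1 xx n1 n2] := @paired_notin x ((x :: x^-1%g :: q) :: rels) (q :: rels) (perm_refl _) h.
have [T [i [X [_ [_ [_ [hi hX _ _ _]]]]]]] := generic_matrices S (rho x) (mid R) 0 0.
have ok : lok (ovr (mmap i \o A) x X) (x :: x^-1%g :: flatten (q :: rels)).
  by apply: (ovr_lok rho_det rho_mul rho_tr) => //; [exact: lok_map | rewrite hX; exact: prjxx].
have eqA w : {subset w <= flatten (q :: rels)} -> mword (ovr (mmap i \o A) x X) w = mmap i (mword A w).
  by move=> sw; rewrite mmap_word; apply: eq_mword; apply: ovr_in; apply/negP => /sw; apply/negP.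
exists T, (ovr (mmap i \o A) x X); split=> // r.
rewrite inE => /orP[/eqP ->|rr].
  rewrite /= ovrx ovrV // mulKadj; apply: scalZ; rewrite eqA; last by move=> y yq; rewrite /= mem_cat yq.
  by apply: scal_map; apply: h2; rewrite mem_head.
rewrite eqA; first by apply: scal_map; apply: h2; rewrite inE rr orbT.
by move=> y yr; apply/flattenP; exists r => //; rewrite inE rr orbT.
Qed.

Lemma pairing (L : seq G) : uniq L -> (forall x, x \in L -> x^-1%g \in L) -> (forall x, x \in L -> x <> x^-1%g) ->
  exists ps, perm_eq L (flatten [seq [:: x; x^-1%g] | x <- ps]).
Proof.
elim: {L}_.+1 {-2}L (ltnSn (size L)) => // n IH [|x L] /=; first by exists [::].
rewrite ltnS => Ln /andP[xL uL] inv ne.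
have xx := ne x (mem_head _ _).
have xi : x^-1%g \in L.
  by have := inv x (mem_head _ _); rewrite inE => /orP[/eqP e|//]; case: xx.
have pL := perm_to_rem xi.
have mL := perm_mem pL.
have uR : uniq (x^-1%g :: rem x^-1%g L) by rewrite -(perm_uniq pL).
have [||||ps hps] := IH (rem x^-1%g L).
- by apply: leq_trans Ln; rewrite ltnS size_rem // leq_pred.
- by case/andP: uR.
- move=> y yR; have yL : y \in L by rewrite mL inE yR orbT.
  have := inv y; rewrite inE yL orbT inE => /(_ isT) /orP[/eqP e|].
    by move: uR => /= /andP[/negP nx _]; case: nx; rewrite -{1}e invgK.
  rewrite mL inE => /orP[/eqP /invg_inj e|//].
  by rewrite -e yL in xL.
- by move=> y yR; apply: ne; rewrite inE mL inE yR !orbT.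
exists (x :: ps) => /=; rewrite perm_cons; apply: perm_trans pL _.
by rewrite perm_cons.
Qed.
(* [a u1 b u2 a^-1 v1 b^-1 v2 = 1] in the new letters [g], [h] is
   [[g, h] v2 v1 u2 u1 = 1]. *)
Lemma handle_relation (a b u1 u2 v1 v2 : G) (s := (v1 * u2 * u1)%g) (g := (s^-1 * a * u1)%g) (h := (b * u2 * u1)%g) :
  (a * u1 * b * u2 * a^-1 * v1 * b^-1 * v2 = 1)%g ->
  (g * h * g^-1 * h^-1 * (v2 * s) = 1)%g.
Proof.
move=> E; have -> : (g * h * g^-1 * h^-1 = s^-1 * v2^-1)%g; last by rewrite -mulgA mulKg mulVg.
have -> : (v2^-1 = a * u1 * b * u2 * a^-1 * v1 * b^-1)%g by apply: (mulIg v2); rewrite mulVg E.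
have hs : (s * u1^-1 * u2^-1 = v1)%g by rewrite /s !mulgK.
rewrite /g /h; clearbody s; rewrite -hs !invgM !invgK !mulgA mulgK.
by [].
Qed.

Section Handle.
Variables (a b : G) (u1 u2 v1 v2 : seq G) (rels : seq (seq G)).
Let r := a :: u1 ++ b :: u2 ++ a^-1%g :: v1 ++ b^-1%g :: v2.
Let w := v2 ++ v1 ++ u2 ++ u1.
Hypothesis paired_r : paired (r :: rels).

Let perm_a : perm_eq (flatten (r :: rels)) (a :: a^-1%g :: (b :: b^-1%g :: w ++ flatten rels)).
Proof.
by apply/seq.permP => P /=; rewrite /r /w /= !count_cat /= ?count_cat /= ?count_cat /= ?count_cat /=; lia.
Qed.

Let la : lets (b :: b^-1%g :: w ++ flatten rels).
Proof. by case: (lets_drop perm_a (paired_lets paired_r)). Qed.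

Lemma handle_lets : lets (w ++ flatten rels).
Proof. by case: (lets_drop (perm_refl _) la). Qed.

Let s := (\prod_(x <- v1) x * \prod_(x <- u2) x * \prod_(x <- u1) x)%g.
Let g := (s^-1 * a * \prod_(x <- u1) x)%g.
Let h := (b * \prod_(x <- u2) x * \prod_(x <- u1) x)%g.

Lemma handle_commutator : (g * h * g^-1 * h^-1 * \prod_(x <- w) x = 1)%g.
Proof.
have := paired_rel paired_r (mem_head _ _); rewrite /r /w !(big_cons, big_cat) /= !mulgA => /handle_relation.
by rewrite !mulgA.
Qed.

(** Given [C] and [B] for [g] and [h], the substitution is inverted: [a = s g u1^-1] and
    [b = h u1^-1 u2^-1]. The relator then evaluates, up to scalars and cyclic rotation, to the
    commutator equation. *)
Lemma handle_glue (S : spec_ring R) (A : G -> mat2 S) :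
  lok A (w ++ flatten rels) -> (forall r', r' \in rels -> scal (mword A r')) ->
  (exists (T : spec_ring R) (i : {rmorphism S -> T}) (C B : mat2 T),
    [/\ forall c, sr_ev T (i c) = sr_ev S c, prj (mmap (sr_ev T) C) (rho g), prj (mmap (sr_ev T) B) (rho h) &
     scal (mmul C (mmul B (mmul (madj C) (mmul (madj B) (mmap i (mword A w))))))]) ->
  realizable (r :: rels).
Proof.
move=> hA hrel [T [i [C [B [hi hC hB hW]]]]].
have [_ a1 na na'] := lets_drop perm_a (paired_lets paired_r).
have [_ b1 nb nb'] := lets_drop (perm_refl _) la.
move: na na'; rewrite !inE !negb_or => /and3P[ab ab' na] /and3P[a'b a'b' na'].
pose A0 := mmap i \o A; have hA0 : lok A0 (w ++ flatten rels) by exact: lok_map.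
have sub u : {subset u <= w} -> lok A0 u by move=> su; apply: lok_sub hA0 => y /su yw; rewrite mem_cat yw.
have [k1 k2 k3 k4] : [/\ lok A0 u1, lok A0 u2, lok A0 v1 & lok A0 v2].
  by split; apply: sub => y yy; rewrite /w !mem_cat yy ?orbT.
pose U1 := mword A0 u1; pose U2 := mword A0 u2; pose V1 := mword A0 v1; pose V2 := mword A0 v2.
have p1 : prj (mmap (sr_ev T) U1) (rho (\prod_(x <- u1) x)%g) by exact: lok_word.
have p2 : prj (mmap (sr_ev T) U2) (rho (\prod_(x <- u2) x)%g) by exact: lok_word.
have p3 : prj (mmap (sr_ev T) V1) (rho (\prod_(x <- v1) x)%g) by exact: lok_word.
have p4 : prj (mmap (sr_ev T) V2) (rho (\prod_(x <- v2) x)%g) by exact: lok_word.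
have pM M N x y : prj (mmap (sr_ev T) M) (rho x) -> prj (mmap (sr_ev T) N) (rho y) -> prj (mmap (sr_ev T) (mmul M N)) (rho (x * y)%g).
  by move=> q1 q2; rewrite mmapM; apply: prj_trans (prjM q1 q2) (prj_sym (rho_mul _ _)).
have pV M x : prj (mmap (sr_ev T) M) (rho x) -> prj (mmap (sr_ev T) (madj M)) (rho x^-1%g).
  by move=> q1; rewrite mmap_adj; apply: prj_trans (prj_adj q1) (prj_sym (rho_inv rho_det rho_mul _)).
have [Sm [hS pS]] : exists Sm, (forall X, mmul V1 (mmul U2 (mmul U1 X)) = mmul Sm X) /\ prj (mmap (sr_ev T) Sm) (rho s).
  exists (mmul (mmul V1 U2) U1); split; first by move=> X; rewrite !mmulA.
  exact: (pM _ _ _ _ (pM _ _ _ _ p3 p2) p1).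
pose MA := mmul Sm (mmul C (madj U1)); pose MB := mmul B (mmul (madj U1) (madj U2)).
have pA : prj (mmap (sr_ev T) MA) (rho a).
  have -> : a = (s * (g * (\prod_(x <- u1) x)^-1))%g by rewrite /g !mulgA mulgV mul1g mulgK.
  exact: (pM _ _ _ _ pS (pM _ _ _ _ hC (pV _ _ p1))).
have pB : prj (mmap (sr_ev T) MB) (rho b).
  have -> : b = (h * ((\prod_(x <- u1) x)^-1 * (\prod_(x <- u2) x)^-1))%g by rewrite /h !mulgA !mulgK.
  exact: (pM _ _ _ _ hB (pM _ _ _ _ (pV _ _ p1) (pV _ _ p2))).
pose A1 := ovr A0 a MA; pose A2 := ovr A1 b MB.
have l1 : lok A1 (a :: a^-1%g :: w ++ flatten rels) by exact: (ovr_lok rho_det rho_mul rho_tr).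
have [na2 na2'] : b \notin a :: a^-1%g :: w ++ flatten rels /\ b^-1%g \notin a :: a^-1%g :: w ++ flatten rels.
  rewrite !inE !negb_or nb nb' !andbT eq_sym ab eq_sym a'b eq_sym ab' eq_sym.
  by rewrite a'b'.
have l2 : lok A2 (b :: b^-1%g :: a :: a^-1%g :: w ++ flatten rels) by exact: (ovr_lok rho_det rho_mul rho_tr).
have aa := neq_inv rho_det rho_mul rho_tr a1; have bb := neq_inv rho_det rho_mul rho_tr b1.
have E u : {subset u <= w ++ flatten rels} -> mword A2 u = mword A0 u.
  move=> su; have nu z : z \notin w ++ flatten rels -> z \notin u by move=> zn; apply/negP => /su; apply/negP.
  apply: eq_mword => y yu; rewrite /A2 (ovr_in _ _ (nu _ nb) (nu _ nb') yu).
  exact: (ovr_in _ _ (nu _ na) (nu _ na') yu).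
have [e1 e2 e3 e4] : [/\ mword A2 u1 = U1, mword A2 u2 = U2, mword A2 v1 = V1 & mword A2 v2 = V2].
  by split; apply: E => y yy; rewrite /w !mem_cat yy ?orbT.
have eb : A2 b = MB by exact: ovrx.
have eb' : A2 b^-1%g = madj MB by exact: ovrV.
have ea : A2 a = MA by rewrite /A2 /ovr (negPf ab) (negPf ab') /A1 ovrx.
have ea' : A2 a^-1%g = madj MA by rewrite /A2 /ovr (negPf a'b) (negPf a'b') /A1 ovrV.
exists T, A2; split.
  apply: lok_sub l2 => y; rewrite (perm_mem perm_a) !inE mem_cat.
  by case/or3P => [->|->|/or3P[->|->|->]]; rewrite ?orbT.
move=> r'; rewrite inE => /orP[/eqP ->|rr]; last first.
  rewrite E; last by move=> y yr; rewrite mem_cat; apply/orP; right; apply/flattenP; exists r'.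
  by rewrite /A0 -mmap_word; apply: scal_map; exact: hrel.
rewrite /r /= !mword_cat /= !mword_cat /= !mword_cat /= ea ea' eb eb' e1 e2 e3 e4.
rewrite /MA /MB !madjM !madjK -!mmulA.
rewrite !(muladjK, mscaleAr) hS !(muladjK, mscaleAr).
do ?apply: scalZ.
apply: scal_rot.
  have pX : prj (mmap (sr_ev T) (mmul C (mmul B (mmul (madj C) (mmul (madj B) V2))))) (rho (g * (h * (g^-1 * (h^-1 * \prod_(x <- v2) x))))%g).
    exact: (pM _ _ _ _ hC (pM _ _ _ _ hB (pM _ _ _ _ (pV _ _ hC) (pM _ _ _ _ (pV _ _ hB) p4)))).
  exact: prj_ev_det rho_det _ _ _ pX.
rewrite -!mmulA; have -> : mmul V2 Sm = mmap i (mword A w); last exact: hW.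
rewrite mmap_word -/A0 /w !mword_cat -/U1 -/U2 -/V1 -/V2 -[U1]mmulm1 hS.
by rewrite mmulm1.
Qed.

Lemma handle_closed : (forall y, y \in r -> y^-1%g \in r) -> forall y, y \in w -> y^-1%g \in w.
Proof.
move=> cl y yw; have [u inv _] := handle_lets.
have yr : y \in r.
  by move: yw; rewrite /w /r !(inE, mem_cat) => /or4P[]->; rewrite ?orbT.
have : y^-1%g \in w ++ flatten rels by apply: inv; rewrite mem_cat yw.
rewrite mem_cat => /orP[//|yf].
have [ur _ _] := paired_lets paired_r; move: ur; rewrite -[flatten _]/(r ++ flatten rels) cat_uniq => /and3P[_ /hasPn /(_ _ yf)] /=.
by rewrite (cl _ yr).
Qed.

Lemma handle_realizable : (forall y, y \in r -> y^-1%g \in r) ->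
  (forall rels', (size (flatten rels') < size (flatten (r :: rels)))%N -> paired rels' -> realizable rels') ->
  realizable (r :: rels).
Proof.
move=> cl IH; have [u inv ne1] := handle_lets; have comm := handle_commutator.
have sz : (size (w ++ flatten rels) < size (flatten (r :: rels)))%N by rewrite (perm_size perm_a) /=; lia.
(* If [w] is trivial in [G] it can serve as a shorter relator, and [W] is then scalar. *)
have [w1|w1] := pselect ((\prod_(x <- w) x)%g = 1%g).
  have [|S [A [h1 h2]]] := IH (w :: rels) sz.
    split=> // r'; rewrite inE => /orP[/eqP ->|rr] //; apply: (paired_rel paired_r).
    by rewrite inE rr orbT.
  apply: (handle_glue h1); first by move=> r' rr; apply: h2; rewrite inE rr orbT.
  apply: (commutator_trivial rho_det rho_mul rho_tr); last by apply: h2; rewrite mem_head.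
  move: comm; rewrite w1 mulg1 => e.
  have -> : (g * h)%g = (g * h * g^-1 * h^-1 * h * g)%g by rewrite !mulgVK.
  by rewrite e mul1g.
have uw : uniq w by move: u; rewrite cat_uniq => /and3P[].
have wne x : x \in w -> x <> x^-1%g.
  by move=> xw; apply: (neq_inv rho_det rho_mul rho_tr); apply: ne1; rewrite mem_cat xw.
(* Otherwise the letters of [w] are kept by the relators [x x^-1], which impose nothing. The pairing
   also shows that [det W] is a square, as [commutator_generic] requires. *)
have [ps hps] := pairing uw (handle_closed cl) wne.
have pf : perm_eq (w ++ flatten rels) (flatten ([seq [:: x; x^-1%g] | x <- ps] ++ rels)).
  by rewrite flatten_cat perm_cat2r.
have [||S [A [h1 h2]]] := IH ([seq [:: x; x^-1%g] | x <- ps] ++ rels).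
- by rewrite -(perm_size pf).
- split.
  + by rewrite -(perm_uniq pf).
  + by move=> x; rewrite -!(perm_mem pf); exact: inv.
  + by move=> x; rewrite -(perm_mem pf); exact: ne1.
  + move=> r'; rewrite mem_cat => /orP[/mapP[x _ ->]|rr]; last by apply: (paired_rel paired_r); rewrite inE rr orbT.
    by rewrite !big_cons big_nil mulg1 mulgV.
have hA : lok A (w ++ flatten rels) by apply: lok_sub h1 => y; rewrite (perm_mem pf).
have hw : lok A w by apply: lok_sub hA => y yw; rewrite mem_cat yw.
apply: (handle_glue hA); first by move=> r' rr; apply: h2; rewrite mem_cat rr orbT.
apply: (commutator_generic comm w1 (lok_word rho_det rho_mul hw) (d := \prod_(x <- ps) mdet (A x))).
have hp : lok A (flatten [seq [:: x; x^-1%g] | x <- ps]) by apply: lok_sub hw => y; rewrite (perm_mem hps).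
rewrite mdet_mword (perm_big _ hps) /=; clear -hp.
elim: ps hp => [|x ps IHp] hp /=; first by rewrite !big_nil expr1n.
rewrite !big_cons IHp; last by move=> y yp; apply: hp; rewrite /= !inE yp !orbT.
by have [-> _] := hp x (mem_head _ _); rewrite mdet_adj exprMn mulrA -expr2.
Qed.
End Handle.

Lemma mem_split (T : eqType) (x : T) (s : seq T) : x \in s -> exists s1 s2, s = s1 ++ x :: s2.
Proof. by case/splitPr=> s1 s2; exists s1, s2. Qed.

(** Take [x] and [x^-1] with [p] between them. If [p] is empty they cancel; if a letter of [p] has
    its inverse in [q], the two pairs are linked and form a handle; otherwise some pair lies inside
    [p], and a rotation restarts the argument with a shorter gap. *)
Lemma relator_ind (P : seq G -> Prop) r :
  (forall u v, P (v ++ u) -> P (u ++ v)) ->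
  (forall x q, P (x :: x^-1%g :: q)) ->
  (forall a b u1 u2 v1 v2, P (a :: u1 ++ b :: u2 ++ a^-1%g :: v1 ++ b^-1%g :: v2)) ->
  uniq r -> (forall y, y \in r -> y^-1%g \in r /\ y <> y^-1%g) -> r <> [::] -> P r.
Proof.
move=> Prot Pc Ph ur cl rn.
have [x [p [q er]]] : exists x p q, r = x :: p ++ x^-1%g :: q.
  case: r rn ur cl => // x r _ _ cl; have [] := cl x (mem_head _ _); rewrite inE => /orP[/eqP e|xr] ne; first by case: ne.
  by have [p [q ->]] := mem_split xr; exists x, p, q.
elim: {p}_.+1 {-2}p (ltnSn (size p)) x q r er ur cl {rn} => // n IH p pn x q r er ur cl.
have [[z [zp zq]]|no] := pselect (exists z, z \in p /\ z^-1%g \in q).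
  have [p1 [p2 ep]] := mem_split zp; have [q1 [q2 eq]] := mem_split zq.
  by rewrite er ep eq -catA /=; exact: Ph.
case: p pn er no => [|y p] pn er no; first by rewrite er; exact: Pc.
have yr : y \in r by rewrite er /= !inE eqxx orbT.
have [yi yne] := cl y yr.
move: (ur); rewrite er /= inE negb_or => /and3P[/andP[xy _] yn _].
move: yn; rewrite mem_cat inE !negb_or => /and3P[_ yx _].
have yp : y^-1%g \in p.
  move: yi; rewrite er !inE mem_cat inE => /or4P[/eqP e|/eqP e|//|].
  - by move: yx; rewrite -e invgK eqxx.
  - by case: yne.
  - case/orP => [/eqP /invg_inj e|yq]; first by move: xy; rewrite e eqxx.
    by case: no; exists y; rewrite mem_head.
have [p1 [p2 ep]] := mem_split yp.
have er' : (y :: p ++ x^-1%g :: q) ++ [:: x] = y :: p1 ++ y^-1%g :: (p2 ++ x^-1%g :: q ++ [:: x]).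
  by rewrite ep /= -?catA /= -?catA.
rewrite -[_ :: _]/([:: x] ++ (y :: p ++ x^-1%g :: q)); apply: Prot.
have pr : perm_eq r ((y :: p ++ x^-1%g :: q) ++ [:: x]) by rewrite er -cat1s perm_catC.
apply: (IH p1 _ y _ _ er').
- by move: pn; rewrite ep /= size_cat /=; lia.
- by rewrite -(perm_uniq pr).
- by move=> z; rewrite -!(perm_mem pr); exact: cl.
Qed.
Lemma flatten_rem (s : seq (seq G)) r : r \in s -> perm_eq (flatten s) (flatten (r :: rem r s)).
Proof. by move/perm_to_rem; exact: perm_flatten. Qed.

Lemma paired_rem rels r : r \in rels -> paired rels -> paired (r :: rem r rels).
Proof.
move=> rr h; apply: (paired_perm (flatten_rem rr) _ h) => r'.
by rewrite -(perm_mem (perm_to_rem rr)); exact: paired_rel.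
Qed.

Theorem paired_realizable rels : paired rels -> realizable rels.
Proof.
elim: {rels}_.+1 {-2}rels (ltnSn (size (flatten rels))) => // n IH rels; rewrite ltnS => sz hg.
have [all0|/existsNP[r /not_implyP[rr r0]]] := pselect (forall r, r \in rels -> r = [::]).
  apply: realizable_nil; elim: (rels) all0 => //= r s IHs a0.
  by rewrite (a0 r (mem_head _ _)) /=; apply: IHs => r' r's; apply: a0; rewrite inE r's orbT.
apply: (@realizable_perm (r :: rem r rels)); first by move=> x; rewrite (perm_mem (perm_to_rem rr)).
have {}sz : (size (flatten (r :: rem r rels)) <= n)%N by rewrite -(perm_size (flatten_rem rr)).
move: (paired_rem rr hg) sz; move: (rem r rels) => {hg rr} {}rels hg sz.
have {}IH rels' : (size (flatten rels') < size (flatten (r :: rels)))%N -> paired rels' -> realizable rels'.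
  by move=> lt; apply: IH; exact: leq_trans lt sz.
(* A letter whose inverse lies in another relator allows the two relators to be merged. *)
have [cl|/existsNP[y /not_implyP[yr /negP yi]]] := pselect (forall y, y \in r -> y^-1%g \in r); last first.
  have [u [v er]] := mem_split yr; rewrite er; apply: realizable_rot.
  have hg1 : paired ((y :: v ++ u) :: rels) by apply: (@paired_rot u (y :: v)); rewrite -er.
  have yf : y^-1%g \in flatten rels.
    have := paired_inv hg (x := y); rewrite /= !mem_cat yr => /(_ isT) /orP[|//].
    by rewrite (negPf yi).
  have /flattenP[r' r'r yr'] := yf.
  have [u' [v' er']] := mem_split yr'.
  move: (perm_to_rem r'r) (flatten_rem r'r); move: (rem r' rels) => rels1 p1 p2; have pm := perm_mem p1.
  apply: (@realizable_perm ((y :: v ++ u) :: r' :: rels1)).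
    by move=> x; rewrite inE -pm -in_cons.
  have hg2 : paired ((y :: v ++ u) :: r' :: rels1).
    apply: (paired_perm _ _ hg1); first by rewrite -[flatten _]/((y :: v ++ u) ++ flatten rels) -[X in perm_eq _ X]/((y :: v ++ u) ++ flatten (r' :: rels1)) perm_cat2l.
    by move=> x; rewrite inE -pm -in_cons => /(paired_rel hg1).
  rewrite er' in hg2 *; apply: merge_realizable => //; apply: IH; last exact: merge_paired hg2.
  rewrite /= !size_cat (perm_size p2) er er' /= !size_cat /= ?size_cat /=; lia.
have ur : uniq r by have := paired_uniq hg; rewrite -[flatten _]/(r ++ flatten rels) cat_uniq => /and3P[].
have ri y : y \in r -> y^-1%g \in r /\ y <> y^-1%g.
  move=> yr; split; first exact: cl.
  by apply: (neq_inv rho_det rho_mul rho_tr); apply: (paired_ne1 hg); rewrite /= mem_cat yr.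
apply: (relator_ind (P := fun r => paired (r :: rels) -> (forall y, y \in r -> y^-1%g \in r) ->
  (forall rels', (size (flatten rels') < size (flatten (r :: rels)))%N -> paired rels' -> realizable rels') ->
  realizable (r :: rels)) _ _ _ ur ri r0 hg cl IH) => {r ur ri r0 hg cl sz IH}.
- move=> u v P hg cl IH; apply: realizable_rot; apply: P.
  + exact: paired_rot.
  + by move=> y; rewrite !mem_cat ![(_ \in v) || _]orbC -!mem_cat; exact: cl.
  + by rewrite -(perm_size (perm_rot u v rels)).
- move=> x q hg _ IH; apply: cancel_realizable => //; apply: IH; last exact: cancel_paired hg.
  by rewrite /=; lia.
- by move=> a b u1 u2 v1 v2 hg cl IH; exact: handle_realizable.
Qed.
End Family.

(** * Quotients acting on a projective line *)

Section ProjectiveLine.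
Variable F : finFieldType.
Implicit Types (M N : mat2 F) (t : option F) (v : F * F).

(** [None] is the point at infinity. Rows are multiplied by matrices on the right because
    permutations compose from left to right. *)
Definition prep t : F * F := if t is Some z then (z, 1) else (1, 0).
Definition pnrm v : option F := if v.2 == 0 then None else Some (v.1 / v.2).
Definition rowmul v M := (v.1 * e11 M + v.2 * e21 M, v.1 * e12 M + v.2 * e22 M).
Definition pact M t := pnrm (rowmul (prep t) M).

Lemma prepK t : pnrm (prep t) = t.
Proof. by case: t => [z|] /=; rewrite /pnrm /= ?eqxx // oner_eq0 divr1. Qed.

Lemma pnrmZ k v : k != 0 -> pnrm (k * v.1, k * v.2) = pnrm v.
Proof.
move=> k0; rewrite /pnrm /= mulf_eq0 (negPf k0) /=; case: eqP => // /eqP v0.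
by rewrite -mulf_div divff // mul1r.
Qed.

Lemma pnrmK v : v != (0, 0) -> exists2 k, k != 0 & prep (pnrm v) = (k * v.1, k * v.2).
Proof.
case: v => a b; rewrite /pnrm /=; have [->|b0] := eqVneq b 0 => v0 /=.
  have a0 : a != 0 by apply: contraNneq v0 => ->.
  by exists a^-1; rewrite ?invr_eq0 // mulVf // mulr0.
by exists b^-1; rewrite ?invr_eq0 // mulVf // mulrC.
Qed.

Lemma rowmulM v M N : rowmul (rowmul v M) N = rowmul v (mmul M N).
Proof. by rewrite /rowmul /=; congr pair; ring. Qed.

Lemma rowmul_neq0 v M : mdet M != 0 -> v != (0, 0) -> rowmul v M != (0, 0).
Proof.
move=> d0; apply: contraNneq => e; have : rowmul (rowmul v M) (madj M) = (0, 0).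
  by rewrite e /rowmul /= !mul0r addr0.
rewrite rowmulM mmul_adj /rowmul /= !mulr0 !mulr1 addr0 add0r => -[/eqP h1 /eqP h2].
move: h1 h2; rewrite !mulf_eq0 (negPf d0) !orbF => /eqP h1 /eqP h2.
by rewrite [v]surjective_pairing h1 h2.
Qed.

Lemma pactM M N t : mdet M != 0 -> pact (mmul M N) t = pact N (pact M t).
Proof.
move=> d0; rewrite /pact -rowmulM.
have pt0 : prep t != (0, 0) by case: t => [z|]; rewrite xpair_eqE oner_eq0 ?andbF.
have [k k0 ->] := pnrmK (rowmul_neq0 d0 pt0).
have -> : rowmul (k * (rowmul (prep t) M).1, k * (rowmul (prep t) M).2) N =
  (k * (rowmul (rowmul (prep t) M) N).1, k * (rowmul (rowmul (prep t) M) N).2).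
  by rewrite /rowmul /=; congr pair; ring.
by rewrite pnrmZ.
Qed.

Lemma pactZ k t : k != 0 -> pact (mscale k (mid F)) t = t.
Proof.
move=> k0; rewrite /pact -[RHS]prepK -[RHS](pnrmZ _ k0); congr pnrm.
by rewrite /rowmul /=; congr pair; ring.
Qed.

Lemma pact_inj M : mdet M != 0 -> injective (pact M).
Proof. by move=> d0; apply: (can_inj (g := pact (madj M))) => t; rewrite -pactM // mmul_adj pactZ. Qed.

Definition pperm M : {perm option F} :=
  if pselect (injective (pact M)) is left h then perm h else 1%g.

Lemma ppermE M t : mdet M != 0 -> pperm M t = pact M t.
Proof. by move=> /pact_inj h; rewrite /pperm; case: pselect => // h'; rewrite permE. Qed.

Lemma ppermM M N : mdet M != 0 -> mdet N != 0 -> pperm (mmul M N) = (pperm M * pperm N)%g.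
Proof.
by move=> m0 n0; apply/permP => t; rewrite permM !ppermE ?pactM // mdetM mulf_neq0.
Qed.

Lemma pperm_scal M : mdet M != 0 -> scal M -> pperm M = 1%g.
Proof.
move=> m0 [k e]; apply/permP => t; rewrite ppermE // perm1 e pactZ //.
by apply: contraNneq m0 => k0; rewrite e mdetZ k0 expr0n mul0r.
Qed.

(** Fixing infinity, 0 and 1 kills in turn [e12], [e21] and the difference of the diagonal
    entries. *)
Lemma pperm1_scal M : mdet M != 0 -> pperm M = 1%g -> scal M.
Proof.
move=> m0 e; have fix_ t : pact M t = t by rewrite -ppermE // e perm1.
have h1 : e12 M = 0.
  by have := fix_ None; rewrite /pact /pnrm /= !mul1r !mul0r !addr0; case: eqP.
have h2 : e21 M = 0.
  have := fix_ (Some 0); rewrite /pact /pnrm /= !mul1r !mul0r !add0r; case: eqP => // /eqP n [/eqP].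
  by rewrite mulf_eq0 invr_eq0 (negPf n) orbF => /eqP.
apply/scalP; split=> //.
have := fix_ (Some 1); rewrite /pact /pnrm /= h1 h2 !mul1r addr0 add0r; case: eqP => // /eqP n [/eqP].
by rewrite -subr_eq0 -{1}(divff n) -mulrBl mulf_eq0 invr_eq0 (negPf n) orbF subr_eq0 => /eqP.
Qed.
End ProjectiveLine.

(** * Norms of matrix words *)

Section MatNorm.
Variables (R : realType) (S : spec_ring R).
Notation N := (@sr_norm R S).
Implicit Types M P : mat2 S.
Definition mnorm M := (N (e11 M) + N (e12 M) + N (e21 M) + N (e22 M))%N.

Lemma mnormM M P : (mnorm (mmul M P) <= mnorm M * mnorm P)%N.
Proof.
have h (a b c d : S) : (N (a * b + c * d)%R <= N a * N b + N c * N d)%N.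
  by apply: leq_trans (sr_normD _ _) _; rewrite leq_add // sr_normM.
have := h (e11 M) (e11 P) (e12 M) (e21 P); have := h (e11 M) (e12 P) (e12 M) (e22 P).
have := h (e21 M) (e11 P) (e22 M) (e21 P); have := h (e21 M) (e12 P) (e22 M) (e22 P).
rewrite /mnorm /=; set B := (N (e11 P) + _ + _ + _)%N.
have q a x y : (x + y <= B)%N -> (a * x + a * y <= a * B)%N by move=> xy; rewrite -mulnDr leq_mul2l xy orbT.
have [q1 q2] : (N (e11 P) + N (e12 P) <= B)%N /\ (N (e21 P) + N (e22 P) <= B)%N by rewrite /B; lia.
have := q (N (e11 M)) _ _ q1; have := q (N (e12 M)) _ _ q2.
have := q (N (e21 M)) _ _ q1; have := q (N (e22 M)) _ _ q2.
rewrite !mulnDl; clearbody B; clear.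
move: (N (e11 M)) (N (e12 M)) (N (e21 M)) (N (e22 M)) (N (e11 P)) (N (e12 P)) (N (e21 P)) (N (e22 P)).
move: (N (e11 _ * e11 _ + _)%R) (N (e11 _ * e12 _ + _)%R) (N (e21 _ * e11 _ + _)%R) (N (e21 _ * e12 _ + _)%R).
by move=> n1 n2 n3 n4 m1 m2 m3 m4 p1 p2 p3 p4; lia.
Qed.

Lemma mnorm_word (G : groupType) (A : G -> mat2 S) (L w : seq G) : {subset w <= L} ->
  (mnorm (mword A w) <= mnorm (mid S) * (\sum_(x <- L) mnorm (A x)) ^ size w)%N.
Proof.
elim: w => [|x w IH] sw; first by rewrite expn0 muln1.
apply: (leq_trans (mnormM _ _)); rewrite expnS mulnCA; apply: leq_mul.
  by rewrite (big_rem x) ?sw ?mem_head //= leq_addr.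
by apply: IH => y yw; apply: sw; rewrite inE yw orbT.
Qed.

Lemma not_scal_entry (f : {rmorphism S -> R}) M : ~ scal (mmap f M) ->
  exists2 h, f h != 0 & (N h <= mnorm M)%N /\
    forall (F : fieldType) (g : {rmorphism S -> F}), scal (mmap g M) -> g h = 0.
Proof.
move=> ns; have [h1|h1] := eqVneq (f (e12 M)) 0; last first.
  exists (e12 M) => //; split; first by rewrite /mnorm; lia.
  by move=> F g /scalP[].
have [h2|h2] := eqVneq (f (e21 M)) 0; last first.
  exists (e21 M) => //; split; first by rewrite /mnorm; lia.
  by move=> F g /scalP[].
exists (e11 M - e22 M).
  rewrite rmorphB subr_eq0; apply/eqP => h3; apply: ns; apply/scalP; split=> //.
split; last by move=> F g /scalP[_ _ /= e]; rewrite rmorphB e subrr.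
by apply: leq_trans (sr_normD _ _) _; rewrite sr_normN /mnorm; lia.
Qed.
End MatNorm.

Lemma morph_word (G K : groupType) (phi : G -> K) (w : seq G) : {morph phi : x y / (x * y)%g} ->
  phi (\prod_(x <- w) x)%g = (\prod_(x <- w) phi x)%g.
Proof.
move=> h; apply: (big_morph phi h); apply: (mulgI (phi 1%g)).
by rewrite -h !mulg1.
Qed.

Theorem linear_quotients (R : realType) (G : groupType) (rho : G -> mat2 R) (rels : seq (seq G)) :
  fuchsian rho -> surface_presentation rels ->
  exists C : nat, forall w : seq G, {subset w <= letters rels} -> (\prod_(x <- w) x)%g <> 1%g ->
    exists p, [/\ prime p, (p <= C * size w)%N &
      exists2 phi : G -> {perm option 'F_p}, {morph phi : x y / (x * y)%g} & phi (\prod_(x <- w) x)%g <> 1%g].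
Proof.
move=> [rdet rsign [e e0 rfar] _] [su sn si sr sg sU].
have rmul g h : prj (rho (g * h)%g) (mmul (rho g) (rho h)).
  by case: (rsign g h) => ->; [exact: prjxx | apply: prjZ; rewrite oppr_eq0 oner_eq0].
have rtr g : g <> 1%g -> 4 < mtr (rho g) ^+ 2.
  by move=> g1; exact: displacement_trace (rdet g) e0 (rfar g g1).
have [S [A [hA hrel]]] := paired_realizable rdet rmul rtr (Paired su si sn sr).
pose L := letters rels; rewrite -/(letters rels) -/L in hA.
(* Besides [h], the determinants of all letters have to survive mod [p] for their images to be
   permutations, so the prime is chosen for [h * D]. *)
pose D := \prod_(x <- L) mdet (A x).
(* The base absorbs the constant factors: [a <= a ^ size w] as the word is nonempty. *)
pose a := (mnorm (mid S) * (sr_norm D).+1).+1; pose b := (\sum_(x <- L) mnorm (A x))%N.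
have [C hC] := @sr_spec R S 0%N (a * b)%N; exists C => w wL w1.
have w0 : (0 < size w)%N by case: (w) w1 => //; rewrite big_nil.
have hw : lok rho A w by apply: lok_sub hA => x /wL.
have [k k0 Ek] := lok_word rdet rmul hw.
have [|h hev [hN hF]] := @not_scal_entry R S (sr_ev S) (mword A w).
  by rewrite Ek => /(scalZK k0); exact: rho_not_scal rdet rtr _ w1.
have evD : sr_ev S D != 0.
  rewrite rmorph_prod prodf_seq_neq0; apply/allP => x xL /=; rewrite -mdet_map.
  by apply: prj_det (rdet x) _; case: (hA x xL).
have bound : (sr_norm (h * D)%R <= (a * b) ^ size w)%N.
  apply: (leq_trans (sr_normM _ _)); apply: (@leq_trans (mnorm (mid S) * b ^ size w * (sr_norm D).+1)).
    by apply: leq_mul => //; apply: (leq_trans hN); exact: mnorm_word.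
  rewrite mulnAC expnMn leq_mul // (@leq_trans a) ?leqnSn //.
  by rewrite -{1}[a]expn1 leq_pexp2l.
have evhD : sr_ev S (h * D) != 0 by rewrite rmorphM mulf_neq0.
have [p [pp _ pC [f hf]]] := hC _ _ w0 bound evhD.
move: hf; rewrite rmorphM mulf_eq0 negb_or => /andP[fh fD].
have fdet x : x \in L -> mdet (mmap f (A x)) != 0.
  move=> xL; rewrite mdet_map; move: fD; rewrite rmorph_prod prodf_seq_neq0 => /allP/(_ x xL).
  by [].
pose F x : {perm option 'F_p} := pperm (mmap f (A x)).
have Fword u : {subset u <= L} -> mdet (mmap f (mword A u)) != 0 /\ pperm (mmap f (mword A u)) = (\prod_(x <- u) F x)%g.
  elim: u => [|x u IH] uL.
    rewrite big_nil /= mmap1 mdet1 oner_neq0; split=> //.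
    by apply: pperm_scal; [rewrite mdet1 oner_neq0 | exists 1; rewrite mscale1].
  have [|d1 d2] := IH; first by move=> y yu; apply: uL; rewrite inE yu orbT.
  have dx := fdet x (uL x (mem_head _ _)).
  by rewrite big_cons /= mmapM mdetM mulf_neq0 // ppermM // d2.
have [||phi phiM phiE] := sU _ F.
- move=> x xL; apply: (mulIg (F x)); rewrite mulVg /F; have [-> _] := hA x xL.
  have dx := fdet x xL; rewrite mmap_adj -ppermM ?mdet_adj // madj_mul; apply: pperm_scal.
    by rewrite mdetZ mdet1 mulr1 expf_neq0.
  by exists (mdet (mmap f (A x))).
- move=> r rr; have [|d1 <-] := Fword r; first by move=> x xr; apply/flattenP; exists r.
  by apply: pperm_scal => //; apply: scal_map; exact: hrel.
exists p; split=> //; exists phi => //.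
rewrite morph_word //; have -> : (\prod_(x <- w) phi x)%g = (\prod_(x <- w) F x)%g.
  by rewrite big_seq [RHS]big_seq; apply: eq_bigr => x /wL /phiE.
have [d1 <-] := Fword w wL; move=> /(pperm1_scal d1) /hF h0.
by rewrite h0 eqxx in fh.
Qed.

(** * Subgroups of finite index and word length *)

Section Stabilizer.
Variables (G : groupType) (T : finType) (phi : G -> {perm T}).
Hypothesis phiM : {morph phi : x y / (x * y)%g}.
Variable t : T.

Let H : {pred G} := fun x => phi x t == t.

Let stabE x : (x \in H) = (phi x t == t). Proof. by []. Qed.
Let phi1 : phi 1%g = 1%g.
Proof. by apply: (mulgI (phi 1%g)); rewrite -phiM !mulg1. Qed.
Let phiV x : phi x^-1%g = (phi x)^-1%g.
Proof. by apply: (mulIg (phi x)); rewrite -phiM !mulVg phi1. Qed.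

Let stab1 : 1%g \in H. Proof. by rewrite stabE phi1 perm1. Qed.
Let stabM x y : x \in H -> y \in H -> (x * y)%g \in H.
Proof. by rewrite !stabE phiM permM => /eqP -> /eqP ->. Qed.
Let stabV x : x \in H -> x^-1%g \in H.
Proof. by rewrite !stabE phiV => /eqP {1}<-; rewrite permK. Qed.

Definition stab : groupClosed G :=
  HB.pack H (isMul1Closed.Build G H stab1) (isMulClosed.Build G H stabM) (isInvClosed.Build G H stabV).

Lemma stab_index : exists2 k : nat, left_cosets stab #= `I_k & (k <= #|T|)%N.
Proof.
(* Permutations act on the right, so a left coset of the stabilizer is determined by [phi x^-1 t]
   and not by [phi x t]. *)
pose orb : set T := [set u | exists x, phi x^-1%g t = u].
pose f (u : T) : set G := [set y | phi y^-1%g t = u].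
have -> : left_cosets stab = f @` orb.
  apply/seteqP; split=> [X [x _ <-]|X [u [x <-] <-]].
    exists (phi x^-1%g t); first by exists x.
    apply/seteqP; split=> y /=.
      rewrite /f /= => e; exists (x^-1 * y)%g; last by rewrite mulKVg.
      by change (phi (x^-1 * y)%g t == t); rewrite phiM permM -e -permM -phiM mulVg phi1 perm1.
    move=> [h]; change (phi h t == t -> (x * h)%g = y -> f (phi x^-1%g t) y) => /eqP hh <-; rewrite /f /= invgM phiM permM.
    by congr (phi _ _); rewrite phiV -{1}hh permK.
  exists x => //; apply/seteqP; split=> y /=.
    move=> [h]; change (phi h t == t -> (x * h)%g = y -> phi y^-1%g t = phi x^-1%g t) => /eqP hh <-; rewrite /f /= invgM phiM permM.
    by congr (phi _ _); rewrite phiV -{1}hh permK.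
  rewrite /f /= => e; exists (x^-1 * y)%g; last by rewrite mulKVg.
  by change (phi (x^-1 * y)%g t == t); rewrite phiM permM -e -permM -phiM mulVg phi1 perm1.
have [k ok] := (finite_setP orb).1 (finite_finset (X := orb)).
exists k.
  apply: card_eq_trans ok; apply: inj_card_eq => u u'; rewrite !inE => -[x xu] _ e.
  have : f u x by [].
  by rewrite e /f /= xu.
rewrite -card_le_II -(card_le_eql ok).
have inj : {in orb &, injective (fun u : T => enum_rank u : nat)}.
  by move=> u u' _ _ /= /ord_inj /enum_rank_inj.
rewrite -(card_le_eql (inj_card_eq inj)); apply: subset_card_le.
by move=> n [u _ <-] /=; exact: ltn_ord.
Qed.
End Stabilizer.

Lemma finite_quotient_index (G : groupType) (T : finType) (phi : G -> {perm T}) (g : G) :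
  {morph phi : x y / (x * y)%g} -> phi g <> 1%g ->
  exists (H : groupClosed G) (k : nat), [/\ left_cosets H #= `I_k, (k <= #|T|)%N & g \notin H].
Proof.
move=> phiM pg; have [t tg] : exists t, phi g t != t.
  apply: contrapT => no; apply: pg; apply/permP => t; rewrite perm1.
  by apply/eqP; apply: contrapT => /negP h; apply: no; exists t.
have [k k1 k2] := stab_index phiM t.
by exists (stab phiM t), k.
Qed.

Section WordLength.
Variables (G : groupType) (s : seq G).

Lemma word_lengthP g : generates s -> exists2 w, spells s w g & size w = word_length s g.
Proof.
move=> gen; rewrite /word_length; case: xgetP => [n _ [//]|no].
have [w hw] := gen g; exfalso.
have ex : exists n, `[< exists2 w, spells s w g & size w = n >] by exists (size w); apply/asboolP; exists w.
case: (ex_minnP ex) => n /asboolP[w' hw' e] hmin; apply: (no n); split; first by exists w'.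
by move=> w2 hw2; apply: hmin; apply/asboolP; exists w2.
Qed.

(* [P g n] stands for: [g] has length at most [n] for another generating set. *)
Lemma word_length_le (P : G -> nat -> Prop) : generates s -> P 1%g 0%N ->
  (forall g h m n, P g m -> P h n -> P (g * h)%g (m + n)%N) ->
  (forall x, x \in s -> exists n, P x n /\ P x^-1%g n) ->
  exists C : nat, forall g, exists2 n, P g n & (n <= C * word_length s g)%N.
Proof.
move=> gen P1 PM Ps.
have [C hC] : exists C : nat, forall x, x \in s -> exists n, [/\ P x n, P x^-1%g n & (n <= C)%N].
  elim: (s) Ps => [|x s' IH] Ps; first by exists 0%N.
  have [|C hC] := IH; first by move=> y ys; apply: Ps; rewrite inE ys orbT.
  have [n [n1 n2]] := Ps x (mem_head _ _); exists (maxn C n) => y.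
  rewrite inE => /orP[/eqP ->|/hC[m [m1 m2 m3]]]; first by exists n; rewrite leq_maxr.
  by exists m; rewrite leq_max m3.
exists C => g; have [w [ws <-] <-] := word_lengthP g gen.
elim: w ws => [|x w IH] ws; first by exists 0%N; rewrite ?big_nil.
have [|n n1 n2] := IH; first by move=> y yw; apply: ws; rewrite inE yw orbT.
have [m m1 m2] : exists2 m, P x m & (m <= C)%N.
  case/orP: (ws x (mem_head _ _)) => /hC[m [m1 m2 m3]]; exists m => //.
  by rewrite -[x]invgK.
exists (m + n)%N; first by rewrite big_cons; exact: PM.
by rewrite mulnS leq_add.
Qed.
End WordLength.

(** * Surface groups *)

Theorem surface_case (R : realType) (S : topologicalType) (x : S) (G : groupType) (s : seq G) :
  closed_orientable_hyperbolic_surface R S -> is_fundamental_group R x G -> generates s ->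
  exists C : nat, forall g : G, g <> 1%g -> exists (H : groupClosed G) (k : nat),
    [/\ left_cosets H #= `I_k, (k <= C * word_length s g)%N & g \notin H].
Proof.
move=> hS hG gen; have [rho hrho] := surface_fuchsian hS hG.
have [rels hrels] := fuchsian_presentation hrho.
have [C hC] := linear_quotients hrho hrels.
pose P (g : G) n := exists w : seq G, [/\ {subset w <= letters rels}, (\prod_(y <- w) y)%g = g & (size w <= n)%N].
have [|||C' hC'] := @word_length_le G s P gen.
- by exists [::]; rewrite big_nil.
- move=> g h m n [u [u1 <- u2]] [v [v1 <- v2]]; exists (u ++ v); rewrite big_cat size_cat leq_add //.
  by split=> // y; rewrite mem_cat => /orP[/u1|/v1].
- move=> y _; have [u u1 u2] := sp_gen hrels y; have [v v1 v2] := sp_gen hrels y^-1%g.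
  exists (maxn (size u) (size v)); split; [exists u | exists v]; split=> //.
    by rewrite leq_maxl.
  by rewrite leq_maxr.
(* The index is at most [p + 1 <= 2 * p]. *)
exists (2 * C * C')%N => g g1; have [n [w [wL wg wn]] nC] := hC' g.
have [|p [pp pC [phi phiM phig]]] := hC w wL; first by rewrite wg.
rewrite wg in phig.
have [H [k [k1 k2 k3]]] := finite_quotient_index phiM phig.
exists H, k; split=> //; apply: (leq_trans k2).
rewrite card_option card_Fp //; have := prime_gt1 pp.
have : (C * size w <= C * (C' * word_length s g))%N by rewrite leq_mul2l (leq_trans wn) ?orbT.
rewrite -mulnA -mulnA; move: pC; move: (C * size w)%N (C * (C' * word_length s g))%N => a b; lia.
Qed.

(** * Free groups *)

(** Composing with the transposition of [sg x] and [y] corrects the value at [x] and leaves the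
    other pairs alone. *)
Lemma partial_perm (T : finType) (s : seq (T * T)) :
  (forall a b, a \in s -> b \in s -> a.1 = b.1 <-> a.2 = b.2) ->
  exists sg : {perm T}, forall a, a \in s -> sg a.1 = a.2.
Proof.
elim: s => [|[x y] s IH] h; first by exists 1%g.
have [|sg hsg] := IH; first by move=> a b ha hb; apply: h; rewrite inE ?ha ?hb orbT.
exists (sg * tperm (sg x) y)%g => a; rewrite inE permM => /orP[/eqP -> /=|ha]; first exact: tpermL.
have e := h (x, y) a (mem_head _ _); rewrite inE ha orbT in e; have {e}[e1 e2] := e isT.
have [E|E] := eqVneq a.1 x; first by rewrite E tpermL; exact: e1.
rewrite tpermD ?hsg //; first by rewrite -(hsg _ ha) (inj_eq perm_inj) eq_sym.
by apply/eqP => /e2 /esym /eqP; rewrite (negPf E).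
Qed.

Lemma rel_perm (T : finType) (Q : T -> T -> Prop) :
  (forall x y y', Q x y -> Q x y' -> y = y') -> (forall x x' y, Q x y -> Q x' y -> x = x') ->
  exists sg : {perm T}, forall x y, Q x y -> sg x = y.
Proof.
move=> hf hi; have [|sg hsg] := @partial_perm T [seq a <- enum {: T * T} | `[< Q a.1 a.2 >]].
  move=> [x y] [x' y'] /=; rewrite !mem_filter => /andP[/asboolP /= q _] /andP[/asboolP /= q' _].
  by split=> e; [apply: hf q _; rewrite e | apply: hi q _; rewrite e].
exists sg => x y q; apply: (hsg (x, y)); rewrite mem_filter mem_enum andbT.
exact/asboolP.
Qed.

(** * Words in a free basis *)

Section FormalWords.
Variables (G : groupType) (I : Type) (e : I -> G).
Implicit Types (w u v : seq (I * bool)) (g : G).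

Definition lval (a : I * bool) : G := if a.2 then e a.1 else (e a.1)^-1%g.
Definition wval w : G := (\prod_(a <- w) lval a)%g.

Lemma wval_cat u v : wval (u ++ v) = (wval u * wval v)%g.
Proof. exact: big_cat. Qed.

Lemma wval_inv w : exists2 v, wval v = (wval w)^-1%g & size v = size w.
Proof.
elim: w => [|[i b] w [v hv vs]]; first by exists [::]; rewrite // /wval !big_nil invg1.
exists (v ++ [:: (i, ~~ b)]); last by rewrite size_cat /= vs addn1.
rewrite wval_cat hv /wval !big_cons big_nil mulg1 invgM; congr (_ * _)%g.
by rewrite /lval /=; case: b => /=; rewrite ?invgK.
Qed.

Definition word_span : {pred G} := fun g => `[< exists w, wval w = g >].

Lemma word_span_closed : group_closed word_span.
Proof.
split; first by apply/asboolP; exists [::]; rewrite /wval big_nil.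
move=> _ _ /asboolP[u <-] /asboolP[v <-]; have [v' hv' _] := wval_inv v.
by apply/asboolP; exists (u ++ v'); rewrite wval_cat hv'.
Qed.

Definition word_span_type := {g : G | word_span g}.
HB.instance Definition _ := SubChoice.on word_span_type.
HB.instance Definition _ := SubChoice_isSubGroup.Build G word_span word_span_type word_span_closed.

(** The basis lies in the subgroup it spans; the induced map followed by the inclusion extends [e],
    as the identity does, so the two coincide. *)
Lemma free_basis_generates : free_basis e -> forall g, exists w, wval w = g.
Proof.
move=> he; have ei i : word_span (e i) by apply/asboolP; exists [:: (i, true)]; rewrite /wval big_cons big_nil mulg1.
have [phi [phie _]] := he word_span_type (fun i => Sub (e i) (ei i)).
have [psi [_ psiu]] := he G e.
move=> g; have h1 : g = psi g by exact: (psiu idfun).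
have h2 : val (phi g) = psi g.
  by apply: (psiu (val \o phi)) => i /=; rewrite phie SubK.
by have /asboolP := valP (phi g); rewrite h2 -h1.
Qed.

Lemma shortest_word_reduced w : (forall v, wval v = wval w -> (size w <= size v)%N) ->
  forall j i b, onth w j = Some (i, b) -> onth w j.+1 <> Some (i, ~~ b).
Proof.
move=> hmin j i b h1 h2; have [u [v [E su]]] : exists u v, w = u ++ [:: (i, b), (i, ~~ b) & v] /\ size u = j.
  elim: w j h1 h2 {hmin} => [|a w IH] [|j] //=.
    case: w {IH} => [|a' w] //= [->] [->]; by exists [::], w.
  by move=> h1 h2; have [u [v [-> <-]]] := IH j h1 h2; exists (a :: u), v.
have := hmin (u ++ v); rewrite E !wval_cat => H.
have : (size (u ++ [:: (i, b), (i, ~~ b) & v]) <= size (u ++ v))%N.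
  apply: H; congr (_ * _)%g; rewrite /wval !big_cons mulgA /lval /=.
  by case: b {h1 h2 E} => /=; rewrite ?mulgV ?mulVg mul1g.
by rewrite !size_cat /=; lia.
Qed.
Hypothesis basis : free_basis e.

Lemma reduced_word_moves w : (forall j i b, onth w j = Some (i, b) -> onth w j.+1 <> Some (i, ~~ b)) ->
  w <> [::] -> exists2 phi : G -> {perm 'I_(size w).+1}, {morph phi : x y / (x * y)%g} & phi (wval w) <> 1%g.
Proof.
move=> red wn.
(* A path labelled by [w], in which an inverse letter is an edge pointing backwards. Reducedness
   makes each [Q i] a partial bijection. *)
pose Q i (x y : 'I_(size w).+1) := (onth w x = Some (i, true) /\ y = x.+1 :> nat) \/
  (onth w y = Some (i, false) /\ x = y.+1 :> nat).
have [sg hsg] : exists sg : I -> {perm 'I_(size w).+1}, forall i x y, Q i x y -> sg i x = y.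
  have ex i : exists sg : {perm 'I_(size w).+1}, forall x y, Q i x y -> sg x = y.
    apply: rel_perm => [x y y'|x x' y] [[h1 h2]|[h1 h2]] [[h3 h4]|[h3 h4]]; apply: ord_inj.
    - by rewrite h2 h4.
    - by case: (red _ _ _ h3); rewrite -h4.
    - by case: (red _ _ _ h1); rewrite -h2.
    - by apply: succn_inj; rewrite -h2 -h4.
    - by apply: succn_inj; rewrite -h2 -h4.
    - by case: (red _ _ _ h1); rewrite -h2.
    - by case: (red _ _ _ h3); rewrite -h4.
    - by rewrite h2 h4.
  by have [f hf] := choice ex; exists f.
have [phi [phie _]] := basis sg.
have phiM : {morph phi : x y / (x * y)%g} by exact: gmulfM.
have phi1 : phi 1%g = 1%g by apply: (mulgI (phi 1%g)); rewrite -phiM !mulg1.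
have phiV x : phi x^-1%g = (phi x)^-1%g by apply: (mulgI (phi x)); rewrite -phiM !mulgV.
exists phi => // h.
have path v u : w = u ++ v -> phi (wval v) (inord (size u)) = ord_max.
  elim: v u => [|[i b] v IH] u E.
    by rewrite /wval big_nil phi1 perm1; apply: ord_inj; rewrite inordK /= E cats0.
  have su : (size u < size w)%N by rewrite E size_cat /= -addSnnS leq_addr.
  have oa : onth w (size u) = Some (i, b) by rewrite E onth_cat ltnn subnn.
  rewrite /wval big_cons phiM permM -/(wval v).
  have -> : phi (lval (i, b)) (inord (size u)) = inord (size u).+1.
    have v1 : (inord (size u) : 'I_(size w).+1) = size u :> nat by rewrite inordK // ltnW.
    have v2 : (inord (size u).+1 : 'I_(size w).+1) = (size u).+1 :> nat by rewrite inordK.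
    rewrite /lval /=; case: b oa {E} => oa.
      by rewrite phie; apply: hsg; left; rewrite v1 v2.
    rewrite phiV phie; apply: (canLR (permK _)); apply/esym.
    by apply: hsg; right; rewrite v1 v2.
  by have := IH (u ++ [:: (i, b)]); rewrite size_cat addn1; apply; rewrite -catA.
have := path w [::] erefl; rewrite h perm1 => /(congr1 val) /=.
rewrite inordK // => e0; apply: wn; apply: size0nil.
by rewrite -e0.
Qed.

End FormalWords.

Theorem free_case (G : groupType) (s : seq G) : free_group G -> generates s ->
  exists C : nat, forall g : G, g <> 1%g -> exists (H : groupClosed G) (k : nat),
    [/\ left_cosets H #= `I_k, (k <= C * word_length s g)%N & g \notin H].
Proof.
move=> [I [e basis]] gen.
pose P (g : G) n := exists w, wval e w = g /\ (size w <= n)%N.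
have [|||C hC] := @word_length_le G s P gen.
- by exists [::]; rewrite /wval big_nil.
- by move=> g h m n [u [<- u1]] [v [<- v1]]; exists (u ++ v); rewrite wval_cat size_cat leq_add.
- move=> x _; have [w hw] := free_basis_generates basis x.
  have [v hv vs] := wval_inv e w; exists (size w); split; first by exists w.
  by exists v; rewrite hv hw vs.
(* The permutations act on [size w + 1] points, at most twice the length of a nonempty word. *)
exists (2 * C)%N => g g1; have [n [w0 [w0g w0n]] nC] := hC g.
have ex : exists n, `[< exists w, wval e w = g /\ size w = n >] by exists (size w0); apply/asboolP; exists w0.
case: (ex_minnP ex) => m /asboolP[w [wg wm]] hmin.
have min v : wval e v = wval e w -> (size w <= size v)%N.
  by rewrite wg wm => vg; apply: hmin; apply/asboolP; exists v.
have wn : w <> [::] by move=> w0'; apply: g1; rewrite -wg w0' /wval big_nil.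
have [phi phiM] := reduced_word_moves basis (shortest_word_reduced min) wn; rewrite wg => phig.
have [H [k [k1 k2 k3]]] := finite_quotient_index phiM phig.
exists H, k; split=> //; apply: (leq_trans k2); rewrite card_ord.
have : (size w <= size w0)%N by apply: min; rewrite wg.
have : (0 < size w)%N by case: (w) wn.
rewrite -mulnA; move: w0n nC; move: (C * word_length s g)%N => a; lia.
Qed.

Theorem theorem6p1 (R : realType) (G : groupType) (s : seq G)
    (G_surface : surface_group R G) (s_gen : generates s) :
  exists C : R, forall g : G, g <> 1%g ->
    exists (H : groupClosed G) (k : nat),
      [/\ left_cosets H #= `I_k,
          k%:R <= C * (word_length s g)%:R
        & g \notin H].
Proof.
have [C hC] : exists C : nat, forall g : G, g <> 1%g -> exists (H : groupClosed G) (k : nat),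
    [/\ left_cosets H #= `I_k, (k <= C * word_length s g)%N & g \notin H].
  case: G_surface => [[_ fr]|[S [x [hS hG]]]]; first exact: free_case.
  exact: surface_case hS hG s_gen.
exists C%:R => g /hC[H [k [k1 k2 k3]]]; exists H, k; split=> //.
by rewrite -natrM ler_nat.
Qed.
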